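(* Let $f(z)=\sum_{n=0}^{\infty}a_nz^n\in\mathcal{B}$, and let $S_r$ denote the area of the Riemann surface of the function $f^{-1}$ defined on the image of the sub-disk $|z|<r$ under the mapping $f$, i.e. $S_r=\int_{|z|<r}|f'(z)|^2\,dA(z)$. Then $$\mathcal{G}_{2,f}(r):=|f(z)|+|f'(z)|\,r+\sum_{n=2}^{\infty}|a_n|r^n+\left(\frac{1}{1+|a_0|}+\frac{r}{1-r}\right)\sum_{n=1}^{\infty}|a_n|^2r^{2n}+\lambda\left(\frac{S_r}{\pi-S_r}\right)\le 1$$ for $|z|=r\le(\sqrt{17}-3)/4$, where the numbers $\lambda=(221-43\sqrt{17})/64$ and $(\sqrt{17}-3)/4$ cannot be improved. The equality $\mathcal{G}_{2,f}(r)=1$ is achieved for the function $f_a$.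
   Context: $\mathbb{D}=\{z\in\mathbb{C}:|z|<1\}$, and $\mathcal{B}$ is the class of analytic functions $f$ on $\mathbb{D}$ with $\sup_{z\in\mathbb{D}}|f(z)|\le 1$. The $a_n=f^{(n)}(0)/n!$ are the Taylor coefficients of $f$ at $0$. Here $dA$ is planar Lebesgue measure, so that $S_r/\pi=\sum_{n=1}^{\infty}n|a_n|^2r^{2n}$. For $a\in[0,1)$, $f_a(z)=\dfrac{a-z}{1-az}$. ''Cannot be improved'' means: the radius $(\sqrt{17}-3)/4$ cannot be replaced by a larger one, and the constant $\lambda$ cannot be replaced by a larger one, with the inequality still holding for all $f\in\mathcal{B}$.
   Formalization: Equality G=1 for f_a fails for every a in [0,1) (for a=0, r=(√17−3)/4, G is about 0.73); it is replaced by: at z=−(√17−3)/4, G for f_a tends to 1 as a→1⁻, and (1−G)/(1−a)² tends to 0. *)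

(* Defs.v *)
From HB Require Import structures.
From mathcomp Require Import all_boot all_order all_algebra.
From mathcomp Require Import complex.
From mathcomp Require Import all_classical all_reals all_analysis.

Set Implicit Arguments.
Unset Strict Implicit.
Unset Printing Implicit Defensive.

Import Order.TTheory GRing.Theory Num.Theory numFieldNormedType.Exports.

Local Open Scope classical_set_scope.
Local Open Scope ring_scope.
Local Open Scope complex_scope.

(* R[i] itself carries no canonical topology.  Packing it as a
   numClosedFieldType gives access to the norm topology and to the complex
   derivative derive1. *)
Definition cplx (R : realType) : numClosedFieldType := R[i].

(* In MathComp `|z| is an element of R[i] with zero imaginary part. *)
Definition cmod (R : realType) (z : cplx R) : R := complex.Re `|z|.

Definition unit_disk (R : realType) : set (cplx R) := [set z | cmod z < 1].

Definition analytic_at (R : realType) (f : cplx R -> cplx R) (z0 : cplx R) :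
    Prop :=
  exists c : nat -> cplx R,
    \forall z \near z0, series (fun n => c n * (z - z0) ^+ n) @ \oo --> f z.

(* Only the restriction of f to the unit disk matters. *)
Definition classB (R : realType) (f : cplx R -> cplx R) : Prop :=
  (forall z, unit_disk z -> analytic_at f z) /\
  (forall z, unit_disk z -> cmod (f z) <= 1).

Definition taylor_coef (R : realType) (f : cplx R -> cplx R) (n : nat) :
    cplx R :=
  derive1n n f 0 / n`!%:R.

Definition image_area (R : realType) (f : cplx R -> cplx R) (r : R) : \bar R :=
  (\int[lebesgue_measure \x lebesgue_measure]_(p in
      [set p : measurableTypeR R * measurableTypeR R |
        (cmod (p.1 +i* p.2 : cplx R) < r)%R])
    (cmod (derive1 f (p.1 +i* p.2 : cplx R)) ^+ 2)%:E)%E.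

(* The sums are taken in \bar R, so that they are meaningful without a
   convergence hypothesis.  The quotient involving the area is the intended one
   as soon as image_area f (cmod z) < pi%:E. *)
Definition bohr_G2 (R : realType) (lambda : R) (f : cplx R -> cplx R)
    (z : cplx R) : \bar R :=
  let r := cmod z in
  let a := fun n => cmod (taylor_coef f n) in
  let S := fine (image_area f r) in
  ((cmod (f z) + cmod (derive1 f z) * r)%:E
   + \sum_(2 <= n <oo) (a n * r ^+ n)%:E
   + ((1 + a 0%N)^-1 + r / (1 - r))%:E
     * \sum_(1 <= n <oo) (a n ^+ 2 * r ^+ (2 * n))%:E
   + (lambda * (S / (pi - S)))%:E)%E.

Definition bohr_radius (R : realType) : R := (Num.sqrt 17 - 3) / 4.

Definition bohr_lambda (R : realType) : R := (221 - 43 * Num.sqrt 17) / 64.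

Definition blaschke (R : realType) (a : R) (z : cplx R) : cplx R :=
  (a%:C - z) / (1 - a%:C * z).

(* Main.v *)
(* Averaging over roots of unity gives a discrete Parseval identity, hence the
   Cauchy estimates, and these continue the Taylor expansion of f at 0 to the whole
   disc.  Multiplication by f contracts the Hardy space, so the lower triangular
   Toeplitz matrices of the a_n are contractions.  Well chosen test vectors yield
   |a_(2n+1)| + |a_0|^2 + ... + |a_n|^2 <= 1, its sharper even analogue, and
   bounds on sum n |a_n|^2 r^(2n); the adjoint, applied to reproducing kernels,
   yields the Schwarz-Pick bounds on |f(z)| and |f'(z)|.  Together they bound
   G_2 by a function Phi(|a_0|, r), which is the value of G_2 for f_a at -r.
   When 2 r^2 + 3 r = 1, Phi(a, r) = 1 - (1 - a)^3 Q(a) / D(a) with Q >= 0 and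
   D > 0, and contact of order 3 at a = 1 leaves no room for a larger lambda; for
   larger r, Phi exceeds 1 to first order in 1 - a. *)
Require Import Defs.
From HB Require Import structures.
From mathcomp Require Import all_boot all_order all_algebra.
From mathcomp Require Import complex ring lra zify.
From mathcomp Require Import all_classical all_reals all_analysis.
From mathcomp Require Import measurable_realfun.

Import Order.TTheory GRing.Theory Num.Theory numFieldNormedType.Exports.

Local Open Scope classical_set_scope.
Local Open Scope ring_scope.
Local Open Scope complex_scope.

Set Implicit Arguments.
Unset Strict Implicit.
Unset Printing Implicit Defensive.

(** G_2 splits into three groups: |f| + r |f'|, the tail of moduli together with the weighted
    squares, and the area term. Each is bounded separately by its value for [f_a] with a = |a_0|,
    and [f_a] at z = -r attains all three bounds at once, so the splitting loses nothing. Phi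
    increases with r, hence only the critical radius has to be examined for the inequality. Both
    constants come from expanding 1 - Phi in powers of 1 - a. The coefficient of 1 - a does not
    involve lambda and fixes the radius; at that radius the coefficient of (1 - a)^2 is affine in
    lambda and vanishes exactly for the stated lambda. Since Q(a) > 0 on [0, 1), at this radius each
    [f_a] stays strictly below 1 and the value 1 is only approached as a tends to 1; extremality is
    therefore a statement about limits. Analyticity provides local power series of unspecified
    radii, so the expansion at 0 must reach the whole disc before any coefficient estimate can
    start. *)

(** * Modulus, power series and Parseval at roots of unity *)

Section Cmod.
Variable R : realType.
Local Notation C := (cplx R).
Implicit Types z w : C.

Lemma normE z : `|z| = (cmod z)%:C :> C.
Proof. by rewrite /cmod; case: z => x y; rewrite normc_def. Qed.

Lemma cmodE z : cmod z = Num.sqrt (complex.Re z ^+ 2 + complex.Im z ^+ 2).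
Proof. by rewrite /cmod; case: z => x y; rewrite normc_def. Qed.

Lemma cmod_sqr z : cmod z ^+ 2 = complex.Re z ^+ 2 + complex.Im z ^+ 2.
Proof. by rewrite cmodE sqr_sqrtr // addr_ge0 // sqr_ge0. Qed.

Lemma cmod_ge0 z : 0 <= cmod z. Proof. by rewrite cmodE sqrtr_ge0. Qed.

Lemma real_complex_inj (x y : R) : (x%:C : C) = y%:C -> x = y.
Proof. by move=> []. Qed.

Lemma cmodM z w : cmod (z * w) = cmod z * cmod w.
Proof. by apply: real_complex_inj; rewrite rmorphM /= -!normE normrM. Qed.

Lemma cmod0 : cmod (0 : C) = 0.
Proof. by apply: real_complex_inj; rewrite -normE normr0. Qed.

Lemma cmod1 : cmod (1 : C) = 1.
Proof. by apply: real_complex_inj; rewrite -normE normr1. Qed.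

Lemma cmodN z : cmod (- z) = cmod z.
Proof. by apply: real_complex_inj; rewrite -!normE normrN. Qed.

Lemma cmodBC z w : cmod (z - w) = cmod (w - z).
Proof. by rewrite -opprB cmodN. Qed.

Lemma cmodX z n : cmod (z ^+ n) = cmod z ^+ n.
Proof. by elim: n => [|n IH]; rewrite ?cmod1 // !exprS cmodM IH. Qed.

Lemma cmodV z : cmod z^-1 = (cmod z)^-1.
Proof.
apply: real_complex_inj; rewrite -normE normfV normE.
by rewrite -[RHS]/((real_complex R) _) fmorphV.
Qed.

Lemma cmod_real (x : R) : cmod (x%:C : C) = `|x|.
Proof. by rewrite cmodE /= expr0n addr0 sqrtr_sqr. Qed.

Lemma cmod_eq0 z : (cmod z == 0) = (z == 0).
Proof.
rewrite -(normr_eq0 z) normE; apply/eqP/eqP => [->//|h].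
by apply: (@real_complex_inj _ 0).
Qed.

Lemma ler_cmodD z w : cmod (z + w) <= cmod z + cmod w.
Proof. by rewrite -lecR rmorphD /= -!normE ler_normD. Qed.

Lemma ler_cmodB z w : cmod z - cmod w <= cmod (z - w).
Proof. by rewrite lerBlDr; have := ler_cmodD (z - w) w; rewrite subrK. Qed.

Lemma ler_cmod_sum (I : Type) (r : seq I) (P : pred I) (F : I -> C) :
  cmod (\sum_(i <- r | P i) F i) <= \sum_(i <- r | P i) cmod (F i).
Proof.
apply: (big_ind2 (fun z x => cmod z <= x)) => //; first by rewrite cmod0.
by move=> z x w y zx wy; rewrite (le_trans (ler_cmodD _ _))// lerD.
Qed.

Lemma Re_le_cmod z : `|complex.Re z| <= cmod z.
Proof.
rewrite -(ler_pXn2r (_ : 0 < 2)%N) ?nnegrE ?cmod_ge0// cmod_sqr.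
by rewrite real_normK ?num_real// lerDl sqr_ge0.
Qed.

Lemma Im_le_cmod z : `|complex.Im z| <= cmod z.
Proof.
rewrite -(ler_pXn2r (_ : 0 < 2)%N) ?nnegrE ?cmod_ge0// cmod_sqr.
by rewrite real_normK ?num_real// lerDr sqr_ge0.
Qed.

Lemma cmod_le_ReIm z : cmod z <= `|complex.Re z| + `|complex.Im z|.
Proof.
rewrite -(ler_pXn2r (_ : 0 < 2)%N) ?nnegrE ?cmod_ge0 ?addr_ge0// cmod_sqr.
rewrite sqrrD !real_normK ?num_real//.
by rewrite lerD2r lerDl mulrn_wge0 // mulr_ge0.
Qed.

Definition cj z : C := conjc z.

Lemma cjD z w : cj (z + w) = cj z + cj w.
Proof. by rewrite /cj -[LHS]/((conjc (R := R)) _) rmorphD. Qed.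
Lemma cjM z w : cj (z * w) = cj z * cj w.
Proof. by rewrite /cj -[LHS]/((conjc (R := R)) _) rmorphM. Qed.
Lemma cjN z : cj (- z) = - cj z.
Proof. by rewrite /cj -[LHS]/((conjc (R := R)) _) rmorphN. Qed.
Lemma cj0 : cj 0 = 0. Proof. exact: conjc0. Qed.
Lemma cj1 : cj 1 = 1. Proof. exact: conjc1. Qed.
Lemma cjX z n : cj (z ^+ n) = cj z ^+ n.
Proof. by elim: n => [|n IH]; rewrite ?cj1 // !exprS cjM IH. Qed.
Lemma cj_sum (I : Type) (r : seq I) (P : pred I) (F : I -> C) :
  cj (\sum_(i <- r | P i) F i) = \sum_(i <- r | P i) cj (F i).
Proof. by apply: (big_morph cj); [exact: cjD|exact: cj0]. Qed.
Lemma cmod_cj z : cmod (cj z) = cmod z.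
Proof. by apply: real_complex_inj; rewrite -!normE; apply: normcJ. Qed.
Lemma mul_cj z : z * cj z = (cmod z ^+ 2)%:C.
Proof. by rewrite rmorphXn /= -normE; symmetry; exact: sqr_normc. Qed.
Lemma cj_real (x : R) : cj x%:C = x%:C. Proof. exact: conjc_real. Qed.

Lemma Re_sum (I : Type) (r : seq I) (P : pred I) (F : I -> C) :
  complex.Re (\sum_(i <- r | P i) F i) = \sum_(i <- r | P i) complex.Re (F i).
Proof. by apply: (big_morph (@complex.Re R)) => // -[a b] [c d]. Qed.
Lemma Im_sum (I : Type) (r : seq I) (P : pred I) (F : I -> C) :
  complex.Im (\sum_(i <- r | P i) F i) = \sum_(i <- r | P i) complex.Im (F i).
Proof. by apply: (big_morph (@complex.Im R)) => // -[a b] [c d]. Qed.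

Lemma real_complex_sum (I : Type) (r : seq I) (P : pred I) (F : I -> R) :
  ((\sum_(i <- r | P i) F i)%:C : C) = \sum_(i <- r | P i) (F i)%:C.
Proof. by apply: (big_morph (real_complex R)) => //; exact: rmorphD. Qed.

(** A positive element of [R[i]] has zero imaginary part, so balls have real radii and complex
    convergence can be tested on the real-valued [cmod]. *)
Lemma cvgCP (T : Type) (F : set_system T) (FF : ProperFilter F) (u : T -> C) (l : C) :
  u @ F --> l <-> cmod (u x - l) @[x --> F] --> (0 : R).
Proof.
split.
  move=> /cvgrPdist_lt h; apply/cvgrPdist_lt => e e0.
  have := h e%:C; rewrite ltcR => /(_ e0).
  apply: filterS => t; rewrite normE ltcR cmodBC => H.
  by rewrite sub0r normrN ger0_norm ?cmod_ge0.
move=> /cvgrPdist_lt h; apply/cvgrPdist_lt => -[e e']; rewrite ltcE /= => /andP[/eqP ->] e0.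
have := h e e0; apply: filterS => t; rewrite sub0r normrN ger0_norm ?cmod_ge0// => H.
by rewrite normE -[X in _ < X]/(e%:C) ltcR cmodBC.
Qed.

Lemma nbhsCP (z0 : C) (P : C -> Prop) : (\forall z \near z0, P z) <->
  exists2 e : R, 0 < e & forall z, cmod (z - z0) < e -> P z.
Proof.
split.
  move=> /nbhs_ballP [[e e']] /=; rewrite ltcE /= => /andP[/eqP ->] e0 H.
  exists e => // z zz0; apply: H; rewrite /ball /= normE -[X in _ < X]/(e%:C) ltcR cmodBC //.
move=> [e e0 H]; apply/nbhs_ballP; exists e%:C; first by rewrite /= ltcR.
by move=> z; rewrite /ball /= normE ltcR cmodBC; exact: H.
Qed.

Lemma cvgC_unique (u : nat -> C) (l l' : C) : u @ \oo --> l -> u @ \oo --> l' -> l = l'.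
Proof. by move=> h h'; apply: (cvg_unique _ h h'). Qed.

(** In characteristic 0 the polynomial X^n - 1 is separable, so over an algebraically closed field
    it has n distinct roots, and n distinct n-th roots of unity include a primitive one. *)
Lemma prim_root_exists (n : nat) : (0 < n)%N -> exists z : C, n.-primitive_root z.
Proof.
pose p : {poly C} := 'X^n - 1; have [r Dp] := closed_field_poly_normal p.
move=> n_gt0; rewrite (monicP _) ?monicXnsubC // scale1r in Dp.
have rn1: all n.-unity_root r by apply/allP=> z; rewrite -root_prod_XsubC -Dp.
have sz_r: (n < (size r).+1)%N.
  by rewrite -(size_prod_XsubC r id) -Dp size_XnsubC.
have [|z] := hasP (cyclic.has_prim_root n_gt0 rn1 _ sz_r); last by exists z.
by rewrite -separable.separable_prod_XsubC -Dp cyclotomic.separable_Xn_sub_1 // pnatr_eq0 -lt0n.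
Qed.

End Cmod.

(** * Absolutely convergent power series *)

Section Series.
Variable R : realType.
Local Notation C := (cplx R).

(** The bound [t n] is uniform in the upper end m, so later proofs can truncate a series with an
    error tending to 0 without handling its limit. *)
Lemma bounded_series_tail (a : nat -> R) (B : R) : (forall n, 0 <= a n) ->
  (forall n, \sum_(0 <= k < n) a k <= B) ->
  exists t : nat -> R, [/\ t @ \oo --> 0, forall n, 0 <= t n &
    forall n m, \sum_(n <= k < m) a k <= t n].
Proof.
move=> a0 aB.
have nd : nondecreasing_seq (series a).
  apply/nondecreasing_seqP => n; rewrite /series /= big_nat_recr//= lerDl//.
have cv : cvgn (series a).
  by apply: nondecreasing_is_cvgn => //; exists B => _ [n _ <-]; exact: aB.
exists (fun n => limn (series a) - series a n); split.
- have -> : (0 : R) = limn (series a) - limn (series a) by rewrite subrr.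
  by apply: cvgB => //; exact: cvg_cst.
- by move=> n; rewrite subr_ge0 nondecreasing_cvgn_le.
- move=> n m; case: (leqP n m) => nm; last by rewrite big_geq ?(ltnW nm)// subr_ge0 nondecreasing_cvgn_le.
  have := nondecreasing_cvgn_le nd cv m.
  by rewrite {1}/series /= (@big_cat_nat _ _ _ n)//= lerBrDl.
Qed.

Lemma sum_nat_split (V : nmodType) (a : nat -> V) n m : (n <= m)%N ->
  \sum_(0 <= k < m) a k = \sum_(0 <= k < n) a k + \sum_(n <= k < m) a k.
Proof. by move=> nm; rewrite (@big_cat_nat _ _ _ n). Qed.

Definition asum (u : nat -> C) := exists B : R, forall n, \sum_(0 <= k < n) cmod (u k) <= B.

(** Summed by components, where completeness of [R] supplies the limits; meaningful under [asum]. *)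
Definition csum (u : nat -> C) : C :=
  limn (series (fun k => complex.Re (u k))) +i* limn (series (fun k => complex.Im (u k))).

Lemma asum_cvg (u : nat -> C) : asum u -> series u @ \oo --> csum u.
Proof.
move=> [B uB].
have key (p : C -> R) : (forall z, `|p z| <= cmod z) -> cvgn (series (fun k => p (u k))).
  move=> pz; apply: normed_cvg; apply: nondecreasing_is_cvgn.
    by apply/nondecreasing_seqP => n; rewrite [X in _ <= X]/series /= big_nat_recr//= lerDl.
  exists B => _ [n _ <-]; apply: le_trans (uB n); apply: ler_sum => k _; exact: pz.
have /cvgrPdist_lt hR := key _ (@Re_le_cmod R).
have /cvgrPdist_lt hI := key _ (@Im_le_cmod R).
apply/cvgCP/cvgrPdist_lt => e e0.
have e20 : 0 < e / 2 by lra.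
move: (hR _ e20) (hI _ e20); apply: filterS2 => n /= h1 h2.
rewrite sub0r normrN ger0_norm ?cmod_ge0// cmodBC.
have H := cmod_le_ReIm (csum u - series u n); apply: (le_lt_trans H).
rewrite (splitr e); apply: ltrD.
  suff -> : complex.Re (csum u - series u n : C) =
    limn (series (fun k => complex.Re (u k))) - series (fun k => complex.Re (u k)) n by [].
  by rewrite /csum /series /= -Re_sum; case: (\sum_(_ <= _ < _) u _).
suff -> : complex.Im (csum u - series u n : C) =
    limn (series (fun k => complex.Im (u k))) - series (fun k => complex.Im (u k)) n by [].
by rewrite /csum /series /= -Im_sum; case: (\sum_(_ <= _ < _) u _).
Qed.

Lemma cvgC_limit_le (u : nat -> C) (l w : C) (t : R) n : u @ \oo --> l ->
  (forall m, (n <= m)%N -> cmod (u m - w) <= t) -> cmod (l - w) <= t.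
Proof.
move=> /cvgCP/cvgrPdist_lt ul h; apply/ler_addgt0Pr => e e0.
have [N _ /(_ (maxn N n) (leq_maxl _ _))] := ul e e0.
rewrite /= sub0r normrN ger0_norm ?cmod_ge0// => h1.
have -> : l - w = - (u (maxn N n) - l) + (u (maxn N n) - w) by ring.
apply: le_trans (ler_cmodD _ _) _; rewrite cmodN addrC; apply: lerD; last exact: ltW.
by apply: h; exact: leq_maxr.
Qed.

Lemma series_tail_le (u : nat -> C) (l : C) (t : R) n : series u @ \oo --> l ->
  (forall m, \sum_(n <= k < m) cmod (u k) <= t) -> cmod (l - \sum_(0 <= k < n) u k) <= t.
Proof.
move=> ul h; apply: (cvgC_limit_le (n := n) ul) => m nm.
rewrite /series /= (sum_nat_split _ nm) addrAC subrr add0r.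
exact: le_trans (ler_cmod_sum _ _ _) (h m).
Qed.

Lemma asum_le (u : nat -> C) (a : nat -> R) (B : R) : (forall n, cmod (u n) <= a n) ->
  (forall n, \sum_(0 <= k < n) a k <= B) -> asum u.
Proof. by move=> ua aB; exists B => n; apply: le_trans (aB n); apply: ler_sum. Qed.

Lemma geom_sum (F : fieldType) (x : F) n : x != 1 -> \sum_(0 <= k < n) x ^+ k = (1 - x ^+ n) / (1 - x).
Proof.
move=> x1; have x1' : 1 - x != 0 by rewrite subr_eq0 eq_sym.
elim: n => [|n IH]; first by rewrite big_nil expr0 subrr mul0r.
rewrite big_nat_recr//= IH exprS; field; exact: x1'.
Qed.

Lemma geom_bound (x : R) n : 0 <= x < 1 -> \sum_(0 <= k < n) x ^+ k <= (1 - x)^-1.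
Proof.
move=> /andP[x0 x1]; rewrite geom_sum ?lt_eqF//.
by rewrite ler_pdivrMr ?subr_gt0// mulVf ?gt_eqF ?subr_gt0// gerBl exprn_ge0.
Qed.

Definition pconv (c : nat -> C) (r : R) :=
  exists B : R, forall n, \sum_(0 <= k < n) cmod (c k) * r ^+ k <= B.

Lemma pconv_le c r s : 0 <= r <= s -> pconv c s -> pconv c r.
Proof.
move=> /andP[r0 rs] [B h]; exists B => n; apply: le_trans (h n).
by apply: ler_sum => k _; rewrite ler_wpM2l ?cmod_ge0// lerXn2r// nnegrE// (le_trans r0).
Qed.

Lemma pconv_asum c r (z : C) : pconv c r -> cmod z <= r -> asum (fun k => c k * z ^+ k).
Proof.
move=> [B h] zr; apply: asum_le h => n.
by rewrite cmodM cmodX ler_wpM2l ?cmod_ge0// lerXn2r ?nnegrE ?cmod_ge0// (le_trans (cmod_ge0 z)).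
Qed.

(** Abel's lemma: the terms at radius r are at most M (r / s)^k, a convergent geometric series. *)
Lemma pconv_bounded c r s (M : R) : 0 <= r < s -> (forall n, cmod (c n) * s ^+ n <= M) -> pconv c r.
Proof.
move=> /andP[r0 rs] h; have s0 : 0 < s by apply: le_lt_trans rs.
have M0 : 0 <= M by apply: le_trans (h 0%N); rewrite mulr_ge0 ?cmod_ge0// exprn_ge0// ltW.
exists (M * (1 - r / s)^-1) => n.
apply: (@le_trans _ _ (\sum_(0 <= k < n) M * (r / s) ^+ k)).
  apply: ler_sum => k _; have -> : cmod (c k) * r ^+ k = cmod (c k) * s ^+ k * (r / s) ^+ k.
    by rewrite -mulrA -exprMn mulrCA divff ?mulr1// gt_eqF.
  by rewrite ler_wpM2r// exprn_ge0// divr_ge0// ltW.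
rewrite -big_distrr /= ler_wpM2l// geom_bound// divr_ge0 ?(ltW s0)//=.
by rewrite ltr_pdivrMr// mul1r.
Qed.

Definition ps (c : nat -> C) (z : C) : C := csum (fun k => c k * z ^+ k).

Lemma ps_cvg c r z : pconv c r -> cmod z <= r -> series (fun k => c k * z ^+ k) @ \oo --> ps c z.
Proof. by move=> h zr; apply: asum_cvg; exact: pconv_asum h zr. Qed.

(** Weierstrass M-test: the tail of |c_k| r^k bounds the remainder at every point of the closed
    disc. *)
Lemma ps_uniform c r : 0 <= r -> pconv c r -> exists t : nat -> R,
  [/\ t @ \oo --> 0, forall n, 0 <= t n &
   forall z, cmod z <= r -> forall n, cmod (ps c z - \sum_(0 <= k < n) c k * z ^+ k) <= t n].
Proof.
move=> r0 cr; have [B h] := cr.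
have [t [t0 tp tn]] := bounded_series_tail (fun n => mulr_ge0 (cmod_ge0 (c n)) (exprn_ge0 n r0)) h.
exists t; split => // z zr n; apply: series_tail_le; first exact: ps_cvg zr.
move=> m; apply: le_trans (tn n m); apply: ler_sum => k _.
by rewrite cmodM cmodX ler_wpM2l ?cmod_ge0// lerXn2r ?nnegrE ?cmod_ge0.
Qed.

(** Only pointwise convergence on the open disc is asked; absolute convergence on smaller discs
    follows by [rep_pconv]. *)
Definition rep (f : C -> C) (c : nat -> C) (z0 : C) (s : R) :=
  forall z, cmod (z - z0) < s -> series (fun k => c k * (z - z0) ^+ k) @ \oo --> f z.

Lemma cvg_bounded_terms (u : nat -> C) (l : C) : series u @ \oo --> l -> exists M : R, forall n, cmod (u n) <= M.
Proof.
move=> /cvgCP/cvgrPdist_lt/(_ 1 ltr01)[N _ h].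
(* From N on, a term is the difference of two partial sums within 1 of the limit, hence at most 2;
   the earlier terms are absorbed by their sum. *)
pose M := \sum_(0 <= k < N) cmod (u k) + 2.
exists M => n; case: (ltnP n N) => nN.
  rewrite /M (@big_cat_nat _ _ _ n)//=; last exact: ltnW.
  rewrite (big_ltn nN) addrCA -!addrA lerDl ?addr_ge0 ?sumr_ge0// => *; exact: cmod_ge0.
have -> : u n = (series u n.+1 - l) - (series u n - l).
  by rewrite /series /= big_nat_recr//=; ring.
apply: le_trans (ler_cmodD _ _) _; rewrite cmodN.
have h1 := h _ nN; have h2 := h n.+1 (leq_trans nN (leqnSn _)).
move: h1 h2; rewrite /= !sub0r !normrN !ger0_norm ?cmod_ge0// => h1 h2.
have : 0 <= \sum_(0 <= k < N) cmod (u k) by apply: sumr_ge0 => *; exact: cmod_ge0.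
rewrite /M; lra.
Qed.

Lemma rep_pconv f c z0 s r : rep f c z0 s -> 0 <= r < s -> pconv c r.
Proof.
move=> h /andP[r0 rs]; pose q := (r + s) / 2.
have qs : q < s by rewrite /q; lra.
have q0 : 0 <= q by rewrite /q; lra.
have := h (z0 + q%:C); rewrite addrAC subrr add0r cmod_real ger0_norm// => /(_ qs)/cvg_bounded_terms[M hM].
apply: (@pconv_bounded _ _ q M); first by apply/andP; split => //; rewrite /q; lra.
by move=> n; have := hM n; rewrite cmodM cmodX cmod_real ger0_norm.
Qed.

Lemma rep_ps f c z0 s z : rep f c z0 s -> cmod (z - z0) < s -> f z = ps c (z - z0).
Proof.
move=> h zs; have pc : pconv c (cmod (z - z0)) by apply: (rep_pconv h); rewrite cmod_ge0.
exact: cvgC_unique (h z zs) (ps_cvg pc (lexx _)).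
Qed.

Lemma ps_rep f c z0 s : (forall r, 0 <= r < s -> pconv c r) ->
  (forall z, cmod (z - z0) < s -> f z = ps c (z - z0)) -> rep f c z0 s.
Proof.
move=> pc h z zs; rewrite h//.
by apply: (@ps_cvg c (cmod (z - z0))) => //; apply: pc; rewrite cmod_ge0.
Qed.

End Series.

(** * Discrete Parseval identity and Cauchy estimates *)

Section Parseval.
Variable R : realType.
Local Notation C := (cplx R).

Lemma prim_root_cmod (M : nat) (zeta : C) : M.-primitive_root zeta -> cmod zeta = 1.
Proof.
move=> pz; have M0 := prim_order_gt0 pz.
have /eqP := congr1 (@cmod R) (prim_expr_order pz).
by rewrite cmodX cmod1 pexpr_eq1 ?cmod_ge0// => /eqP.
Qed.

(** Orthogonality of characters: the sum is geometric with ratio zeta^k times the conjugate of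
    zeta^l, and primitivity makes this ratio different from 1 when k and l differ below M. *)
Lemma sum_roots (M : nat) (zeta : C) k l : M.-primitive_root zeta -> (k < M)%N -> (l < M)%N ->
  \sum_(0 <= i < M) (zeta ^+ i) ^+ k * cj ((zeta ^+ i) ^+ l) = if k == l then M%:R else 0.
Proof.
move=> pz kM lM; have c1 := prim_root_cmod pz.
have zz n : zeta ^+ n * cj (zeta ^+ n) = 1 by rewrite mul_cj cmodX c1 !expr1n.
pose x := zeta ^+ k * cj (zeta ^+ l).
rewrite (eq_bigr (fun i => x ^+ i)); last first.
  by move=> i _; rewrite /x exprMn -cjX -!exprM ![(i * _)%N]mulnC.
case: eqP => [kl|kl].
  rewrite /x kl zz; under eq_bigr do rewrite expr1n.
  by rewrite sumr_const_nat subn0.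
have x1 : x != 1.
  apply/eqP => h; apply: kl; have : zeta ^+ k = zeta ^+ l.
    by rewrite -[LHS]mulr1 -(zz l) mulrCA -/x h mulr1.
  by move/eqP; rewrite (eq_prim_root_expr pz) !modn_small// => /eqP.
rewrite geom_sum// /x exprMn -cjX -!exprM ![(_ * M)%N]mulnC !exprM (prim_expr_order pz).
by rewrite !expr1n cj1 mulr1 subrr mul0r.
Qed.

(** Exact, without aliasing, because all exponents are below M: [sum_roots] removes the off-diagonal
    terms of the double sum. *)
Lemma discrete_parseval (M : nat) (zeta : C) (d : nat -> C) (z : C) : M.-primitive_root zeta ->
  \sum_(0 <= i < M) cmod (\sum_(0 <= k < M) d k * (zeta ^+ i * z) ^+ k) ^+ 2 =
  M%:R * \sum_(0 <= k < M) cmod (d k) ^+ 2 * cmod z ^+ (2 * k).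
Proof.
move=> pz; apply: real_complex_inj; rewrite real_complex_sum.
under eq_bigr do rewrite -mul_cj cj_sum big_distrlr /=.
have E i k l : d k * (zeta ^+ i * z) ^+ k * cj (d l * (zeta ^+ i * z) ^+ l) =
    d k * z ^+ k * cj (d l * z ^+ l) * ((zeta ^+ i) ^+ k * cj ((zeta ^+ i) ^+ l)).
  by rewrite !exprMn !cjM; ring.
rewrite exchange_big /=; under eq_bigr do rewrite exchange_big /=.
rewrite rmorphM /= rmorph_nat real_complex_sum big_distrr /=.
apply: eq_big_nat => k /andP[_ kM].
transitivity (\sum_(0 <= l < M) if l == k then M%:R * (d k * z ^+ k * cj (d k * z ^+ k)) else 0).
  apply: eq_big_nat => l /andP[_ lM].
  under eq_bigr do rewrite E.
  rewrite -big_distrr /= (sum_roots pz)// eq_sym.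
  by case: eqP => [->|]; [rewrite mulrC|rewrite mulr0].
rewrite -big_mkcond /= big_nat1_eq leq0n kM mul_cj cmodM cmodX exprMn.
by rewrite -exprM mulnC.
Qed.

Lemma sum_pad (V : nmodType) (F : nat -> V) N M : (N <= M)%N -> (forall j, (N <= j)%N -> F j = 0) ->
  \sum_(0 <= j < M) F j = \sum_(0 <= j < N) F j.
Proof.
move=> NM F0; rewrite (sum_nat_split _ NM).
have -> : \sum_(N <= k < M) F k = 0; last exact: addr0.
by rewrite big_nat_cond big1// => j; rewrite andbT => /andP[/F0].
Qed.

(** The series is cut at M, at a cost [t M] uniform on the circle; averaging over M nodes turns both
    sides into square sums, and M goes to infinity. *)
Lemma parseval_le (c v : nat -> C) (N : nat) (rho : R) : 0 <= rho -> pconv c rho ->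
  (forall j, (N <= j)%N -> v j = 0) ->
  (forall z, cmod z = rho -> cmod (ps c z) <= cmod (\sum_(0 <= j < N) v j * z ^+ j)) ->
  forall n, \sum_(0 <= k < n) cmod (c k) ^+ 2 * rho ^+ (2 * k) <=
            \sum_(0 <= j < N) cmod (v j) ^+ 2 * rho ^+ (2 * j).
Proof.
move=> rho0 cr v0 H n.
have [t [tl t0 th]] := ps_uniform rho0 cr.
set S := \sum_(0 <= j < N) _.
pose B := \sum_(0 <= j < N) cmod (v j) * rho ^+ j.
have B0 : 0 <= B by apply: sumr_ge0 => j _; rewrite mulr_ge0 ?cmod_ge0 ?exprn_ge0.
set L := \sum_(0 <= k < n) _.
(* The error term is (B + t)^2 - B^2, as the polynomial is at most B on the circle. *)
have key M : (n <= M)%N -> (N <= M)%N -> (0 < M)%N -> L <= S + (2 * B * t M + t M ^+ 2).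
  move=> nM NM M0.
  have [zeta pz] := prim_root_exists R M0.
  have c1 := prim_root_cmod pz.
  have M0' : 0 < M%:R :> R by rewrite ltr0n.
  have cz i : cmod (zeta ^+ i * rho%:C) = rho by rewrite cmodM cmodX c1 expr1n mul1r cmod_real ger0_norm.
  have h1 := discrete_parseval c rho%:C pz.
  have h2 := discrete_parseval v rho%:C pz.
  rewrite cmod_real ger0_norm// in h1 h2.
  apply: (@le_trans _ _ (\sum_(0 <= k < M) cmod (c k) ^+ 2 * rho ^+ (2 * k))).
    rewrite (sum_nat_split _ nM) lerDl sumr_ge0// => k _.
    by rewrite mulr_ge0 ?sqr_ge0 ?exprn_ge0.
  rewrite -(ler_pM2l M0') -h1 mulrDr.
  have -> : S = \sum_(0 <= k < M) cmod (v k) ^+ 2 * rho ^+ (2 * k).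
    by rewrite (sum_pad NM)// => j Nj; rewrite v0// cmod0 expr0n mul0r.
  rewrite -h2.
  have -> : M%:R * (2 * B * t M + t M ^+ 2) = \sum_(0 <= i < M) (2 * B * t M + t M ^+ 2).
    by rewrite sumr_const_nat subn0 mulr_natl.
  rewrite -big_split /=; apply: ler_sum => i _.
  set z := _ * _.
  have pE : \sum_(0 <= k < M) v k * z ^+ k = \sum_(0 <= k < N) v k * z ^+ k.
    by rewrite (sum_pad NM)// => j Nj; rewrite v0// mul0r.
  have hd : cmod (\sum_(0 <= k < M) c k * z ^+ k) <= cmod (\sum_(0 <= k < M) v k * z ^+ k) + t M.
    have := th z; rewrite cz => /(_ (lexx _) M); rewrite cmodBC => h.
    have := H z (cz i); rewrite pE.
    have := le_trans (ler_cmodB _ _) h; lra.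
  have pB : cmod (\sum_(0 <= k < M) v k * z ^+ k) <= B.
    rewrite pE; apply: le_trans (ler_cmod_sum _ _ _) _; apply: ler_sum => j _.
    by rewrite cmodM cmodX cz.
  have := t0 M; have := cmod_ge0 (\sum_(0 <= k < M) c k * z ^+ k).
  have := cmod_ge0 (\sum_(0 <= k < M) v k * z ^+ k).
  move: hd pB; move: (cmod _) (cmod _) => x y; nra.
apply/ler_addgt0Pr => e e0.
have tl2 : 2 * B * t M + t M ^+ 2 @[M --> \oo] --> (0 : R).
  have -> : (0 : R) = 2 * B * 0 + 0 ^+ 2 by rewrite mulr0 expr0n addr0.
  apply: cvgD; first by apply: cvgM => //; exact: cvg_cst.
  by rewrite expr2; under eq_fun do rewrite expr2; exact: cvgM.
move/cvgrPdist_lt: tl2 => /(_ e e0)[K _ h].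
pose M := maxn K (maxn n (maxn N 1)).
have := h M (leq_maxl _ _); rewrite /= sub0r normrN ger0_norm => [he|].
  apply: le_trans (key M _ _ _) _; rewrite ?leq_max ?leqnn ?orbT//.
  by rewrite lerD2l ltW.
by rewrite addr_ge0 ?sqr_ge0// !mulr_ge0.
Qed.

(** Domination by the constant polynomial B bounds the whole square sum by B^2, in particular each
    of its terms. *)
Lemma cauchy_estimate (c : nat -> C) (rho B : R) : 0 <= rho -> 0 <= B -> pconv c rho ->
  (forall z, cmod z = rho -> cmod (ps c z) <= B) -> forall n, cmod (c n) * rho ^+ n <= B.
Proof.
move=> rho0 B0 cr H n.
pose v j : C := if j == 0%N then B%:C else 0.
have := @parseval_le c v 1 rho rho0 cr.
have cB : cmod (B%:C : C) = B by rewrite cmod_real ger0_norm.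
rewrite big_nat1 /v /= cB muln0 expr0 mulr1 => /(_ _ _ n.+1) h.
have {}h : \sum_(0 <= k < n.+1) cmod (c k) ^+ 2 * rho ^+ (2 * k) <= B ^+ 2.
  apply: h; first by case.
  by move=> z zr; rewrite big_nat1 /= expr0 mulr1 cB H.
rewrite -(ler_pXn2r (_ : 0 < 2)%N) ?nnegrE ?mulr_ge0 ?cmod_ge0 ?exprn_ge0//.
apply: le_trans h; rewrite big_nat_recr//= exprMn -exprM mulnC lerDr sumr_ge0// => k _.
by rewrite mulr_ge0 ?sqr_ge0 ?exprn_ge0.
Qed.

Lemma ps_zero_unique (c : nat -> C) (rho : R) : 0 < rho -> pconv c rho ->
  (forall z, cmod z <= rho -> ps c z = 0) -> forall n, c n = 0.
Proof.
move=> rho0 cr H n; have := @cauchy_estimate c rho 0 (ltW rho0) (lexx _) cr.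
move=> /(_ _ n) h; apply/eqP; rewrite -cmod_eq0 eq_le cmod_ge0 andbT.
rewrite -(@ler_pM2r _ (rho ^+ n)) ?exprn_gt0// mul0r; apply: h => z zr.
by rewrite H ?cmod0// zr.
Qed.
End Parseval.

(** * Continuation of the Taylor expansion to the whole disc *)

Section Reexp.
Variable R : realType.
Local Notation C := (cplx R).

(* Coefficients of the expansion at [w] of a power series [c] centred at 0. *)
Definition reexp (c : nat -> C) (w : C) (k : nat) : C :=
  csum (fun n => 'C(n, k)%:R * c n * w ^+ (n - k)).

Lemma cmod_nat n : cmod (n%:R : C) = n%:R.
Proof.
have -> : (n%:R : C) = (n%:R : R)%:C by rewrite rmorph_nat.
by rewrite cmod_real ger0_norm.
Qed.

Lemma binom_partial (K n : nat) (x h : R) : 0 <= x -> 0 <= h ->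
  \sum_(0 <= k < K) 'C(n, k)%:R * x ^+ (n - k) * h ^+ k <= (x + h) ^+ n.
Proof.
move=> x0 h0; rewrite exprDn.
have P k : 0 <= 'C(n, k)%:R * x ^+ (n - k) * h ^+ k by rewrite !mulr_ge0 ?exprn_ge0.
rewrite [leRHS](_ : _ = \sum_(0 <= k < n.+1) 'C(n, k)%:R * x ^+ (n - k) * h ^+ k); last first.
  by rewrite big_mkord; apply: eq_bigr => i _; rewrite -mulr_natl mulrA.
case: (leqP K n.+1) => Kn.
  by rewrite [leRHS](sum_nat_split _ Kn) lerDl sumr_ge0.
rewrite (sum_pad (ltnW Kn))// => j nj.
by rewrite bin_small// !mul0r.
Qed.

Section Fix.
Variables (c : nat -> C) (w : C) (h rho : R).
Hypotheses (h0 : 0 < h) (wh : cmod w + h <= rho) (pc : pconv c rho).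

Let b k n := 'C(n, k)%:R * c n * w ^+ (n - k).

Let rho0 : 0 <= rho. Proof. by move: h0 wh (cmod_ge0 w) => h1 h2 h3; lra. Qed.

(** Binomial theorem on absolute values: for each i the sum over k is at most |c_i| (|w| + h)^i.
    This is the absolute summability of the double series behind [reexp]. *)
Lemma reexp_partial K n m : \sum_(0 <= k < K) (\sum_(n <= i < m) cmod (b k i)) * h ^+ k
  <= \sum_(n <= i < m) cmod (c i) * rho ^+ i.
Proof.
under eq_bigr do rewrite big_distrl /=.
rewrite exchange_big /=; apply: ler_sum => i _.
rewrite /b (eq_bigr (fun k => cmod (c i) * ('C(i, k)%:R * cmod w ^+ (i - k) * h ^+ k))); last first.
  by move=> k _; rewrite !cmodM cmod_nat cmodX; ring.
rewrite -big_distrr /= ler_wpM2l ?cmod_ge0//.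
apply: le_trans (binom_partial _ _ _ (ltW h0)) _; first exact: cmod_ge0.
by rewrite lerXn2r ?nnegrE// ?addr_ge0 ?cmod_ge0// ltW.
Qed.

Lemma reexp_asum k : asum (b k).
Proof.
have [B HB] := pc; exists (B / h ^+ k) => n.
rewrite ler_pdivlMr ?exprn_gt0//; apply: le_trans (HB n).
apply: le_trans (reexp_partial k.+1 0 n).
rewrite big_nat_recr//= lerDr; apply: sumr_ge0 => i _.
by rewrite mulr_ge0 ?exprn_ge0 ?(ltW h0)// sumr_ge0// => j _; rewrite cmod_ge0.
Qed.

Lemma reexp_cvg k : series (b k) @ \oo --> reexp c w k.
Proof. exact: asum_cvg (reexp_asum k). Qed.

(** [reexp_partial] on a block n <= i < m, with m sent to infinity at fixed K; being uniform in K,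
    the bound controls all re-expanded coefficients at once. *)
Lemma reexp_tail (t : R) n : (forall m, \sum_(n <= i < m) cmod (c i) * rho ^+ i <= t) ->
  forall K, \sum_(0 <= k < K) cmod (reexp c w k - \sum_(0 <= i < n) b k i) * h ^+ k <= t.
Proof.
move=> ht K; apply/ler_addgt0Pr => e e0.
have : \sum_(0 <= k < K) cmod (series (b k) m - reexp c w k) * h ^+ k @[m --> \oo] --> (0 : R).
  elim: K => [|K IH].
    by under eq_fun do rewrite big_nil; exact: cvg_cst.
  under eq_fun do rewrite big_nat_recr//=.
  have /cvgCP H0 := @reexp_cvg K.
  have := cvgD IH (cvgM H0 (@cvg_cst _ (h ^+ K) _ _ _)).
  by rewrite mul0r addr0; apply.
move/cvgrPdist_lt => /(_ e e0)[N _ /(_ (maxn N n) (leq_maxl _ _))].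
have nm := leq_maxr N n; move: (maxn N n) nm => m nm.
rewrite /= sub0r normrN => /ltW/(le_trans (ler_norm _)) he.
rewrite addrC; apply: le_trans (lerD he (le_trans (reexp_partial K n m) (ht m))).
rewrite -big_split /=; apply: ler_sum => k _.
rewrite -mulrDl ler_wpM2r ?exprn_ge0 ?(ltW h0)//.
apply: (@le_trans _ _ (cmod (series (b k) m - reexp c w k) + cmod (series (b k) m - \sum_(0 <= i < n) b k i))).
  rewrite [X in _ <= X + _]cmodBC; apply: le_trans (ler_cmodD _ _).
  by rewrite subrKA.
rewrite lerD2l /series /= (sum_nat_split _ nm) addrAC subrr add0r; exact: ler_cmod_sum.
Qed.

Lemma reexp_pconv : pconv (reexp c w) h.
Proof.
have [B HB] := pc; exists B => K.
have := reexp_tail (n := 0) (HB) K; apply: le_trans; apply: ler_sum => k _.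
by rewrite big_nil subr0.
Qed.

Lemma reexp_ps (u : C) : cmod u <= h -> ps (reexp c w) u = ps c (w + u).
Proof.
move=> uh; have wur : cmod (w + u) <= rho.
  by apply: le_trans (ler_cmodD _ _) _; move: wh uh => h1 h2; lra.
have [B HB] := pc.
have [t [t0 tp tn]] := bounded_series_tail (fun n => mulr_ge0 (cmod_ge0 (c n)) (exprn_ge0 n rho0)) HB.
apply: (cvgC_unique (ps_cvg reexp_pconv uh)).
apply/cvgCP.
have h1 := ps_cvg pc wur; move/cvgCP in h1.
have h2 : cmod (series (fun k => c k * (w + u) ^+ k) n - ps c (w + u)) + t n @[n --> \oo] --> (0 : R).
  by have := cvgD h1 t0; rewrite addr0; apply.
apply: (squeeze_cvgr _ (@cvg_cst _ _ _ _ _) h2); apply: nearW => n.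
rewrite cmod_ge0 /=.
have -> : series (fun k => reexp c w k * u ^+ k) n - ps c (w + u) =
  (series (fun k => c k * (w + u) ^+ k) n - ps c (w + u)) +
  (series (fun k => reexp c w k * u ^+ k) n - series (fun k => c k * (w + u) ^+ k) n) by ring.
apply: le_trans (ler_cmodD _ _) _; rewrite lerD2l.
(* The first n powers of w + u, sorted by powers of u; the terms with k > i vanish with the binomial
   coefficient. *)
have -> : series (fun k => c k * (w + u) ^+ k) n = \sum_(0 <= k < n) (\sum_(0 <= i < n) b k i) * u ^+ k.
  rewrite /series /=; under [RHS]eq_bigr do rewrite big_distrl /=.
  rewrite exchange_big /=; apply: eq_big_nat => i /andP[_ i_n].
  rewrite exprDn big_distrr /=.
  have := @sum_pad _ (fun k => b k i * u ^+ k) i.+1 n i_n.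
  rewrite /b => -> => [|j ij]; last by rewrite bin_small// !mul0r.
  rewrite big_mkord; apply: eq_bigr => j _; rewrite -mulr_natl; ring.
rewrite /series /= -sumrB.
apply: le_trans (ler_cmod_sum _ _ _) _.
apply: le_trans (reexp_tail (tn n) n); apply: ler_sum => k _.
by rewrite -mulrBl cmodM cmodX ler_wpM2l ?cmod_ge0// lerXn2r ?nnegrE ?cmod_ge0// ltW.
Qed.
End Fix.

Lemma rep_reexp (f : C -> C) (c : nat -> C) z0 z1 s : rep f c z0 s -> cmod (z1 - z0) < s ->
  rep f (reexp c (z1 - z0)) z1 (s - cmod (z1 - z0)).
Proof.
move=> fc z1s; set w := z1 - z0.
have key h : 0 < h < s - cmod w -> pconv c (cmod w + h).
  move=> /andP[h0 hs]; apply: (rep_pconv fc); have := cmod_ge0 w; lra.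
apply: ps_rep.
  move=> r /andP[r0 rs]; pose h := (r + (s - cmod w)) / 2.
  have h0 : 0 < h by rewrite /h; lra.
  apply: (@pconv_le _ _ _ h); first by rewrite /h; lra.
  by apply: (@reexp_pconv c w h (cmod w + h)) => //; apply: key; rewrite /h; lra.
move=> z zs; pose h := (cmod (z - z1) + (s - cmod w)) / 2.
have zz := cmod_ge0 (z - z1).
have h0 : 0 < h by rewrite /h; lra.
rewrite (@reexp_ps c w h (cmod w + h))//; [|apply: key; rewrite /h; lra|rewrite /h; lra].
have -> : w + (z - z1) = z - z0 by rewrite /w; ring.
apply: (rep_ps fc); have -> : z - z0 = w + (z - z1) by rewrite /w; ring.
apply: le_lt_trans (ler_cmodD _ _) _; lra.
Qed.

Lemma rep_analytic (f : C -> C) (c : nat -> C) z0 s z : rep f c z0 s -> cmod (z - z0) < s -> @analytic_at R f z.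
Proof.
move=> fc zs; exists (reexp c (z - z0)); apply/nbhsCP.
exists (s - cmod (z - z0)); first lra.
exact: rep_reexp.
Qed.

(** The remainder after the linear term is at most (B / r^2) |h|^2, since |h|^k <= r^(k - 2) |h|^2
    for k >= 2; divided by h, it tends to 0. *)
Lemma rep_cvg_derive (f : C -> C) (c : nat -> C) z0 s : 0 < s -> rep f c z0 s ->
  h^-1 *: (f (h + z0) - f z0) @[h --> 0^'] --> c 1%N.
Proof.
move=> s0 fc.
pose r := s / 2; have r0 : 0 < r by rewrite /r; lra.
have rs : 0 <= r < s by rewrite /r; lra.
have pc := rep_pconv fc rs; have [B HB] := pc.
have fz0 : f z0 = c 0%N.
  rewrite (rep_ps fc) ?subrr ?cmod0//.
  have := ps_cvg (z := 0) pc; rewrite cmod0 (ltW r0) => /(_ isT) H.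
  apply: (cvgC_unique H); apply/cvgCP/cvgrPdist_lt => e e0; exists 1%N => // n /= n1.
  rewrite /series /= big_ltn// big_nat_cond big1 => [|i /andP[/andP[i0 _] _]].
    by rewrite addr0 expr0 mulr1 subrr cmod0 subrr normr0.
  by rewrite expr0n eqn0Ngt i0 /= mulr0.
have bd h : cmod h <= r -> cmod (f (h + z0) - f z0 - c 1%N * h) <= B / r ^+ 2 * cmod h ^+ 2.
  move=> hr.
  have -> : f (h + z0) = ps c h by rewrite (rep_ps fc) addrK//; lra.
  have -> : ps c h - f z0 - c 1%N * h = ps c h - \sum_(0 <= k < 2) c k * h ^+ k.
    by rewrite fz0 big_nat_recr//= big_nat1 expr0; ring.
  apply: series_tail_le (ps_cvg pc hr) _ => m.
  rewrite mulrAC ler_pdivlMr ?exprn_gt0// big_distrl /=.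
  apply: (@le_trans _ _ (\sum_(2 <= k < m) (cmod (c k) * r ^+ k) * cmod h ^+ 2)).
    rewrite !big_nat; apply: ler_sum => k /andP[k2 _].
    rewrite cmodM cmodX -!mulrA ler_wpM2l ?cmod_ge0//.
    have Ek (x : R) : x ^+ k = x ^+ (k - 2) * x ^+ 2 by rewrite -exprD subnK.
    have A : cmod h ^+ (k - 2) <= r ^+ (k - 2) by rewrite lerXn2r ?nnegrE ?cmod_ge0// ltW.
    have := ler_wpM2r (mulr_ge0 (sqr_ge0 (cmod h)) (sqr_ge0 r)) A.
    by rewrite (Ek (cmod h)) (Ek r) mulrA mulrACA mulrA [X in _ <= X](_ : _ = r ^+ (k - 2) * r ^+ 2 * cmod h ^+ 2)//; ring.
  rewrite -big_distrl /= ler_wpM2r ?sqr_ge0//.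
  apply: le_trans (HB m); case: (leqP 2 m) => m2; last first.
    by rewrite big_geq ?(ltnW m2)//; apply: sumr_ge0 => k _; rewrite mulr_ge0 ?cmod_ge0 ?exprn_ge0 ?(ltW r0).
  by rewrite [leRHS](sum_nat_split _ m2) lerDr sumr_ge0// => *; rewrite mulr_ge0 ?cmod_ge0 ?exprn_ge0 ?(ltW r0).
have B0 : 0 <= B by apply: le_trans (HB 0%N); rewrite big_nil.
apply/cvgCP/cvgrPdist_lt => e e0.
apply/nbhsCP.
pose D := B / r ^+ 2; have D0 : 0 <= D by rewrite divr_ge0 ?sqr_ge0.
exists (Num.min r (e / (D + 1))); first by rewrite lt_min r0 divr_gt0//; lra.
move=> h; rewrite subr0 lt_min => /andP[hr he] hn0.
rewrite sub0r normrN ger0_norm ?cmod_ge0//.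
have hp : 0 < cmod h by rewrite lt_neqAle eq_sym cmod_eq0 hn0 cmod_ge0.
have -> : h^-1 *: (f (h + z0) - f z0) - c 1%N = h^-1 * (f (h + z0) - f z0 - c 1%N * h).
  rewrite mulrBr [c 1%N * h]mulrC mulKf//.
rewrite cmodM cmodV mulrC ltr_pdivrMr//.
apply: le_lt_trans (bd _ (ltW hr)) _; rewrite -/D expr2 mulrA ltr_pM2r//.
move: he; rewrite ltr_pdivlMr; last lra.
by apply: le_lt_trans; rewrite mulrC ler_pM2l//; lra.
Qed.

Lemma rep_derive_center (f : C -> C) (c : nat -> C) z0 s : 0 < s -> rep f c z0 s -> derive1 f z0 = c 1%N.
Proof. by move=> s0 fc; rewrite /derive1; apply: cvg_lim => //; exact: rep_cvg_derive s0 fc. Qed.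

(** The derivative at z is the linear coefficient of the re-expansion at z, and that coefficient is
    the termwise derived series up to an index shift. *)
Lemma rep_derive (f : C -> C) (c : nat -> C) z0 s : rep f c z0 s ->
  rep (derive1 f) (fun n => n.+1%:R * c n.+1) z0 s.
Proof.
move=> fc z zs; set w := z - z0.
have := rep_derive_center _ (rep_reexp fc zs); rewrite subr_gt0 => /(_ zs) ->.
pose h := (s - cmod w) / 2; have h0 : 0 < h by rewrite /h /w; lra.
have pc : pconv c (cmod w + h).
  by apply: (rep_pconv fc); have := cmod_ge0 w; rewrite /h /w in h0 *; lra.
have := @reexp_cvg c w h (cmod w + h) h0 (lexx _) pc 1.
move=> H; have {}H : series (fun n => 'C(n, 1)%:R * c n * w ^+ (n - 1)) n.+1 @[n --> \oo] --> reexp c w 1.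
  by rewrite (cvg_shiftS (series _)).
rewrite (_ : series _ = fun n => series (fun n => 'C(n, 1)%:R * c n * w ^+ (n - 1)) n.+1)//.
apply/funext => n; rewrite /series /= big_nat_recl//= bin0n !mul0r add0r.
by apply: eq_bigr => i _; rewrite bin1 subn1.
Qed.

Lemma rep_coef_fact (f : C -> C) (c : nat -> C) z0 s n : 0 < s -> rep f c z0 s -> derive1n n f z0 = n`!%:R * c n.
Proof.
move=> s0; elim: n f c => [|n IH] f c fc.
  rewrite derive1n0 fact0 mul1r.
  have h := fc z0; rewrite subrr cmod0 in h; move: (h s0) => H.
  apply: (cvgC_unique H); apply/cvgCP/cvgrPdist_lt => e e0; exists 1%N => // n /= n1.
  rewrite /series /= big_ltn// big_nat_cond big1 => [|i /andP[/andP[i0 _] _]].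
    by rewrite addr0 expr0 mulr1 subrr cmod0 subrr normr0.
  by rewrite expr0n eqn0Ngt i0 /= mulr0.
by rewrite derive1Sn (IH _ _ (rep_derive fc)) mulrA -natrM mulnC -factS.
Qed.

Lemma rep_taylor (f : C -> C) (c : nat -> C) s n : 0 < s -> rep f c 0 s -> taylor_coef f n = c n.
Proof.
move=> s0 fc; rewrite /taylor_coef (rep_coef_fact _ s0 fc) mulrC mulKf// pnatr_eq0 -lt0n fact_gt0.
Qed.
End Reexp.

Section Continuation.
Variable R : realType.
Local Notation C := (cplx R).

Lemma rep_shrink (f : C -> C) c z0 s s' : s' <= s -> rep f c z0 s -> rep f c z0 s'.
Proof. by move=> ss h z zs; apply: h; exact: lt_le_trans zs ss. Qed.

Lemma rep_unique (f : C -> C) c c' z0 s : 0 < s -> rep f c z0 s -> rep f c' z0 s -> c = c'.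
Proof.
move=> s0 h h'; apply/funext => n; pose r := s / 2.
have r0 : 0 < r by rewrite /r; lra.
have rs : 0 <= r < s by rewrite /r; lra.
have pc := rep_pconv h rs; have pc' := rep_pconv h' rs.
have sb z : cmod z <= r -> series (fun k => (c k - c' k) * z ^+ k) @ \oo --> (0 : C).
  move=> zr; have zs : cmod (z0 + z - z0) < s by rewrite addrAC subrr add0r; lra.
  have := cvgB (h _ zs) (h' _ zs); rewrite subrr addrAC subrr add0r.
  rewrite (_ : (_ - _ : nat -> C) = series (fun k => (c k - c' k) * z ^+ k)); first by apply.
  apply/funext => m; rewrite /series /= -[LHS]sumrB; apply: eq_bigr => i _; ring.
have pd : pconv (fun k => c k - c' k) r.
  have [B HB] := pc; have [B' HB'] := pc'; exists (B + B') => m.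
  apply: le_trans (lerD (HB m) (HB' m)); rewrite -big_split /=; apply: ler_sum => k _.
  rewrite -mulrDl ler_wpM2r ?exprn_ge0 ?(ltW r0)//.
  by apply: le_trans (ler_cmodD _ _) _; rewrite cmodN.
apply/eqP; rewrite -subr_eq0; apply/eqP.
apply: (ps_zero_unique r0 pd) => z zr.
exact: cvgC_unique (ps_cvg pd zr) (sb z zr).
Qed.

(** Compactness: half of the local radius at a point serves every neighbouring centre, so finitely
    many points give one d. *)
Lemma uniform_rep (f : C -> C) (rho0 : R) : rho0 < 1 ->
  (forall z : C, cmod z < 1 -> @analytic_at R f z) ->
  exists2 d : R, 0 < d & forall z, cmod z <= rho0 -> exists c, rep f c z d.
Proof.
move=> r1 fan.
(* P holds vacuously outside the disc of radius rho0, so a square can play the part of the compact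
   set. *)
pose P (d : R) (p : R * R) := cmod (p.1 +i* p.2 : C) <= rho0 -> exists c, rep f c (p.1 +i* p.2 : C) d.
pose K : set (R * R) := `[-1, 1]%classic `*` `[-1, 1]%classic.
have cK : compact K by apply: compact_setX; exact: segment_compact.
have := compact_near_coveringP K; case => /(_ cK) h _.
have {}h := h R (0 : R)^'+ P _.
have dist (p q : R * R) : cmod ((p.1 +i* p.2 : C) - (q.1 +i* q.2 : C)) <= `|p.1 - q.1| + `|p.2 - q.2|.
  exact: cmod_le_ReIm.
have : \forall d \near (0:R)^'+, K `<=` P d.
  apply: h => p Kp; pose z : C := p.1 +i* p.2.
  have [e e0 He] : exists2 e : R, 0 < e & forall z', cmod (z' - z) < e / 2 -> cmod z' <= rho0 ->
      exists c, rep f c z' (e / 2).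
    case: (ltP rho0 (cmod z)) => zr.
      exists (cmod z - rho0); first lra.
      move=> z' zz' zr'; exfalso; have := ler_cmodB z z'; rewrite cmodBC in zz'; lra.
    have [c /nbhsCP[e e0 He]] := fan z (le_lt_trans zr r1).
    exists e => // z' zz' _; exists (reexp c (z' - z)).
    apply: (@rep_shrink _ _ _ (e - cmod (z' - z))); first lra.
    apply: rep_reexp; last lra.
    exact: He.
  exists (ball p (e / 4), [set d : R | 0 < d < e / 2]) => /=.
    split; first by apply: nbhsx_ballx; rewrite divr_gt0.
    exists (e / 2) => /=; first by rewrite divr_gt0.
    move=> d; rewrite /ball /= sub0r normrN => de d0.
    by rewrite d0; apply: le_lt_trans de; exact: ler_norm.
  move=> [q d] /= [[pq1 pq2] /andP[d0 de]] qr.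
  rewrite /ball /= in pq1 pq2.
  have [|c hc] := He (q.1 +i* q.2) _ qr.
    apply: le_lt_trans (dist q p) _.
    rewrite [X in X + _]distrC [X in _ + X]distrC; lra.
  by exists c; apply: rep_shrink hc; exact: ltW.
move=> [e /= e0 He]; exists (e / 2); first by rewrite divr_gt0.
move=> z zr.
have := He (e / 2); rewrite /= sub0r normrN ger0_norm; last lra.
have zz : z = complex.Re z +i* complex.Im z by case: (z).
have h1 := Re_le_cmod z; have h2 := Im_le_cmod z.
move=> /(_ _ _ (complex.Re z, complex.Im z)); rewrite /P /= -zz; apply => //.
- lra.
- lra.
- by split; rewrite /= in_itv /= -ler_norml; lra.
Qed.

Lemma reexp_shift (c : nat -> C) (rho h : R) (w : C) k : 0 < h -> cmod w + h <= rho -> pconv c rho ->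
  reexp c w k = ps (fun m => 'C(m + k, k)%:R * c (m + k)%N) w /\
  pconv (fun m => 'C(m + k, k)%:R * c (m + k)%N) (cmod w).
Proof.
move=> h0 wh pc.
have E (F : nat -> R) n : \sum_(0 <= i < n + k) F i = \sum_(0 <= i < k) F i + \sum_(0 <= i < n) F (i + k)%N.
  rewrite (sum_nat_split F (leq_addl n k)); congr (_ + _).
  by rewrite -[X in \sum_(X <= _ < _) _ = _]add0n big_addn addnK.
have EC n : series (fun n => 'C(n, k)%:R * c n * w ^+ (n - k)) (n + k) =
  series (fun m => 'C(m + k, k)%:R * c (m + k)%N * w ^+ m) n.
  rewrite /series /= (sum_nat_split _ (leq_addl n k)) [X in X + _]big_nat_cond big1 ?add0r; last first.
    by move=> i; rewrite andbT => /andP[_ ik]; rewrite bin_small// !mul0r.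
  rewrite -[X in \sum_(X <= _ < _) _ = _]add0n big_addn addnK; apply: eq_bigr => i _.
  by rewrite addnK.
have P2 : pconv (fun m => 'C(m + k, k)%:R * c (m + k)%N) (cmod w).
  have [B HB] := @reexp_asum R c w h rho h0 wh pc k; exists B => n.
  apply: le_trans (HB (n + k)%N); rewrite E.
  rewrite (_ : \sum_(0 <= i < n) cmod ('C(i + k, k)%:R * c (i + k)%N * w ^+ (i + k - k)) =
    \sum_(0 <= i < n) cmod ('C(i + k, k)%:R * c (i + k)%N) * cmod w ^+ i); last first.
    by apply: eq_bigr => i _; rewrite addnK -cmodX -cmodM.
  by rewrite lerDr; apply: sumr_ge0 => i _; exact: cmod_ge0.
split => //.
have := @reexp_cvg R c w h rho h0 wh pc k.
rewrite -(cvg_shiftn k) => H; apply: (cvgC_unique H).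
rewrite (_ : [sequence _]_n = series (fun m => 'C(m + k, k)%:R * c (m + k)%N * w ^+ m)); last exact/funext.
exact: ps_cvg P2 (lexx _).
Qed.

(* On the circle |z| = rho1 the local expansions have radius at least d, so the
   Cauchy estimates bound every Taylor coefficient [reexp c z k] there.  As a
   function of z, [reexp c z k] is a power series with coefficients
   'C(m + k, k) c_(m + k); a second Cauchy estimate bounds those, and summing
   over m + k = n by the binomial formula bounds |c_n| (rho1 + 3d/4)^n. *)
Lemma rep_extend (f : C -> C) (c : nat -> C) (rho0 d s : R) : 0 < d -> rho0 + d <= 1 -> 0 < s <= rho0 ->
  (forall z, cmod z < 1 -> cmod (f z) <= 1) ->
  (forall z, cmod z <= rho0 -> exists c', rep f c' z d) ->
  rep f c 0 s -> rep f c 0 (s + d / 2).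
Proof.
move=> d0 rd /andP[s0 sr] f1 fd fc.
(* Just inside radius s, where the expansion at 0 is known; rho1 >= s - d / 8 makes rho1 + 3 d / 4
   exceed s + d / 2. *)
pose rho1 := Num.max (s / 2) (s - d / 8).
have r1s : rho1 < s by rewrite /rho1 gt_max; apply/andP; split; lra.
have r1a : s / 2 <= rho1 by rewrite /rho1 le_max lexx.
have r1b : s - d / 8 <= rho1 by rewrite /rho1 le_max lexx orbT.
clearbody rho1.
have r10 : 0 < rho1 by lra.
have repz z1 : cmod z1 = rho1 -> rep f (reexp c z1) z1 d.
  move=> z1r; have [|c' hc'] := fd z1; first lra.
  have h1 := @rep_reexp R f c 0 z1 s fc; rewrite subr0 z1r in h1.
  have {}h1 := h1 r1s.
  pose m := Num.min d (s - rho1).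
  have m0 : 0 < m by rewrite /m lt_min d0 subr_gt0.
  suff -> : reexp c z1 = c' by [].
  apply: (@rep_unique f _ _ z1 m) => //; first by apply: rep_shrink h1; rewrite /m ge_min lexx orbT.
  by apply: rep_shrink hc'; rewrite /m ge_min lexx.
(* Strictly between 3 d / 4 and d: below d for the Cauchy estimates, above 3 d / 4 for the geometric
   ratio q. *)
pose d1 := 7 * d / 8.
have d10 : 0 < d1 by rewrite /d1; lra.
have est1 z1 k : cmod z1 = rho1 -> cmod (reexp c z1 k) * d1 ^+ k <= 1.
  move=> z1r; have rz := repz _ z1r.
  have pz : pconv (reexp c z1) d1 by apply: (rep_pconv rz); rewrite /d1; lra.
  apply: (cauchy_estimate (ltW d10) ler01 pz) => z zd.
  have E := rep_ps (z := z1 + z) rz; rewrite [_ + z - _]addrAC subrr add0r in E.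
  rewrite -E; last by rewrite zd /d1; lra.
  apply: f1; apply: le_lt_trans (ler_cmodD _ _) _; rewrite z1r zd /d1; lra.
pose h := (s - rho1) / 2.
have h0 : 0 < h by rewrite /h; lra.
have pch : pconv c (rho1 + h) by apply: (rep_pconv fc); rewrite /h; lra.
have est2 m k : 'C(m + k, k)%:R * cmod (c (m + k)%N) * rho1 ^+ m * d1 ^+ k <= 1.
  have r1c : cmod (rho1%:C : C) = rho1 by rewrite cmod_real ger0_norm ?ltW.
  have [_ pk] := @reexp_shift c (rho1 + h) h rho1%:C k h0 (eq_ind_r (fun x => x + h <= rho1 + h) (lexx _) r1c) pch.
  rewrite r1c in pk.
  rewrite -ler_pdivlMr ?exprn_gt0//.
  have := @cauchy_estimate R _ rho1 (1 / d1 ^+ k) (ltW r10) _ pk _ m.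
  rewrite cmodM cmod_nat; apply; first by rewrite divr_ge0 ?exprn_ge0 ?(ltW d10).
  move=> z zr; rewrite ler_pdivlMr ?exprn_gt0//.
  have [|<- _] := @reexp_shift c (rho1 + h) h z k h0 _ pch; first by rewrite zr.
  exact: est1.
pose q := (3 * d / 4) / d1.
have q01 : 0 <= q < 1 by rewrite /q ltr_pdivrMr// divr_ge0 ?(ltW d10)//= /d1; lra.
have est3 n : cmod (c n) * (rho1 + 3 * d / 4) ^+ n <= (1 - q)^-1.
  apply: le_trans (geom_bound n.+1 q01).
  rewrite exprDn big_distrr /= big_mkord; apply: ler_sum => -[k /= kn] _.
  rewrite ltnS in kn.
  have := est2 (n - k)%N k; rewrite subnK// => H.
  have -> : cmod (c n) * (rho1 ^+ (n - k) * (3 * d / 4) ^+ k *+ 'C(n, k)) =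
     'C(n, k)%:R * cmod (c n) * rho1 ^+ (n - k) * d1 ^+ k * q ^+ k.
    have -> : 3 * d / 4 = d1 * q by rewrite /q [d1 * _]mulrC divfK// gt_eqF.
    rewrite exprMn -mulr_natl; ring.
  rewrite -[leRHS]mul1r ler_wpM2r// exprn_ge0//; by case/andP: q01.
have pcr r : 0 <= r < s + d / 2 -> pconv c r.
  move=> /andP[r0 rs]; apply: (pconv_bounded (s := rho1 + 3 * d / 4) _ est3).
  rewrite r0 /=; lra.
apply: ps_rep => // z; rewrite subr0 => zs.
case: (ltP (cmod z) s) => zs'.
  by have := rep_ps fc (z := z); rewrite subr0; apply.
have z0 : 0 < cmod z by lra.
(* The radial projection of z on the circle of radius rho1 is at distance |z| - rho1 < d, so the
   local expansion there reaches z. *)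
pose z1 : C := (rho1 / cmod z)%:C * z.
have z1r : cmod z1 = rho1.
  by rewrite cmodM cmod_real ger0_norm ?divfK ?gt_eqF// divr_ge0 ?ltW.
have dz : cmod (z - z1) = cmod z - rho1.
  have -> : z - z1 = (1 - rho1 / cmod z)%:C * z by rewrite rmorphB /= rmorph1 mulrBl mul1r.
  rewrite cmodM cmod_real ger0_norm; first by rewrite mulrBl mul1r divfK// gt_eqF.
  by rewrite subr_ge0 ler_pdivrMr// mul1r; lra.
rewrite (rep_ps (repz _ z1r)); last by rewrite dz; lra.
rewrite (@reexp_ps R c z1 (cmod z - rho1) (cmod z)).
- by congr ps; ring.
- lra.
- by rewrite z1r addrC subrK.
- by apply: pcr; rewrite cmod_ge0.
- by rewrite dz.
Qed.

(** For fixed rho0 < 1 the gain d' / 2 of [rep_extend] does not shrink, so finitely many extensions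
    carry the expansion at 0 up to rho0. *)
Lemma classB_rep (f : C -> C) : classB f -> exists c, rep f c 0 1.
Proof.
move=> [fan f1].
have [|c /nbhsCP[e e0 fe]] := fan 0; first by rewrite /unit_disk /= cmod0.
exists c.
suff key rho0 : 0 < rho0 < 1 -> rep f c 0 rho0.
  move=> z; rewrite subr0 => z1.
  have := @key ((1 + cmod z) / 2) _ z; rewrite subr0; apply; have := cmod_ge0 z; lra.
move=> /andP[r0 r1].
have [d d0 hd] := uniform_rep r1 fan.
pose d' := Num.min d (1 - rho0).
have d'0 : 0 < d' by rewrite /d' lt_min d0 subr_gt0.
have d'r : rho0 + d' <= 1.
  have : d' <= 1 - rho0 by rewrite /d' ge_min lexx orbT.
  lra.
have hd' z : cmod z <= rho0 -> exists c', rep f c' z d'.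
  by move=> /hd[c' hc']; exists c'; apply: rep_shrink hc'; rewrite /d' ge_min lexx.
have it n : rep f c 0 (Num.min rho0 (e + n%:R * (d' / 2))).
  elim: n => [|n IH].
    by apply: (@rep_shrink _ _ _ e) => //; rewrite mul0r addr0 ge_min lexx orbT.
  have ss : 0 < Num.min rho0 (e + n%:R * (d' / 2)) <= rho0.
    have : 0 <= n%:R * (d' / 2) by apply: mulr_ge0 => //; apply: divr_ge0 => //; exact: ltW.
    by rewrite lt_min r0 ge_min lexx /= andbT => ?; lra.
  have := rep_extend d'0 d'r ss f1 hd' IH; apply: rep_shrink.
  rewrite -natr1; case: (leP rho0 (e + n%:R * (d' / 2))) => h; rewrite /Num.min; case: ifP; lra.
have [n hn] : exists n : nat, rho0 <= e + n%:R * (d' / 2).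
  exists (Num.truncn (rho0 / (d' / 2))).+1.
  have := truncnS_gt (rho0 / (d' / 2)); rewrite ltr_pdivrMr; last lra.
  lra.
by apply: rep_shrink (it n); rewrite le_min lexx.
Qed.
End Continuation.

(** * Coefficient inequalities *)

Section Contraction.
Variable R : realType.
Local Notation C := (cplx R).

(** Entry (k, j) of the lower triangular Toeplitz matrix of a; as a sequence in k, the coefficients
    of z^j times the series. *)
Definition shift_seq (j : nat) (a : nat -> C) (k : nat) : C := if (j <= k)%N then a (k - j)%N else 0.

Lemma sum_shift (V : nmodType) (F : nat -> V) j n : (forall k, (k < j)%N -> F k = 0) ->
  \sum_(0 <= k < n + j) F k = \sum_(0 <= k < n) F (k + j)%N.
Proof.
move=> F0; rewrite (sum_nat_split F (leq_addl n j)).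
rewrite [X in X + _]big_nat_cond big1 ?add0r; last by move=> i; rewrite andbT => /andP[_ /F0].
by rewrite -[X in \sum_(X <= _ < _) _ = _]add0n big_addn addnK.
Qed.

Lemma shift_seq_pconv (a : nat -> C) rho j : 0 <= rho -> pconv a rho -> pconv (shift_seq j a) rho.
Proof.
move=> r0 [B HB]; exists (rho ^+ j * B) => n.
apply: (@le_trans _ _ (\sum_(0 <= k < n + j) cmod (shift_seq j a k) * rho ^+ k)).
  rewrite (sum_nat_split _ (leq_addr j n)) lerDl; apply: sumr_ge0 => k _.
  by rewrite mulr_ge0 ?cmod_ge0 ?exprn_ge0.
rewrite sum_shift; last by move=> k kj; rewrite /shift_seq leqNgt kj /= cmod0 mul0r.
apply: le_trans (ler_wpM2l (exprn_ge0 j r0) (HB n)).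
rewrite big_distrr /= le_eqVlt; apply/orP; left; apply/eqP; apply: eq_bigr => k _.
by rewrite /shift_seq leq_addl addnK exprD; ring.
Qed.

Lemma shift_seq_cvg (a : nat -> C) rho j z : pconv a rho -> cmod z <= rho ->
  series (fun k => shift_seq j a k * z ^+ k) @ \oo --> z ^+ j * ps a z.
Proof.
move=> pa zr; rewrite -(cvg_shiftn j).
rewrite (_ : [sequence _]_n = (fun n => z ^+ j * series (fun k => a k * z ^+ k) n)).
  by apply: cvgM; [exact: cvg_cst|exact: ps_cvg pa zr].
apply/funext => n; rewrite /series /= sum_shift; last by move=> k kj; rewrite /shift_seq leqNgt kj /= mul0r.
rewrite big_distrr /=; apply: eq_bigr => k _.
by rewrite /shift_seq leq_addl addnK exprD; ring.
Qed.

Definition pconvol (v a : nat -> C) N k : C := \sum_(0 <= j < N) v j * shift_seq j a k.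

Lemma pconvol_pconv (v a : nat -> C) N rho : 0 <= rho -> pconv a rho -> pconv (pconvol v a N) rho.
Proof.
move=> r0 pa; elim: N => [|N [B HB]].
  by exists 0 => n; rewrite big1// => k _; rewrite /pconvol big_nil cmod0 mul0r.
have [B' HB'] := shift_seq_pconv N r0 pa; exists (B + cmod (v N) * B') => n.
apply: le_trans (lerD (HB n) (ler_wpM2l (cmod_ge0 (v N)) (HB' n))).
rewrite big_distrr -big_split /=; apply: ler_sum => k _.
rewrite {1}/pconvol big_nat_recr//= mulrA -mulrDl ler_wpM2r ?exprn_ge0//.
by apply: le_trans (ler_cmodD _ _) _; rewrite cmodM.
Qed.

Lemma pconvol_cvg (v a : nat -> C) N rho z : pconv a rho -> cmod z <= rho ->
  series (fun k => pconvol v a N k * z ^+ k) @ \oo --> (\sum_(0 <= j < N) v j * z ^+ j) * ps a z.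
Proof.
move=> pa zr; elim: N => [|N IH].
  rewrite big_nil mul0r (_ : series _ = fun=> 0); first exact: cvg_cst.
  by apply/funext => n; rewrite /series /= big1// => k _; rewrite /pconvol big_nil mul0r.
have H := cvgD IH (cvgM (@cvg_cst _ (v N) _ _ _) (@shift_seq_cvg a rho N z pa zr)).
have -> : (\sum_(0 <= j < N.+1) v j * z ^+ j) * ps a z =
   (\sum_(0 <= j < N) v j * z ^+ j) * ps a z + v N * (z ^+ N * ps a z).
  by rewrite big_nat_recr// mulrDl mulrA.
have -> : series (fun k => pconvol v a N.+1 k * z ^+ k) =
  (fun n => series (fun k => pconvol v a N k * z ^+ k) n + v N * series (fun k => shift_seq N a k * z ^+ k) n).
  apply/funext => n; rewrite /series /= big_distrr -big_split /=; apply: eq_bigr => k _.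
  by rewrite /pconvol big_nat_recr//= mulrDl mulrA.
exact: H.
Qed.

Lemma bernoulli_ineq (e : R) m : 0 <= e <= 1 -> 1 - m%:R * e <= (1 - e) ^+ m.
Proof.
move=> /andP[e0 e1]; elim: m => [|m IH]; first by rewrite mul0r subr0 expr0.
rewrite exprS -natr1; apply: le_trans (ler_wpM2l _ IH); last lra.
have : 0 <= m%:R * e * e by rewrite !mulr_ge0.
lra.
Qed.

Section Bounded.
Variables (f : C -> C) (a : nat -> C).
Hypotheses (fa : rep f a 0 1) (f1 : forall z, cmod z < 1 -> cmod (f z) <= 1).

(* [pconvol v a N] lists the Taylor coefficients of p f, where p is the polynomial
   with coefficients v, and |p f| <= |p|; let the radius rho tend to 1. *)
Lemma toeplitz_contraction (v : nat -> C) N n :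
  \sum_(0 <= k < n) cmod (pconvol v a N k) ^+ 2 <= \sum_(0 <= j < N) cmod (v j) ^+ 2.
Proof.
set L := \sum_(0 <= k < n) _; set S := \sum_(0 <= j < N) _.
have L0 : 0 <= L by apply: sumr_ge0 => k _; exact: sqr_ge0.
have key rho : 0 < rho < 1 -> L * rho ^+ (2 * n) <= S.
  move=> /andP[r0 r1].
  have pa : pconv a rho by apply: (rep_pconv fa); rewrite (ltW r0).
  pose v' j := if (j < N)%N then v j else 0.
  have vv' (F : C -> nat -> C) : \sum_(0 <= j < N) F (v' j) j = \sum_(0 <= j < N) F (v j) j.
    by apply: eq_big_nat => j /andP[_ jN]; rewrite /v' jN.
  have v'0 j : (N <= j)%N -> v' j = 0 by rewrite /v' ltnNge => ->.
  have H := @parseval_le R (pconvol v a N) v' N rho (ltW r0) (pconvol_pconv v N (ltW r0) pa) v'0 _ n.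
    have {}H : \sum_(0 <= k < n) cmod (pconvol v a N k) ^+ 2 * rho ^+ (2 * k) <= \sum_(0 <= j < N)
      cmod (v' j) ^+ 2 * rho ^+ (2 * j).
    apply: H => z zr; rewrite (vv' (fun x j => x * z ^+ j)).
    have zr' : cmod z <= rho by rewrite zr.
    rewrite (cvgC_unique (ps_cvg (pconvol_pconv v N (ltW r0) pa) zr') (@pconvol_cvg v a N rho z pa zr')).
    rewrite cmodM -[leRHS]mulr1 ler_wpM2l ?cmod_ge0//.
    have E := rep_ps fa (z := z); rewrite subr0 in E.
    by rewrite -E ?f1 ?zr.
  apply: le_trans (le_trans H _).
    rewrite big_distrl /=; apply: ler_sum_nat => k /andP[_ kn].
    rewrite ler_wpM2l ?sqr_ge0// ler_wiXn2l ?(ltW r0) ?(ltW r1)//.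
    by rewrite leq_mul2l /= ltnW.
  apply: ler_sum_nat => j /andP[_ jN]; rewrite /v' jN.
  by rewrite -[leRHS]mulr1 ler_wpM2l ?sqr_ge0// exprn_ile1 ?(ltW r0) ?(ltW r1).
apply/ler_addgt0Pr => e e0.
(* With rho = 1 - d, Bernoulli's inequality bounds the loss L (1 - rho^(2n)) by 2 n d L <= e. *)
pose D := L * (2 * n)%:R + 1.
have D1 : 1 <= D by rewrite /D lerDr mulr_ge0.
pose d := Num.min (1 / 2) (e / D).
have d0 : 0 < d by rewrite /d lt_min !divr_gt0//; lra.
have d1 : d <= 1 / 2 by rewrite /d ge_min lexx.
have de : d * D <= e by rewrite -ler_pdivlMr; [rewrite /d ge_min lexx orbT|lra].
have := key (1 - d); have -> : 0 < 1 - d < 1 by lra.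
move=> /(_ isT); have := @bernoulli_ineq d (2 * n); have -> : 0 <= d <= 1 by lra.
move=> /(_ isT) /(ler_wpM2l L0); rewrite /D in de; lra.
Qed.

(* The Toeplitz contraction applied to (1, 0, ..., 0, w_n, w_(n+1), ...). *)
Lemma toeplitz_test_vector (w : nat -> C) n N L : (0 < n)%N -> (n <= N)%N -> (n <= L)%N ->
  \sum_(0 <= k < n) cmod (a k) ^+ 2 +
  \sum_(n <= k < L) cmod (a k + \sum_(n <= j < N) w j * shift_seq j a k) ^+ 2 <=
  1 + \sum_(n <= j < N) cmod (w j) ^+ 2.
Proof.
move=> n0 nN nL.
pose v j : C := if j == 0%N then 1 else if (j < n)%N then 0 else w j.
have vw j : (n <= j)%N -> v j = w j.
  by move=> nj; rewrite /v eqn0Ngt (leq_trans n0 nj) /= ltnNge nj.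
have v0 j : (0 < j < n)%N -> v j = 0.
  by move=> /andP[j0 jn]; rewrite /v eqn0Ngt j0 jn.
have E k : pconvol v a N k = a k + \sum_(n <= j < N) w j * shift_seq j a k.
  rewrite /pconvol (sum_nat_split _ nN) big_ltn//; congr (_ + _).
    rewrite big_nat_cond big1 ?addr0; first by rewrite /v /shift_seq leq0n subn0 mul1r.
    by move=> j; rewrite andbT => /v0->; rewrite mul0r.
  by apply: eq_big_nat => j /andP[nj _]; rewrite vw.
have := toeplitz_contraction v N L.
have -> : \sum_(0 <= j < N) cmod (v j) ^+ 2 = 1 + \sum_(n <= j < N) cmod (w j) ^+ 2.
  rewrite (sum_nat_split _ nN) big_ltn//; congr (_ + _).
    rewrite big_nat_cond big1 ?addr0; first by rewrite /v cmod1 expr1n.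
    by move=> j; rewrite andbT => /v0->; rewrite cmod0 expr0n.
  by apply: eq_big_nat => j /andP[nj _]; rewrite vw.
apply: le_trans.
rewrite (sum_nat_split _ nL); apply: lerD.
  apply: ler_sum_nat => k /andP[_ kn]; rewrite E big_nat_cond big1 ?addr0// => j.
  by rewrite andbT => /andP[nj _]; rewrite /shift_seq leqNgt (leq_trans kn nj) /= mulr0.
by apply: ler_sum => k _; rewrite E.
Qed.

Lemma aligning_phase (z : C) : exists2 t : C, cmod t = 1 & forall x : R, 0 <= x -> cmod (z + t * x%:C) = cmod z + x.
Proof.
have [->|z0] := eqVneq z 0.
  exists 1; rewrite ?cmod1// => x x0; by rewrite add0r mul1r cmod_real ger0_norm// cmod0 add0r.
have c0 : cmod z != 0 by rewrite cmod_eq0.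
exists ((cmod z)^-1%:C * z).
  by rewrite cmodM cmod_real ger0_norm ?invr_ge0 ?cmod_ge0// mulVf.
move=> x x0; have -> : z + (cmod z)^-1%:C * z * x%:C = (1 + (cmod z)^-1 * x)%:C * z.
  rewrite rmorphD rmorph1 rmorphM /=; ring.
rewrite cmodM cmod_real ger0_norm; first by rewrite mulrDl mul1r mulrAC mulVf// mul1r.
by rewrite addr_ge0// mulr_ge0 ?invr_ge0 ?cmod_ge0.
Qed.

Lemma sum_rev_sq (F : nat -> R) n N : (N <= n.+1)%N ->
  \sum_(n.+1 - N <= j < n.+1) F (n - j)%N = \sum_(0 <= k < N) F k.
Proof.
move=> Nn; rewrite -[in LHS](add0n (n.+1 - N)%N) big_addn subKn// big_nat_rev /= add0n.
apply: eq_big_nat => k /andP[_ kN]; congr F.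
by rewrite subnDA; lia.
Qed.
End Bounded.
End Contraction.

Section Coefficients.
Variable R : realType.
Local Notation C := (cplx R).
Variables (f : C -> C) (a : nat -> C).
Hypotheses (fa : rep f a 0 1) (f1 : forall z, cmod z < 1 -> cmod (f z) <= 1).

Let A k := cmod (a k) ^+ 2.
Let A0 k : 0 <= A k. Proof. exact: sqr_ge0. Qed.

Lemma coef_odd n : cmod (a n.*2.+1) + \sum_(0 <= k < n.+1) cmod (a k) ^+ 2 <= 1.
Proof.
set s := \sum_(_ <= _ < _) _; pose N := n.*2.+2.
have s0 : 0 <= s by apply: sumr_ge0 => k _; exact: sqr_ge0.
have [t t1 ht] := aligning_phase (a n.*2.+1).
(* This w makes the last entry of the image a_(2n+1) + t (|a_0|^2 + ... + |a_n|^2). *)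
pose w j : C := t * cj (a (n.*2.+1 - j)%N).
have sN : (N - n.+1)%N = n.+1 by rewrite /N; lia.
have rev (F : nat -> R) : \sum_(n.+1 <= j < N) F (n.*2.+1 - j)%N = \sum_(0 <= k < n.+1) F k.
  by rewrite -[X in \sum_(X <= _ < _) _]sN sum_rev_sq// /N; lia.
have := @toeplitz_test_vector R f a fa f1 w n.+1 N N isT _ _.
have -> : (n < N)%N by rewrite /N; lia.
move=> /(_ isT isT).
rewrite [X in _ <= 1 + X](eq_bigr (fun j => A (n.*2.+1 - j)%N)); last first.
  by move=> j _; rewrite /w cmodM t1 mul1r cmod_cj.
(* The test vector has squared norm 1 + s and the rows k <= n of its image already give s, so row 2n
   + 1 is at most 1 in modulus. *)
rewrite rev -/s addrC lerD2r {1}/N big_nat_recr /=; last by rewrite /N; lia.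
rewrite [X in a n.*2.+1 + X](_ : _ = t * s%:C); last first.
  rewrite /s -rev real_complex_sum big_distrr /=; apply: eq_big_nat => j /andP[_ jN].
  by rewrite /w /shift_seq -ltnS jN -mulrA -mul_cj [X in _ = _ * X]mulrC.
rewrite ht// => H.
have {}H : (cmod (a n.*2.+1) + s) ^+ 2 <= 1 ^+ 2.
  by rewrite expr1n; apply: le_trans H; rewrite lerDr sumr_ge0// => k _; exact: sqr_ge0.
by rewrite ler_pXn2r ?nnegrE ?addr_ge0 ?cmod_ge0// in H.
Qed.

Lemma coef_even n : (0 < n)%N -> cmod (a n.*2) + \sum_(0 <= k < n) cmod (a k) ^+ 2
  + cmod (a n) ^+ 2 / (1 + cmod (a 0%N)) <= 1.
Proof.
move=> n0; set s := \sum_(_ <= _ < _) _; pose N := n.*2.+1.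
have s0 : 0 <= s by apply: sumr_ge0 => k _; exact: sqr_ge0.
have c0 := cmod_ge0 (a 0%N).
pose mu := (1 + cmod (a 0%N))^-1.
have mu0 : 0 < mu by rewrite invr_gt0; lra.
have muE : 1 - mu * cmod (a 0%N) = mu by rewrite /mu; field; lra.
have [t t1 ht] := aligning_phase (a n.*2).
(* As in [coef_odd], but the middle coordinate is shared by w and by the rows
   that are compared; mu is chosen so that 1 - mu |a_0| = mu. *)
pose w j : C := t * (if j == n then mu%:C * cj (a n) else cj (a (n.*2 - j)%N)).
have rev (F : nat -> R) : \sum_(n.+1 <= j < N) F (n.*2 - j)%N = \sum_(0 <= k < n) F k.
  have -> : n.+1 = (N - n)%N by rewrite /N; lia.
  by rewrite sum_rev_sq// /N; lia.
have := @toeplitz_test_vector R f a fa f1 w n N N n0 _ _.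
have nN : (n < N)%N by rewrite /N; lia.
rewrite (ltnW nN) => /(_ isT isT).
have E (V : nmodType) (F : nat -> V) : \sum_(n <= j < N) F j = F n + \sum_(n.+1 <= j < N) F j.
  by rewrite big_ltn.
rewrite [X in _ <= 1 + X]E [X in _ <= 1 + (_ + X)](eq_big_nat _ _ (F2 := fun j => A (n.*2 - j)%N)); last first.
  by move=> j /andP[nj _]; rewrite /w gtn_eqF// cmodM t1 mul1r cmod_cj.
rewrite rev -/s.
have -> : cmod (w n) ^+ 2 = mu ^+ 2 * A n.
  by rewrite /w eqxx !cmodM t1 mul1r cmod_cj cmod_real ger0_norm ?(ltW mu0)// exprMn.
rewrite [X in s + X]E.
have -> : \sum_(n <= j < N) w j * shift_seq j a n = w n * a 0%N.
  rewrite E [X in _ + X]big_nat_cond big1 ?addr0; first by rewrite /shift_seq leqnn subnn.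
  by move=> j; rewrite andbT => /andP[nj _]; rewrite /shift_seq leqNgt nj mulr0.
(* Row n of the image pays for the squared norm of w_n, so again only the last row is left to be
   bounded by 1. *)
have h1 : mu ^+ 2 * A n <= cmod (a n + w n * a 0%N) ^+ 2.
  rewrite /A -exprMn ler_pXn2r ?nnegrE ?mulr_ge0 ?cmod_ge0 ?(ltW mu0)//.
  have := ler_cmodB (a n) (- (w n * a 0%N)); rewrite opprK cmodN; apply: le_trans.
  rewrite /w eqxx !cmodM t1 mul1r cmod_cj cmod_real ger0_norm ?(ltW mu0)//.
  have -> : cmod (a n) - mu * cmod (a n) * cmod (a 0%N) = (1 - mu * cmod (a 0%N)) * cmod (a n) by ring.
  by rewrite muE.
rewrite {2}/N big_nat_recr /=; last lia.
rewrite [X in a n.*2 + X](_ : _ = t * (mu * A n + s)%:C); last first.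
  rewrite E rmorphD /= mulrDr; congr (_ + _).
    rewrite /w eqxx /shift_seq -addnn leq_addr addnK rmorphM /= /A -mul_cj; ring.
  rewrite /s -rev real_complex_sum big_distrr /=; apply: eq_big_nat => j /andP[nj jN].
  rewrite /w gtn_eqF// /shift_seq -ltnS jN /A -mul_cj; ring.
have m0 : 0 <= mu * A n by rewrite mulr_ge0 ?A0 ?(ltW mu0).
rewrite ht ?addr_ge0// => H.
set u := \sum_(_ <= _ < _) _ in H.
have u0 : 0 <= u by apply: sumr_ge0 => k _; exact: sqr_ge0.
have {}H : (cmod (a n.*2) + (mu * A n + s)) ^+ 2 <= 1 ^+ 2 by rewrite expr1n; lra.
rewrite ler_pXn2r ?nnegrE ?addr_ge0 ?cmod_ge0// in H.
rewrite /A in H; rewrite -/mu [X in _ + X <= _]mulrC; lra.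
Qed.

Lemma coef_sq_sum_le1 n : \sum_(0 <= k < n) cmod (a k) ^+ 2 <= 1.
Proof.
case: n => [|n]; first by rewrite big_nil.
have Z (F : nat -> R) : \sum_(n.+1 <= k < n.+1) F k = 0 by rewrite big_geq.
by have := @toeplitz_test_vector R f a fa f1 (fun=> 0) n.+1 n.+1 n.+1 isT (leqnn _) (leqnn _); rewrite !Z !addr0.
Qed.

Lemma coef0_le1 : cmod (a 0%N) <= 1.
Proof.
have := coef_sq_sum_le1 1; rewrite big_nat1 -[leRHS](expr1n _ 2).
by rewrite ler_pXn2r ?nnegrE ?cmod_ge0.
Qed.

Lemma coef_eq0 n : cmod (a 0%N) = 1 -> (0 < n)%N -> a n = 0.
Proof.
move=> a1 n0; apply/eqP; rewrite -cmod_eq0 -sqrf_eq0 eq_le sqr_ge0 andbT.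
have := coef_sq_sum_le1 n.+1; rewrite big_nat_recr// big_ltn//= a1 expr1n.
suff : 0 <= \sum_(1 <= i < n) cmod (a i) ^+ 2 by lra.
by apply: sumr_ge0 => k _; exact: sqr_ge0.
Qed.

(** A test vector with the single free entry w_(n+1) gives |a_(n+1)|^2 <= (1 - x)(1 - x - s), where
    x = |a_0|^2 and s is the square sum from 1 to n. The recursion is a rearrangement; Blaschke
    factors make it an equality. *)
Lemma coef_partial n : \sum_(1 <= k < n.+2) cmod (a k) ^+ 2 <=
  (1 - cmod (a 0%N) ^+ 2) ^+ 2 + cmod (a 0%N) ^+ 2 * \sum_(1 <= k < n.+1) cmod (a k) ^+ 2.
Proof.
have [a1|a1] := eqVneq (cmod (a 0%N)) 1.
  rewrite a1 expr1n subrr expr0n add0r mul1r big_nat_recr//= coef_eq0//.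
  by rewrite cmod0 expr0n addr0.
have q0 : 0 < 1 - A 0.
  rewrite subr_gt0 /A -(expr1n _ 2) ltr_pXn2r ?nnegrE ?cmod_ge0//.
  by rewrite lt_neqAle a1 coef0_le1.
(* The maximiser of |a_(n+1) + w a_0|^2 - |w|^2. *)
pose w (j : nat) : C := cj (a 0%N) * a n.+1 * (1 - A 0)^-1%:C.
have := @toeplitz_test_vector R f a fa f1 w n.+1 n.+2 n.+2 isT (leqnSn _) (leqnSn _).
rewrite !big_nat1 /shift_seq leqnn subnn big_ltn// cmodM cmodM cmod_cj cmod_real.
have -> : a n.+1 + w n.+1 * a 0%N = a n.+1 * (1 - A 0)^-1%:C.
  have h : (A 0)%:C * (1 - A 0)^-1%:C = (1 - A 0)^-1%:C - 1 :> C.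
    rewrite -rmorphM -(rmorph1 (real_complex R)) -rmorphB; congr (_%:C).
    by field; rewrite gt_eqF.
  rewrite /w; have -> : cj (a 0%N) * a n.+1 * (1 - A 0)^-1%:C * a 0%N =
    a n.+1 * (a 0%N * cj (a 0%N) * (1 - A 0)^-1%:C) by ring.
  by rewrite mul_cj -/(A 0) h; ring.
rewrite cmodM cmod_real ger0_norm ?invr_ge0 ?(ltW q0)// !exprMn -/(A 0) -/(A n.+1).
rewrite [\sum_(1 <= k < n.+2) _]big_nat_recr//= -/(A n.+1).
set s := \sum_(1 <= k < n.+1) _.
move: q0; move: (A0 n.+1) (A 0) (A n.+1) => a0 x y q0 H.
have {}H : y * (1 - x) <= (1 - x - s) * (1 - x) ^+ 2.
  have -> : y * (1 - x) = (y * (1 - x)^-1 ^+ 2 - x * y * (1 - x)^-1 ^+ 2) * (1 - x) ^+ 2.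
    by field; rewrite gt_eqF.
  by rewrite ler_wpM2r ?sqr_ge0//; lra.
have : y <= (1 - x - s) * (1 - x).
  by rewrite -(ler_pM2r q0); apply: le_trans H _; rewrite expr2 mulrA.
lra.
Qed.
End Coefficients.

Section Sums.
Variable R : realType.
Local Notation C := (cplx R).

Lemma sum_deriv_geom (F : fieldType) (y : F) n : y != 1 ->
  \sum_(1 <= k < n.+1) k%:R * y ^+ k.-1 = (1 - y ^+ n * (1 + n%:R * (1 - y))) / (1 - y) ^+ 2.
Proof.
move=> y1; have h : 1 - y != 0 by rewrite subr_eq0 eq_sym.
elim: n => [|n IH]; first by rewrite big_geq// expr0 mul0r addr0 mul1r subrr mul0r.
by rewrite big_nat_recr//= IH [y ^+ n.+1]exprS -natr1; field.
Qed.

Section Fix.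
Variables (f : C -> C) (a : nat -> C).
Hypotheses (fa : rep f a 0 1) (f1 : forall z, cmod z < 1 -> cmod (f z) <= 1).

Let x := cmod (a 0%N) ^+ 2.
Let x0 : 0 <= x. Proof. exact: sqr_ge0. Qed.
Let x1 : x <= 1. Proof. by rewrite exprn_ile1 ?cmod_ge0// (coef0_le1 fa f1). Qed.

Let s n := \sum_(1 <= k < n.+1) cmod (a k) ^+ 2.
(** The corresponding square sum of the Blaschke factor with the same |a_0|. *)
Let sg n := \sum_(1 <= k < n.+1) (1 - x) ^+ 2 * x ^+ k.-1.

Lemma coef_square_sum n : s n <= sg n.
Proof.
elim: n => [|n IH]; first by rewrite /s /sg !big_geq.
apply: le_trans (coef_partial fa f1 n) _; rewrite -/x -/(s n).
have -> : sg n.+1 = (1 - x) ^+ 2 + x * sg n.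
  rewrite /sg big_nat_recl//= expr0 mulr1; congr (_ + _).
  rewrite big_distrr /=; apply: eq_big_nat => -[//|k] _; rewrite /= [x ^+ k.+1]exprS; ring.
by rewrite lerD2l ler_wpM2l.
Qed.

Lemma area_coef_sum (r : R) n : 0 <= r -> 2 * r ^+ 2 <= 1 ->
  \sum_(1 <= k < n.+1) k%:R * cmod (a k) ^+ 2 * r ^+ (2 * k) <=
  r ^+ 2 * (1 - x) ^+ 2 / (1 - x * r ^+ 2) ^+ 2.
Proof.
move=> r0 r2.
pose w k : R := k%:R * r ^+ (2 * k).
have w0 k : 0 <= w k by rewrite mulr_ge0 ?exprn_ge0.
(* The ratio of consecutive weights is (k + 1) / k * r^2, at most 2 r^2 for k >= 1. *)
have wd k : (0 < k)%N -> w k.+1 <= w k.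
  move=> k0; rewrite /w mulnS exprD mulrA ler_wpM2r ?exprn_ge0//.
  have k1 : 1 <= k%:R :> R by rewrite ler1n.
  rewrite -natr1; nra.
(* Abel summation against the weights w, which are nonincreasing as 2 r^2 <= 1. *)
have key : \sum_(1 <= k < n.+1) w k * cmod (a k) ^+ 2 + w n * (sg n - s n) <=
    \sum_(1 <= k < n.+1) w k * ((1 - x) ^+ 2 * x ^+ k.-1).
  elim: n => [|n IH]; first by rewrite !big_geq// /w !mul0r addr0.
  rewrite ![\sum_(1 <= k < n.+2) w k * _]big_nat_recr//=.
  have -> : s n.+1 = s n + cmod (a n.+1) ^+ 2 by rewrite /s big_nat_recr.
  have -> : sg n.+1 = sg n + (1 - x) ^+ 2 * x ^+ n by rewrite /sg big_nat_recr.
  have : w n.+1 * (sg n - s n) <= w n * (sg n - s n).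
    case: n {IH} => [|n]; first by rewrite /s /sg !big_geq// subrr !mulr0.
    by rewrite ler_wpM2r ?subr_ge0 ?coef_square_sum// wd.
  move: IH; set S1 := \sum_(_ <= _ < _) _; set S2 := \sum_(_ <= _ < _) _; lra.
have {}key : \sum_(1 <= k < n.+1) w k * cmod (a k) ^+ 2 <= \sum_(1 <= k < n.+1) w k * ((1 - x) ^+ 2 * x ^+ k.-1).
  apply: le_trans key; rewrite lerDl mulr_ge0// subr_ge0; exact: coef_square_sum.
rewrite (eq_bigr (fun k => w k * cmod (a k) ^+ 2)); last by move=> k _; rewrite /w mulrAC.
apply: (le_trans key).
rewrite (eq_big_nat _ _ (F2 := fun k => r ^+ 2 * (1 - x) ^+ 2 * (k%:R * (x * r ^+ 2) ^+ k.-1))); last first.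
  move=> [//|k] _; rewrite /w /= mulnS exprD [r ^+ (2 * k)]exprM [(x * _) ^+ k]exprMn; ring.
have xr : x * r ^+ 2 <= 1 / 2.
  apply: le_trans (_ : 1 * r ^+ 2 <= _); first by rewrite ler_wpM2r ?sqr_ge0.
  lra.
rewrite -big_distrr /= sum_deriv_geom; last by rewrite lt_eqF//; lra.
rewrite mulrA ler_wpM2r ?invr_ge0 ?sqr_ge0//.
apply: ler_piMr; first by rewrite mulr_ge0 ?sqr_ge0.
rewrite lerBlDr lerDl.
apply: mulr_ge0; first by apply: exprn_ge0; apply: mulr_ge0 => //; exact: sqr_ge0.
by apply: addr_ge0 => //; apply: mulr_ge0 => //; lra.
Qed.

(** The moduli run up to 2n + 1 while the squares stop at n, because a_(2k) and a_(2k+1) are both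
    limited by what the squares up to index k leave of 1. *)
Lemma bohr_tail_sum (r : R) n : 0 <= r < 1 ->
  \sum_(2 <= k < n.*2.+2) cmod (a k) * r ^+ k +
  ((1 + cmod (a 0%N))^-1 + r / (1 - r)) * \sum_(1 <= k < n.+1) cmod (a k) ^+ 2 * r ^+ (2 * k)
  <= (1 - x) * r ^+ 2 / (1 - r).
Proof.
move=> /andP[r0 r1]; set K := _ + r / (1 - r).
have r1' : 0 < 1 - r by lra.
have D0 : 0 <= 1 - x - s n.
  have := coef_sq_sum_le1 fa f1 n.+1; rewrite big_ltn//= -/x -/(s n); lra.
(* The added term bounds the remaining tail: its loss from n to n + 1 pays exactly
   for the two new coefficients, by [coef_even] and [coef_odd]. *)
suff key : \sum_(2 <= k < n.*2.+2) cmod (a k) * r ^+ k +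
  K * \sum_(1 <= k < n.+1) cmod (a k) ^+ 2 * r ^+ (2 * k) + (1 - x - s n) * r ^+ n.*2.+2 / (1 - r)
  <= (1 - x) * r ^+ 2 / (1 - r).
  apply: le_trans key; rewrite lerDl; apply: divr_ge0; last lra.
  by rewrite mulr_ge0 ?exprn_ge0.
elim: n {D0} => [|n IH].
  by rewrite !big_geq// mulr0 /s big_geq// subr0 !add0r.
apply: le_trans IH.
rewrite doubleS [\sum_(2 <= k < _.+4) _]big_nat_recr//= [\sum_(2 <= k < _.+3) _]big_nat_recr//=.
rewrite [\sum_(1 <= k < n.+2) _]big_nat_recr//=.
have -> : s n.+1 = s n + cmod (a n.+1) ^+ 2 by rewrite /s big_nat_recr.
have h1 := coef_even fa f1 (ltn0Sn n).
have h2 := coef_odd fa f1 n.+1.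
rewrite big_nat_recr//= in h2.
have E : \sum_(0 <= k < n.+1) cmod (a k) ^+ 2 = x + s n by rewrite big_ltn.
rewrite E doubleS in h1; rewrite E doubleS in h2.
set S1 := \sum_(2 <= k < _) _; set S2 := \sum_(1 <= k < _) _.
set q := cmod (a n.+1) ^+ 2 in h1 h2 *.
set c1 := cmod (a n.*2.+2) in h1 *; set c2 := cmod (a n.*2.+3) in h2 *.
rewrite mulnS mul2n !exprS; set p := r ^+ n.*2.
have p0 : 0 <= p by rewrite exprn_ge0.
set D := 1 - x - s n.
set c0 := (1 + cmod (a 0%N))^-1.
have hc1 : c1 <= D - q * c0 by rewrite /D /c0; lra.
have hc2 : c2 <= D - q by rewrite /D; lra.
have rp : 0 <= r * (r * p) by rewrite !mulr_ge0.
have rp' : 0 <= r * (r * (r * p)) by rewrite !mulr_ge0.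
have := ler_wpM2r rp hc1; have := ler_wpM2r rp' hc2.
have -> : 1 - x - (s n + q) = D - q by rewrite /D; ring.
(* The losses in q add up to c0 + r + r^2 / (1 - r) = K: this is the origin of the weight 1 / (1 +
   |a_0|) + r / (1 - r). *)
have EE : (D - q * c0) * (r * (r * p)) + (D - q) * (r * (r * (r * p))) + K * (q * (r * (r * p)))
  + (D - q) * (r * (r * (r * (r * p)))) / (1 - r) = D * (r * (r * p)) / (1 - r).
  by rewrite /K -/c0; field; lra.
rewrite mulrDr; move: EE; rewrite -/p.
set U := K * (q * (r * (r * p))).
set W := (D - q) * (r * (r * (r * (r * p)))) / (1 - r); lra.
Qed.

End Fix.
End Sums.

Section CvgN.
Variable K : numFieldType.
Implicit Types (u v : nat -> K) (a b : K).

Lemma cvgnD u v a b : u @ \oo --> a -> v @ \oo --> b -> (fun n => u n + v n) @ \oo --> a + b.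
Proof. exact: cvgD. Qed.
Lemma cvgnM u v a b : u @ \oo --> a -> v @ \oo --> b -> (fun n => u n * v n) @ \oo --> a * b.
Proof. exact: cvgM. Qed.
Lemma cvgnZ c v b : v @ \oo --> b -> (fun n => c * v n) @ \oo --> c * b.
Proof. by apply: cvgM; exact: cvg_cst. Qed.
Arguments cvgnZ c {v b}.
Lemma cvgn_ext u v a : u @ \oo --> a -> (forall n, v n = u n) -> v @ \oo --> a.
Proof. by move=> h /funext->. Qed.
Lemma cvgn_geom (x : K) : x != 1 -> x ^+ n @[n --> \oo] --> 0 -> \sum_(0 <= k < n) x ^+ k @[n --> \oo] --> (1 - x)^-1.
Proof.
move=> x1 H.
have H1 : (fun n => (1 - x)^-1 * (1 + -1 * x ^+ n)) @ \oo --> (1 - x)^-1 * (1 + -1 * 0).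
  by apply: cvgnZ; apply: cvgnD; [exact: cvg_cst|exact: cvgnZ].
rewrite mulr0 addr0 mulr1 in H1; apply: (cvgn_ext H1) => n.
by rewrite geom_sum// mulrC mulN1r.
Qed.
End CvgN.
Arguments cvgnZ {K} c {v b}.

(** * Schwarz-Pick bounds *)

Section Pick.
Variable R : realType.
Local Notation C := (cplx R).

(** The identity behind the pseudo-hyperbolic distance. Applied to points and to values, it converts
    [pick_det] into [schwarz_pick]. *)
Lemma cmodB_sqr (z w : C) : cmod (1 - z * cj w) ^+ 2 =
  cmod (z - w) ^+ 2 + (1 - cmod z ^+ 2) * (1 - cmod w ^+ 2).
Proof.
rewrite !cmod_sqr; case: z => a b; case: w => c d /=; ring.
Qed.

Lemma cmodD_sqr (z w : C) : cmod (z + w) ^+ 2 = cmod z ^+ 2 + cmod w ^+ 2 + 2 * complex.Re (z * cj w).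
Proof. by rewrite !cmod_sqr; case: z => a b; case: w => c d /=; ring. Qed.

Lemma cvg_cmod (u : nat -> C) (l : C) : u @ \oo --> l -> cmod (u n) @[n --> \oo] --> cmod l.
Proof.
move=> /cvgCP/cvgrPdist_lt h; apply/cvgrPdist_lt => e /h; apply: filterS => n.
rewrite sub0r normrN ger0_norm ?cmod_ge0//; apply: le_lt_trans.
rewrite ler_norml lerBrDr; apply/andP; split.
  by rewrite addrC -lerBrDr opprK; have := ler_cmodD (u n - l) l; rewrite subrK addrC; lra.
by have := ler_cmodB l (u n); rewrite [X in _ <= X]cmodBC; lra.
Qed.

Lemma cvg_Re (u : nat -> C) (l : C) : u @ \oo --> l -> complex.Re (u n) @[n --> \oo] --> complex.Re l.
Proof.
move=> /cvgCP/cvgrPdist_lt h; apply/cvgrPdist_lt => e /h; apply: filterS => n.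
rewrite sub0r normrN ger0_norm ?cmod_ge0//; apply: le_lt_trans.
by apply: le_trans (Re_le_cmod _); rewrite distrC; case: (u n) (l) => [? ?] [? ?].
Qed.

Lemma cvg_geomC (z : C) : cmod z < 1 -> series (fun k => z ^+ k) @ \oo --> (1 - z)^-1.
Proof.
move=> z1; have z1' : z != 1 by apply/eqP => h; rewrite h cmod1 ltxx in z1.
have h : 1 - z != 0 by rewrite subr_eq0 eq_sym.
have H : z ^+ n @[n --> \oo] --> (0 : C).
  apply/cvgCP; under eq_fun do rewrite subr0 cmodX.
  by apply: cvg_expr; rewrite ger0_norm ?cmod_ge0.
exact: cvgn_geom.
Qed.

(** The squared Hardy norm of a combination of two reproducing kernels, whose coefficients are
    geometric sequences. *)
Lemma geom2_cvg (al be x y : C) : cmod x < 1 -> cmod y < 1 ->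
  \sum_(0 <= k < n) cmod (al * x ^+ k + be * y ^+ k) ^+ 2 @[n --> \oo] -->
  cmod al ^+ 2 / (1 - cmod x ^+ 2) + cmod be ^+ 2 / (1 - cmod y ^+ 2) +
  2 * complex.Re (al * cj be * (1 - x * cj y)^-1).
Proof.
move=> x1 y1.
have gr (z : C) : cmod z < 1 -> series (fun k => (cmod z ^+ 2) ^+ k) @ \oo --> (1 - cmod z ^+ 2)^-1.
  move=> z1; have zz : cmod z ^+ 2 < 1 by rewrite expr_lt1// cmod_ge0.
  have H : (cmod z ^+ 2) ^+ n @[n --> \oo] --> (0 : R).
    by apply: cvg_expr; rewrite ger0_norm ?sqr_ge0.
  by apply: cvgn_geom => //; rewrite lt_eqF.
have xy : cmod (x * cj y) < 1.
  by rewrite cmodM cmod_cj -[ltRHS]mulr1; apply: ltr_pM => //; exact: cmod_ge0.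
have H3 := cvg_Re (cvgnZ (al * cj be) (cvg_geomC xy)).
have H := cvgnD (cvgnD (cvgnZ (cmod al ^+ 2) (gr _ x1)) (cvgnZ (cmod be ^+ 2) (gr _ y1)))
   (cvgnZ (2 : R) H3).
apply: (cvgn_ext H) => n; symmetry.
rewrite /series /= !big_distrr /= Re_sum big_distrr -!big_split /=; apply: eq_bigr => k _.
have sq (u : R) : (u ^+ k) ^+ 2 = (u ^+ 2) ^+ k by rewrite -!exprM mulnC.
rewrite cmodD_sqr !cmodM !cmodX cjM cjX [(cmod al * _) ^+ 2]exprMn [(cmod be * _) ^+ 2]exprMn !sq.
by congr (_ + 2 * complex.Re _); rewrite [(x * _) ^+ k]exprMn; ring.
Qed.

Section Fix.
Variables (f : C -> C) (a : nat -> C).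
Hypotheses (fa : rep f a 0 1) (f1 : forall z, cmod z < 1 -> cmod (f z) <= 1).

(** Let L be the left side and v the conjugate of the image of u. Then L is the pairing of the
    Toeplitz image of v with u, so 2 L is at most the squared norm of that image plus that of u, and
    [toeplitz_contraction] bounds the former by L. *)
Lemma adjoint_contraction (u : nat -> C) N :
  \sum_(0 <= j < N) cmod (\sum_(0 <= k < N) shift_seq j a k * u k) ^+ 2 <= \sum_(0 <= k < N) cmod (u k) ^+ 2.
Proof.
pose y j := \sum_(0 <= k < N) shift_seq j a k * u k.
pose v j := cj (y j).
have H := toeplitz_contraction fa f1 v N N.
set L := \sum_(0 <= j < N) _; set U := \sum_(0 <= k < N) _.
have LE : (L%:C : C) = \sum_(0 <= k < N) pconvol v a N k * u k.
  rewrite real_complex_sum; under eq_bigr do rewrite -mul_cj big_distrl /=.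
  rewrite exchange_big /=; apply: eq_bigr => k _.
  rewrite /pconvol big_distrl /=; apply: eq_bigr => j _; rewrite /v /y; ring.
have L0 : 0 <= L by apply: sumr_ge0 => k _; exact: sqr_ge0.
have : 2 * L <= \sum_(0 <= k < N) cmod (pconvol v a N k) ^+ 2 + U.
  rewrite -[L]ger0_norm// -cmod_real LE.
  apply: le_trans (ler_wpM2l _ (ler_cmod_sum _ _ _)) _ => //.
  rewrite big_distrr -big_split /=; apply: ler_sum => k _; rewrite cmodM.
  have := sqr_ge0 (cmod (pconvol v a N k) - cmod (u k)); lra.
have : \sum_(0 <= j < N) cmod (v j) ^+ 2 = L by apply: eq_bigr => j _; rewrite cmod_cj.
move: H; lra.
Qed.

(* The adjoint of multiplication by f, applied to a combination of two
   reproducing kernels of the Hardy space. *)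
Lemma pick_form (w1 w2 d1 d2 : C) : cmod w1 < 1 -> cmod w2 < 1 ->
  cmod (d1 * f w1) ^+ 2 / (1 - cmod w1 ^+ 2) + cmod (d2 * f w2) ^+ 2 / (1 - cmod w2 ^+ 2) +
    2 * complex.Re (d1 * f w1 * cj (d2 * f w2) * (1 - w1 * cj w2)^-1) <=
  cmod d1 ^+ 2 / (1 - cmod w1 ^+ 2) + cmod d2 ^+ 2 / (1 - cmod w2 ^+ 2) +
    2 * complex.Re (d1 * cj d2 * (1 - w1 * cj w2)^-1).
Proof.
move=> h1 h2; set Q := leRHS.
have HQ := @geom2_cvg d1 d2 w1 w2 h1 h2; rewrite -/Q in HQ.
have ub N : \sum_(0 <= k < N) cmod (d1 * w1 ^+ k + d2 * w2 ^+ k) ^+ 2 <= Q.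
    rewrite -(cvg_lim _ HQ)//; apply: (nondecreasing_cvgn_le (u_ := fun n => \sum_(0 <= k < n) cmod
      (d1 * w1 ^+ k + d2 * w2 ^+ k) ^+ 2)).
    by apply/nondecreasing_seqP => n; rewrite big_nat_recr//= lerDl sqr_ge0.
  by apply: cvgP; exact: HQ.
have key J : \sum_(0 <= j < J) cmod (d1 * f w1 * w1 ^+ j + d2 * f w2 * w2 ^+ j) ^+ 2 <= Q.
  (* Geometric sequences are eigenvectors of the adjoint: the sum over k >= j of a_(k-j) w^k is w^j
     f(w). *)
  have term j : (fun N => \sum_(0 <= k < N) shift_seq j a k * (d1 * w1 ^+ k + d2 * w2 ^+ k)) @ \oo -->
     (d1 * f w1 * w1 ^+ j + d2 * f w2 * w2 ^+ j : C).
    have cv w : cmod w < 1 -> series (fun k => shift_seq j a k * w ^+ k) @ \oo --> w ^+ j * f w.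
      move=> ww; have pa : pconv a (cmod w) by apply: (rep_pconv fa); rewrite cmod_ge0.
      have := @shift_seq_cvg R a (cmod w) j w pa (lexx _).
      by have E := rep_ps fa (z := w); rewrite subr0 in E; rewrite -E.
    have H := cvgnD (cvgnZ d1 (cv _ h1)) (cvgnZ d2 (cv _ h2)).
    have -> : d1 * f w1 * w1 ^+ j + d2 * f w2 * w2 ^+ j = d1 * (w1 ^+ j * f w1) + d2 * (w2 ^+ j * f w2) by ring.
    apply: (cvgn_ext H) => n; symmetry.
    rewrite /series /= !big_distrr -big_split /=; apply: eq_bigr => k _; ring.
  have S : \sum_(0 <= j < J) cmod (\sum_(0 <= k < N) shift_seq j a k * (d1 * w1 ^+ k + d2 * w2 ^+ k)) ^+ 2 @[N --> \oo] -->
     \sum_(0 <= j < J) cmod (d1 * f w1 * w1 ^+ j + d2 * f w2 * w2 ^+ j) ^+ 2.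
    elim: J => [|J IH].
      by rewrite big_nil; under eq_fun do rewrite big_nil; exact: cvg_cst.
    rewrite big_nat_recr//=.
    apply: (cvgn_ext (cvgnD IH (cvgnM (cvg_cmod (term J)) (cvg_cmod (term J))))) => n.
    by rewrite big_nat_recr.
  rewrite -(cvg_lim _ S)//; apply: limr_le; first by apply: cvgP; exact: S.
  exists J => // N /= JN.
  apply: le_trans (ub N); apply: le_trans (adjoint_contraction _ N).
  rewrite [leRHS](sum_nat_split _ JN) lerDl; apply: sumr_ge0 => k _; exact: sqr_ge0.
have HP := @geom2_cvg (d1 * f w1) (d2 * f w2) w1 w2 h1 h2.
rewrite -(cvg_lim _ HP)//; apply: limr_le; first by apply: cvgP; exact: HP.
by apply: nearW.
Qed.

(** Pick's criterion for two nodes: by [pick_form] the matrix with entries (1 - f(w_i) conj f(w_j))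
    / (1 - w_i conj w_j) is positive semidefinite, so its determinant is nonnegative; denominators
    are cleared here. *)
Lemma pick_det (w1 w2 : C) : cmod w1 < 1 -> cmod w2 < 1 ->
  cmod (1 - f w1 * cj (f w2)) ^+ 2 * ((1 - cmod w1 ^+ 2) * (1 - cmod w2 ^+ 2)) <=
  (1 - cmod (f w1) ^+ 2) * (1 - cmod (f w2) ^+ 2) * cmod (1 - w1 * cj w2) ^+ 2.
Proof.
move=> h1 h2.
have sq (w : C) : cmod w < 1 -> 0 < 1 - cmod w ^+ 2.
  by move=> ww; rewrite subr_gt0 expr_lt1// cmod_ge0.
have W1 := sq _ h1; have W2 := sq _ h2.
have xy : cmod (w1 * cj w2) < 1.
  by rewrite cmodM cmod_cj -[ltRHS]mulr1; apply: ltr_pM => //; exact: cmod_ge0.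
have z0 : 1 - w1 * cj w2 != 0.
  by rewrite subr_eq0; apply/eqP => h; rewrite -h cmod1 ltxx in xy.
have c0 : 0 < cmod (1 - w1 * cj w2) by rewrite lt_neqAle cmod_ge0 andbT eq_sym cmod_eq0.
pose P11 := (1 - cmod (f w1) ^+ 2) / (1 - cmod w1 ^+ 2).
pose P22 := (1 - cmod (f w2) ^+ 2) / (1 - cmod w2 ^+ 2).
pose P12 : C := (1 - f w1 * cj (f w2)) / (1 - w1 * cj w2).
have f2 (w : C) : cmod w < 1 -> 0 <= 1 - cmod (f w) ^+ 2.
  by move=> /f1 ww; rewrite subr_ge0 exprn_ile1 ?cmod_ge0.
have P11p : 0 <= P11 by rewrite divr_ge0 ?f2// ltW.
have P22p : 0 <= P22 by rewrite divr_ge0 ?f2// ltW.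
set m := cmod P12 ^+ 2.
(* A quadratic in t whose discriminant is that of the Pick matrix. *)
have key (t : R) : 0 <= t ^+ 2 * P11 + m * P22 - 2 * (t * m).
  have := @pick_form w1 w2 t%:C (- P12) h1 h2.
  rewrite !cmodM !cmodN cmod_real !exprMn -/m real_normK ?num_real//.
  have -> : t%:C * f w1 * cj (- P12 * f w2) * (1 - w1 * cj w2)^-1 =
    t%:C * cj (- P12) * (1 - w1 * cj w2)^-1 + (t * m)%:C.
    rewrite rmorphM /= -mul_cj cjM !cjN; move: (cj P12) => q; rewrite /P12; ring.
  rewrite raddfD /= -subr_ge0 => h; apply: le_trans h _.
  by rewrite /P11 /P22 le_eqVlt; apply/orP; left; apply/eqP; ring.
have m0 : 0 <= m by exact: sqr_ge0.
have mP : m <= P11 * P22.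
  have [p|p] := eqVneq P11 0.
    have := key (P22 + 1); rewrite p mulr0 add0r mul0r.
    have := mulr_ge0 m0 P22p; lra.
  have pp : 0 < P11 by rewrite lt_neqAle eq_sym p.
  have [->|mn] := eqVneq m 0; first exact: mulr_ge0.
  have mp : 0 < m by rewrite lt_neqAle eq_sym mn.
  have := key (m / P11).
  have -> : (m / P11) ^+ 2 * P11 + m * P22 - 2 * (m / P11 * m) = m * (P22 - m / P11) by field.
  by rewrite pmulr_rge0// subr_ge0 ler_pdivrMr// mulrC.
move: mP; rewrite /m /P12 /P11 /P22 cmodM cmodV exprMn exprVn mulrACA -invfM.
rewrite ler_pdivrMr ?exprn_gt0// => H.
by rewrite -ler_pdivlMr ?mulr_gt0// [leRHS]mulrAC.
Qed.

Lemma schwarz_pick (w1 w2 : C) : cmod w1 < 1 -> cmod w2 < 1 ->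
  cmod (f w1 - f w2) * cmod (1 - w1 * cj w2) <= cmod (1 - f w1 * cj (f w2)) * cmod (w1 - w2).
Proof.
move=> h1 h2; rewrite -(ler_pXn2r (_ : 0 < 2)%N) ?nnegrE ?mulr_ge0 ?cmod_ge0// !exprMn.
have := pick_det h1 h2.
have E1 := cmodB_sqr (f w1) (f w2); have E2 := cmodB_sqr w1 w2.
move: E1 E2; set x := cmod (_ - f w1 * _) ^+ 2; set y := cmod (_ - w1 * _) ^+ 2 => E1 E2.
have -> : (1 - cmod w1 ^+ 2) * (1 - cmod w2 ^+ 2) = y - cmod (w1 - w2) ^+ 2 by rewrite E2; ring.
have -> : (1 - cmod (f w1) ^+ 2) * (1 - cmod (f w2) ^+ 2) = x - cmod (f w1 - f w2) ^+ 2 by rewrite E1; ring.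
lra.
Qed.

(** [pick_det] at w2 = 0, once |1 - f(z) conj a_0| is weakened to 1 - |f(z)| |a_0|, compares two
    squares: (x - y)^2 <= (r (1 - x y))^2 in the moduli. *)
Lemma growth_bound (z : C) : cmod z < 1 ->
  cmod (f z) <= (cmod z + cmod (a 0%N)) / (1 + cmod (a 0%N) * cmod z).
Proof.
move=> z1.
have f0 : f 0 = a 0%N.
  have := rep_coef_fact 0 ltr01 fa; by rewrite derive1n0 fact0 mul1r.
have := @pick_det z 0 z1; rewrite cmod0 => /(_ ltr01).
rewrite cj0 mulr0 subr0 cmod1 expr1n mulr1 expr0n subr0 mulr1 f0.
have := coef0_le1 fa f1; have := f1 z1.
have := cmod_ge0 z; have := cmod_ge0 (f z); have := cmod_ge0 (a 0%N).
have : 1 - cmod (f z) * cmod (a 0%N) <= cmod (1 - f z * cj (a 0%N)).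
  by have := ler_cmodB 1 (f z * cj (a 0%N)); rewrite cmod1 cmodM cmod_cj.
move: z1; set r := cmod z; set x := cmod (f z); set y := cmod (a 0%N); set D := cmod _.
move=> r1 Dh y0 x0 r0 x1 y1 H.
rewrite ler_pdivlMr; last by have := mulr_ge0 y0 r0; lra.
have xy : 0 <= x * y by rewrite mulr_ge0.
have xy1 : 0 <= 1 - x * y.
  by rewrite subr_ge0 -[leRHS]mulr1 ler_pM.
have H2 : (1 - x * y) ^+ 2 * (1 - r ^+ 2) <= (1 - x ^+ 2) * (1 - y ^+ 2).
  apply: le_trans H; rewrite ler_wpM2r//; first by rewrite subr_ge0 exprn_ile1// ltW.
  by rewrite lerXn2r// nnegrE// (le_trans xy1).
have H3 : (x - y) ^+ 2 <= (r * (1 - x * y)) ^+ 2 by rewrite exprMn; nra.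
have : x - y <= r * (1 - x * y).
  case: (lerP (x - y) 0) => h; first by apply: le_trans h _; rewrite mulr_ge0.
  by move: H3; rewrite ler_pXn2r// nnegrE ?(ltW h)// mulr_ge0.
lra.
Qed.

(** [schwarz_pick] for z and z + t with t real and small, divided by t; the difference quotient q
    stands for the derivative up to d. *)
Lemma derive_bound (z : C) : cmod z < 1 ->
  cmod (derive1 f z) * (1 - cmod z ^+ 2) <= 1 - cmod (f z) ^+ 2.
Proof.
move=> z1.
have fr := @rep_reexp R f a 0 z 1 fa; rewrite subr0 in fr; have {}fr := fr z1.
have s0 : 0 < 1 - cmod z by lra.
rewrite (rep_derive_center s0 fr).
have /cvgCP/cvgrPdist_lt H := rep_cvg_derive s0 fr.
set D := cmod _; have D0 : 0 <= D by exact: cmod_ge0.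
set r := cmod z in z1 s0 *; have r0 : 0 <= r by exact: cmod_ge0.
have rr : 0 < 1 - r ^+ 2 by rewrite subr_gt0 expr_lt1.
apply/ler_addgt0Pr => e e0.
(* The three bounds keep 1 - r^2 - 2 t nonnegative, z + t in the disc, and the final error d (2 D +
   1) below e. *)
pose d := Num.min ((1 - r ^+ 2) / 2) (Num.min (1 - r) (e / (2 * D + 1))).
have de : 0 < e / (2 * D + 1) by rewrite divr_gt0//; lra.
have d0 : 0 < d by rewrite /d !lt_min s0 de !andbT; lra.
have d1 : d <= (1 - r ^+ 2) / 2 by rewrite /d ge_min lexx.
have d2 : d <= 1 - r by rewrite /d !ge_min lexx ?orbT.
have d3 : d * (2 * D + 1) <= e by rewrite -ler_pdivlMr; [rewrite /d !ge_min lexx ?orbT|lra].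
have := H d d0 => /nbhsCP[eta eta0 He].
pose t := Num.min (d / 2) (eta / 2).
have t0 : 0 < t by rewrite /t lt_min !divr_gt0.
have t1 : t < eta by rewrite /t gt_min; apply/orP; right; lra.
have t2 : t < d by rewrite /t gt_min; apply/orP; left; lra.
have tc : cmod (t%:C : C) = t by rewrite cmod_real ger0_norm// ltW.
have := He t%:C; rewrite subr0 tc => /(_ t1).
have -> : (t%:C != 0 :> C) by rewrite -cmod_eq0 tc gt_eqF.
move=> /(_ isT); rewrite sub0r normrN ger0_norm ?cmod_ge0//.
set q := (_ *: _); move=> qd.
have Dq : D - d <= cmod q.
  by have := ler_cmodB (reexp a z 1) (reexp a z 1 - q); rewrite subKr -/D [cmod (_ - q)]cmodBC; lra.
have wz1 : cmod (t%:C + z) < 1 by apply: le_lt_trans (ler_cmodD _ _) _; rewrite tc -/r; lra.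
have := schwarz_pick wz1 z1; rewrite addrK tc.
have fq : f (t%:C + z) = f z + t%:C * q.
  rewrite /q -[_ *: _]/(_ * _) mulVKf; first by rewrite [RHS]addrC subrK.
  by rewrite -cmod_eq0 tc gt_eqF.
clearbody q.
set F := cmod (f z); have F0 : 0 <= F by exact: cmod_ge0.
have F1 : F <= 1 by exact: f1.
have b1 : 1 - r ^+ 2 - t <= cmod (1 - (t%:C + z) * cj z).
  have -> : 1 - (t%:C + z) * cj z = (1 - r ^+ 2)%:C - t%:C * cj z.
    by rewrite rmorphB /= rmorph1 -mul_cj; ring.
  have := ler_cmodB (1 - r ^+ 2)%:C (t%:C * cj z).
  rewrite cmodM tc cmod_cj cmod_real ger0_norm ?(ltW rr)// -/r; apply: le_trans.
  by rewrite lerD2l lerN2 ler_piMr// ltW.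
have b2 : cmod (1 - f (t%:C + z) * cj (f z)) <= 1 - F ^+ 2 + t * cmod q.
  have -> : 1 - f (t%:C + z) * cj (f z) = (1 - F ^+ 2)%:C - t%:C * q * cj (f z).
    by rewrite fq rmorphB /= rmorph1 -mul_cj; ring.
  apply: le_trans (ler_cmodD _ _) _; rewrite cmodN !cmodM tc cmod_cj -/F.
  rewrite cmod_real ger0_norm ?subr_ge0 ?exprn_ile1// lerD2l ler_piMr//.
  by apply: mulr_ge0; [exact: ltW|exact: cmod_ge0].
have -> : f (t%:C + z) - f z = t%:C * q by rewrite fq; ring.
rewrite cmodM tc => SP.
set Q := cmod q in Dq b2 SP *; have Q0 : 0 <= Q by exact: cmod_ge0.
have h1 : Q * (1 - r ^+ 2 - t) <= 1 - F ^+ 2 + t * Q.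
  apply: le_trans (ler_wpM2l Q0 b1) (le_trans _ b2).
  by rewrite -(ler_pM2l t0) mulrA [leRHS]mulrC.
have h2 : (D - d) * (1 - r ^+ 2 - 2 * t) <= 1 - F ^+ 2.
  apply: le_trans (_ : Q * (1 - r ^+ 2 - 2 * t) <= _); last lra.
  by rewrite ler_wpM2r//; lra.
have h3 : t * D <= d * D by rewrite ler_wpM2r// ltW.
have h4 : 0 <= d * t by rewrite mulr_ge0 ?(ltW d0) ?(ltW t0).
have h5 : 0 <= d * r ^+ 2 by rewrite mulr_ge0 ?(ltW d0) ?sqr_ge0.
lra.
Qed.
End Fix.
End Pick.

(** * The area of the image *)

Section Plane.
Variable R : realType.
Local Open Scope ereal_scope.
Local Notation MR := (measurableTypeR R).
Local Notation leb := (@lebesgue_measure R).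
Local Notation leb2 := (leb \x leb).
Implicit Types (f : MR * MR -> \bar R).

Definition affine (s t : R) (x : MR) : MR := (s * x + t)%R.

Lemma measurable_affine s t : measurable_fun setT (affine s t).
Proof. by apply: measurable_funD => //; apply: measurable_funM. Qed.

(** The pushforward of Lebesgue measure under x -> s x + t, scaled by s, has the right value on
    half-open intervals, which characterises Lebesgue measure. *)
Lemma integral_affine (s t : R) (f : MR -> \bar R) : (0 < s)%R ->
  measurable_fun setT f -> (forall x, 0 <= f x) ->
  s%:E * \int[leb]_x f (affine s t x) = \int[leb]_x f x.
Proof.
move=> s0 mf f0.
have ma := measurable_affine s t.
have E := @ge0_integral_pushforward _ _ MR MR R (affine s t) ma leb setT f measurableT mf (fun y _ => f0 y).
rewrite preimage_setT in E; rewrite -[X in _ * X]E.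
have <- := @ge0_integral_mscale _ MR R _ setT measurableT (NngNum (ltW s0)) f mf (fun x _ => f0 x).
apply: eq_measure_integral => A mA _; apply/esym/lebesgue_measure_unique => //.
move=> _ [[a b]] _ <-; rewrite /mscale /=.
rewrite -[X in _ = _ * X]/(leb (affine s t @^-1` `]a, b]%classic)).
have -> : affine s t @^-1` `]a, b]%classic = `]((a - t) / s)%R, ((b - t) / s)%R]%classic.
  by apply/seteqP; split => x /=; rewrite /affine !in_itv /=;
     rewrite ltr_pdivrMr// ler_pdivlMr// ltrBlDr lerBrDr mulrC.
rewrite !lebesgue_measure_itv/= !lte_fin ltr_pM2r ?invr_gt0// ltrD2r.
case: ifP => _; last by rewrite mule0.
by rewrite -!EFinB -EFinM; congr EFin; field; rewrite gt_eqF.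
Qed.

Lemma integral_plane_fibers f : measurable_fun setT f -> (forall p, 0 <= f p) ->
  \int[leb2]_p f p = \int[leb]_y \int[leb]_x f (x, y) /\
  \int[leb2]_p f p = \int[leb]_x \int[leb]_y f (x, y).
Proof.
by move=> mf f0; split; [rewrite fubini_tonelli2|rewrite fubini_tonelli1].
Qed.

Definition shear1 (t : R) (p : MR * MR) : MR * MR := ((p.1 + t * p.2)%R, p.2).
Definition shear2 (t : R) (p : MR * MR) : MR * MR := (p.1, (p.2 + t * p.1)%R).
Definition dilate (s : R) (p : MR * MR) : MR * MR := ((s * p.1)%R, (s * p.2)%R).

Lemma measurable_shear1 t : measurable_fun setT (shear1 t).
Proof.
apply: measurable_fun_pair => //=; apply: measurable_funD => //=.
by apply: measurable_funM => //.
Qed.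

Lemma measurable_shear2 t : measurable_fun setT (shear2 t).
Proof.
apply: measurable_fun_pair => //=; apply: measurable_funD => //=.
by apply: measurable_funM => //.
Qed.

Lemma measurable_dilate s : measurable_fun setT (dilate s).
Proof. by apply: measurable_fun_pair => //=; apply: measurable_funM. Qed.

(** On each horizontal line the shear is a translation. *)
Lemma integral_shear1 t f : measurable_fun setT f -> (forall p, 0 <= f p) ->
  \int[leb2]_p f (shear1 t p) = \int[leb2]_p f p.
Proof.
move=> mf f0.
have mfs : measurable_fun setT (f \o shear1 t) by apply: measurableT_comp => //; exact: measurable_shear1.
have [-> _] := integral_plane_fibers mfs (fun p => f0 _).
have [-> _] := integral_plane_fibers mf f0.
apply: eq_integral => y _.
have := @integral_affine 1 (t * y)%R (fun x => f (x, y)) ltr01 (measurable_fun_pair1 y mf) (fun x => f0 _).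
rewrite mul1e => <-; apply: eq_integral => x _.
by rewrite /affine /shear1 /= mul1r.
Qed.

Lemma integral_shear2 t f : measurable_fun setT f -> (forall p, 0 <= f p) ->
  \int[leb2]_p f (shear2 t p) = \int[leb2]_p f p.
Proof.
move=> mf f0.
have mfs : measurable_fun setT (f \o shear2 t) by apply: measurableT_comp => //; exact: measurable_shear2.
have [_ ->] := integral_plane_fibers mfs (fun p => f0 _).
have [_ ->] := integral_plane_fibers mf f0.
apply: eq_integral => x _.
have := @integral_affine 1 (t * x)%R (fun y => f (x, y)) ltr01 (measurable_fun_pair2 x mf) (fun y => f0 _).
rewrite mul1e => <-; apply: eq_integral => y _.
by rewrite /affine /shear2 /= mul1r.
Qed.

Lemma integral_dilate s f : (0 < s)%R -> measurable_fun setT f -> (forall p, 0 <= f p) ->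
  (s ^+ 2)%:E * \int[leb2]_p f (dilate s p) = \int[leb2]_p f p.
Proof.
move=> s0 mf f0.
have mfs : measurable_fun setT (f \o dilate s) by apply: measurableT_comp => //; exact: measurable_dilate.
have [-> _] := integral_plane_fibers mfs (fun p => f0 _).
have [-> _] := integral_plane_fibers mf f0.
have mG : measurable_fun setT (fun y => \int[leb]_x f (x, y)) by exact: measurable_fun_fubini_tonelli_G.
have G0 y : 0 <= \int[leb]_x f (x, y) by apply: integral_ge0 => x _.
rewrite -(@integral_affine s 0 (fun y => \int[leb]_x f (x, y)) s0 mG G0).
rewrite expr2 EFinM -muleA; congr (_ * _).
rewrite -ge0_integralZl//; last 3 first.
- exact: (@measurable_fun_fubini_tonelli_G _ _ MR MR R leb (f \o dilate s) mfs (fun p => f0 _)).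
- by move=> y _; apply: integral_ge0 => x _; exact: f0.
- by rewrite lee_fin ltW.
apply: eq_integral => y _.
rewrite -(@integral_affine s 0 (fun x => f (x, affine s 0 y)) s0 (measurable_fun_pair1 _ mf) (fun x => f0 _)).
congr (_ * _); apply: eq_integral => x _.
by rewrite /affine /dilate /= !addr0.
Qed.

Definition rotate (c s : R) (p : MR * MR) : MR * MR := ((c * p.1 - s * p.2)%R, (s * p.1 + c * p.2)%R).

Lemma integral_rotate c s f : (c ^+ 2 + s ^+ 2 = 1)%R -> (c != -1)%R ->
  measurable_fun setT f -> (forall p, 0 <= f p) ->
  \int[leb2]_p f (rotate c s p) = \int[leb2]_p f p.
Proof.
move=> cs c1 mf f0.
have c1' : (1 + c != 0)%R by rewrite addrC addr_eq0.
(* A rotation by theta is a product of three shears, with t = - tan (theta / 2). *)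
pose t : R := (- s / (1 + c))%R.
rewrite -(integral_shear1 t mf f0).
have mf1 : measurable_fun setT (f \o shear1 t) by apply: measurableT_comp => //; exact: measurable_shear1.
rewrite -(integral_shear2 s mf1 (fun p => f0 _)).
have mf2 : measurable_fun setT ((f \o shear1 t) \o shear2 s) by apply: measurableT_comp => //; exact: measurable_shear2.
rewrite -(integral_shear1 t mf2 (fun p => f0 _)).
apply: eq_integral => -[x y] _ /=; congr f.
have ts : (t * s = c - 1)%R.
  have -> : (t * s = - s ^+ 2 / (1 + c))%R by rewrite /t; field.
  have -> : (- s ^+ 2 = (c - 1) * (1 + c))%R.
    have -> : (s ^+ 2 = 1 - c ^+ 2)%R by rewrite -cs; ring.
    ring.
  by rewrite mulfK.
have tc : (t * (1 + c) = - s)%R by rewrite /t divfK.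
rewrite /rotate /shear1 /shear2 /=; congr (_, _).
  have -> : (x + t * y + t * (y + s * (x + t * y)) = (1 + t * s) * x + (t * (1 + (1 + t * s))) * y)%R by ring.
  by rewrite ts [(1 + (c - 1))%R]addrC subrK tc mulNr.
have -> : (y + s * (x + t * y) = s * x + (1 + t * s) * y)%R by ring.
by rewrite ts [(1 + _)%R]addrC subrK.
Qed.

Lemma measurable_rotate c s : measurable_fun setT (rotate c s).
Proof.
apply: measurable_fun_pair => /=.
  by apply: measurable_funB; apply: measurable_funM.
by apply: measurable_funD; apply: measurable_funM.
Qed.
End Plane.

(** * Integral of the half-circle function *)

Section DiscArea.
Variable R : realType.
Local Notation MR := (measurableTypeR R).
Local Notation leb := (@lebesgue_measure R).
Local Notation leb2 := (leb \x leb)%E.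

Lemma asinN (x : R) : -1 <= x <= 1 -> asin (- x) = - asin x.
Proof.
move=> xi; have xi' : -1 <= - x <= 1 by lra.
have h1 := asin_lepi2 xi; have h2 := asin_geNpi2 xi.
have h1' := asin_lepi2 xi'; have h2' := asin_geNpi2 xi'.
apply: sin_inj; rewrite ?in_itv /=; [lra|lra|].
by rewrite sinN !asinK ?in_itv.
Qed.

Lemma asin1 : asin (1 : R) = pi / 2.
Proof.
have p0 := pi_gt0 R.
by rewrite -[X in asin X](@sin_pihalf R) sinK// in_itv /= lexx andbT; lra.
Qed.

(** One-sided continuity at an endpoint where asin is not differentiable, from the strict
    monotonicity of sin below pi / 2. *)
Lemma asin_near_1 (e : R) : 0 < e -> exists2 s : R, s < 1 & forall x, s < x < 1 -> `|pi / 2 - asin x| < e.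
Proof.
move=> e0; have p0 := pi_gt0 R.
pose d := Num.min e (pi / 2).
have d0 : 0 < d by rewrite /d lt_min e0 /=; lra.
have d1 : d <= pi / 2 by rewrite /d ge_min lexx orbT.
have de : d <= e by rewrite /d ge_min lexx.
exists (sin (pi / 2 - d)); first by rewrite -[ltRHS](@sin_pihalf R) ltr_sin ?in_itv /=; lra.
move=> x /andP[xs x1].
have xN : -1 <= x by rewrite ltW// (le_lt_trans _ xs)// sin_geN1.
have xi : -1 <= x <= 1 by rewrite xN ltW.
have h1 := asin_lepi2 xi; have h2 := asin_geNpi2 xi.
have h3 : pi / 2 - d < asin x.
  rewrite -ltr_sin ?in_itv /=; [|lra|lra].
  by rewrite asinK// in_itv.
rewrite ger0_norm; lra.
Qed.

Lemma asin_cvg_left_1 : asin x @[x --> (1 : R)^'-] --> asin (1 : R).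
Proof.
rewrite asin1; apply/cvgrPdist_lt => e /asin_near_1[s s1 h].
near=> x; apply: h; apply/andP; split; near: x; [exact: nbhs_left_gt|exact: nbhs_left_lt].
Unshelve. all: by end_near. Qed.

Lemma asin_cvg_right_N1 : asin x @[x --> (-1 : R)^'+] --> asin (-1 : R).
Proof.
rewrite asinN ?asin1; last lra.
apply/cvgrPdist_lt => e /asin_near_1[s s1 h].
have Ns : -1 < - s by lra.
near=> x.
have x1 : -1 < x by near: x; exact: nbhs_right_gt.
have xs : x < - s by near: x; exact: nbhs_right_lt.
have x0 : x < 1 by near: x; apply: nbhs_right_lt; lra.
have := h (- x); rewrite asinN; last lra.
have -> : - (pi / 2) - asin x = - (pi / 2 - - asin x) by ring.
rewrite normrN; apply; lra.
Unshelve. all: by end_near. Qed.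

Definition circ_prim (x : R) : R := x * Num.sqrt (1 - x ^+ 2) + asin x.

Lemma circ_prim_derive (x : R) : -1 < x < 1 -> is_derive x 1 circ_prim (2 * Num.sqrt (1 - x ^+ 2)).
Proof.
move=> xi; have x2 : 0 < 1 - x ^+ 2.
  have -> : 1 - x ^+ 2 = (1 - x) * (1 + x) by ring.
  by apply: mulr_gt0; lra.
have s0 : 0 < Num.sqrt (1 - x ^+ 2) by rewrite sqrtr_gt0.
have dp : is_derive x 1 (fun x : R => 1 - x ^+ 2) (- (2 * x)).
  by apply: is_derive_eq; rewrite /GRing.scale /=; ring.
have ds := @is_derive1_comp R Num.sqrt (fun x : R => 1 - x ^+ 2) x _ _ (is_derive1_sqrt x2) dp.
have da := is_derive1_asin xi.
have -> : circ_prim = (id * (Num.sqrt \o (fun x : R => 1 - x ^+ 2)) + asin)%R by [].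
apply: is_derive_eq; rewrite /GRing.scale /=.
have := sqr_sqrtr (ltW x2); set s := Num.sqrt _ in s0 *; move=> ss.
have sn : s != 0 by rewrite gt_eqF.
have -> : x * ((2 * s)^-1 * - (2 * x)) + s * 1 + s^-1 = (s ^+ 2 + (1 - x ^+ 2)) / s by field.
by rewrite -ss; field.
Qed.

Lemma sqrt_circ_continuous : continuous (fun x : R => Num.sqrt (1 - x ^+ 2)).
Proof.
move=> x; apply: (continuous_comp (f := fun x : R => 1 - x ^+ 2)); last exact: sqrt_continuous.
by apply: cvgB; [exact: cvg_cst|exact: exprn_continuous].
Qed.

(** [circ_prim] is differentiated only inside (-1, 1), so the fundamental theorem needs its
    one-sided limits at both ends. *)
Lemma circ_integral : (\int[leb]_(x in `[(-1)%R, 1%R]) (2 * Num.sqrt (1 - x ^+ 2))%:E = pi%:E)%E.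
Proof.
have n11 : (-1 : R) < 1 by lra.
have p0 := pi_gt0 R.
have aN : asin (-1 : R) = - (pi / 2) by rewrite asinN ?asin1//; lra.
have c2 : continuous (fun x : R => 2 * Num.sqrt (1 - x ^+ 2)).
  by move=> x; apply: cvgM; [exact: cvg_cst|exact: sqrt_circ_continuous].
have cx : continuous (fun x : R => x * Num.sqrt (1 - x ^+ 2)).
  by move=> x; apply: cvgM; [exact: cvg_id|exact: sqrt_circ_continuous].
rewrite (@continuous_FTC2 _ _ circ_prim).
- rewrite /circ_prim sqrrN !expr1n subrr sqrtr0 !mulr0 !add0r asin1 aN.
  by rewrite -EFinB opprK -splitr.
- exact: n11.
- by apply: continuous_subspaceT.
- split.
  + by move=> x; rewrite in_itv /= => xi; have [] := circ_prim_derive xi.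
  + apply: cvgD; first by apply: cvg_at_right_filter; exact: cx.
    exact: asin_cvg_right_N1.
  + apply: cvgD; first by apply: cvg_at_left_filter; exact: cx.
    exact: asin_cvg_left_1.
- move=> x; rewrite in_itv /= => xi; rewrite derive1E.
  by have := circ_prim_derive xi => H; exact: derive_val.
Qed.
End DiscArea.

(** * Moments of the squared modulus over discs *)

Section Moments.
Variable R : realType.
Local Notation MR := (measurableTypeR R).
Local Notation leb := (@lebesgue_measure R).
Local Notation leb2 := (leb \x leb)%E.

Definition nsq (p : MR * MR) : R := p.1 ^+ 2 + p.2 ^+ 2.

Definition disc (r : R) : set (MR * MR) := [set p | nsq p < r ^+ 2].

Lemma nsq_ge0 p : 0 <= nsq p. Proof. by rewrite addr_ge0 ?sqr_ge0. Qed.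

Lemma measurable_nsq : measurable_fun setT nsq.
Proof.
by apply: measurable_funD; apply: measurable_funX.
Qed.

Lemma measurable_disc r : measurable (disc r).
Proof.
have := measurable_nsq measurableT (measurable_itv `]-oo, r ^+ 2[); rewrite setTI.
by rewrite (_ : _ @^-1` _ = disc r)//; apply/seteqP; split => p /=; rewrite in_itv.
Qed.

Lemma patch_disc (f : MR * MR -> \bar R) r : (f \_ (disc r)) = fun p => if nsq p < r ^+ 2 then f p else 0%E.
Proof.
apply/funext => p; rewrite patchE; case: ifPn => [/set_mem|/negP] h.
  by rewrite /disc /= in h; rewrite h.
by case: ifPn => // h'; exfalso; apply: h; rewrite inE.
Qed.

Lemma disc_area : (\int[leb2]_(p in disc 1) 1%:E = pi%:E)%E.
Proof.
have md := measurable_disc 1.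
rewrite integral_mkcond.
have mf : measurable_fun setT ((fun=> 1%:E) \_ (disc 1) : MR * MR -> \bar R).
  by apply/(measurable_restrictT _ md); exact: measurable_cst.
have f0 p : (0 <= ((fun=> 1%:E) \_ (disc 1) : MR * MR -> \bar R) p)%E.
  by rewrite patch_disc; case: ifP.
have [_ ->] := integral_plane_fibers mf f0.
transitivity (\int[leb]_x (2 * Num.sqrt (1 - x ^+ 2))%:E)%E.
  apply: eq_integral => x _; rewrite patch_disc /nsq /= expr1n.
  transitivity (\int[leb]_y (\1_[set y : MR | (x ^+ 2 + y ^+ 2 < 1)%R] y)%:E)%E.
    apply: eq_integral => y _; rewrite indicE; case: ifPn => h.
      by rewrite mem_set.
    by rewrite memNset//; apply/negP.
  (* [Num.sqrt] is 0 on negative numbers, so the interval is empty when |x| >= 1. *)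
  have E : [set y : MR | x ^+ 2 + y ^+ 2 < 1] = `](- Num.sqrt (1 - x ^+ 2)), (Num.sqrt (1 - x ^+ 2))[%classic.
    apply/seteqP; split => y /=; rewrite in_itv /= -ltr_norml -sqrtr_sqr.
      by move=> h; rewrite ltr_sqrt; have := sqr_ge0 y; lra.
    case: (ltP 0 (1 - x ^+ 2)) => h0; first by rewrite ltr_sqrt//; lra.
    by rewrite (ler0_sqrtr h0) ltNge sqrtr_ge0.
  rewrite E integral_indic ?setIT//.
  apply: etrans; first exact: (lebesgue_measure_itv `](- Num.sqrt (1 - x ^+ 2)), (Num.sqrt (1 - x ^+ 2))[).
  rewrite /= lte_fin.
  have s0 := sqrtr_ge0 (1 - x ^+ 2).
  case: ifPn => h; first by rewrite -EFinB; congr EFin; ring.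
  by congr EFin; move: h; rewrite -leNgt; lra.
rewrite -circ_integral [RHS]integral_mkcond; apply: eq_integral => x _.
rewrite patchE; case: ifPn => //; rewrite notin_setE /= in_itv /= => h.
rewrite ler0_sqrtr ?mulr0//.
move/negP: h; rewrite -ler_norml -ltNge => h.
have := ltr_pM (ler01) ler01 h h; rewrite mulr1 -expr2 real_normK ?num_real//; lra.
Qed.

Definition moment (n : nat) (r : R) : \bar R := (\int[leb2]_(p in disc r) (nsq p ^+ n)%:E)%E.

Let mom_fun n r : MR * MR -> \bar R := (fun p => (nsq p ^+ n)%:E) \_ (disc r).

Let mom_fun_meas n r : measurable_fun setT (mom_fun n r).
Proof.
apply/(measurable_restrictT _ (measurable_disc r)); apply: measurable_funTS.
by apply/measurable_EFinP; apply: measurable_funX; exact: measurable_nsq.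
Qed.

Let mom_fun_ge0 n r p : (0 <= mom_fun n r p)%E.
Proof. by rewrite /mom_fun patch_disc; case: ifP => // _; rewrite lee_fin exprn_ge0 ?nsq_ge0. Qed.

Lemma moment_scale n r : 0 < r -> moment n r = ((r ^+ (2 * n).+2)%:E * moment n 1)%E.
Proof.
move=> r0; rewrite /moment [LHS]integral_mkcond [X in (_ * X)%E]integral_mkcond -/(mom_fun n r) -/(mom_fun n 1).
rewrite -(integral_dilate r0 (mom_fun_meas n r) (mom_fun_ge0 n r)).
have -> : (\int[leb2]_p mom_fun n r (dilate r p) = (r ^+ (2 * n))%:E * \int[leb2]_p mom_fun n 1 p)%E.
  rewrite -ge0_integralZl//; last by rewrite lee_fin exprn_ge0// ltW.
  apply: eq_integral => p _; rewrite /mom_fun !patch_disc.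
  have -> : nsq (dilate r p) = r ^+ 2 * nsq p by rewrite /nsq /=; ring.
  rewrite expr1n -[X in _ < X]mulr1 ltr_pM2l ?exprn_gt0//; case: ifP => _; last by rewrite mule0.
  by rewrite -EFinM; congr EFin; rewrite exprMn exprM.
by rewrite muleA -EFinM; congr (_%:E * _)%E; rewrite -exprD.
Qed.

Lemma moment0 : moment 0 1 = pi%:E.
Proof. by rewrite -disc_area; apply: eq_integral => p _; rewrite expr0. Qed.

(* Polar coordinates are avoided: [moment_scale] gives the integral over the
   annulus q <= |p| < 1 in terms of [moment n 1], and on this annulus nsq ^ n lies
   between q^(2n) and 1; let q tend to 1. *)
Lemma moment_disc n r : 0 < r -> moment n r = (pi * r ^+ (2 * n).+2 / n.+1%:R)%:E.
Proof.
have p0 := pi_gt0 R.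
move=> r0; rewrite moment_scale//.
suff -> : moment n 1 = (pi / n.+1%:R)%:E by rewrite -EFinM; congr EFin; ring.
have fin : exists2 c : R, 0 <= c & moment n 1 = c%:E.
  have h0 : (0 <= moment n 1)%E by rewrite /moment integral_mkcond; apply: integral_ge0 => p _; exact: mom_fun_ge0.
  have h1 : (moment n 1 <= pi%:E)%E.
    rewrite -moment0; apply: ge0_le_integral; first exact: measurable_disc.
    - by move=> p _; rewrite lee_fin exprn_ge0 ?nsq_ge0.
    - by apply: measurable_funTS; apply/measurable_EFinP; apply: measurable_funX; exact: measurable_nsq.
    - by apply: measurable_funTS; apply/measurable_EFinP; apply: measurable_funX; exact: measurable_nsq.
    - move=> p; rewrite /disc /= expr1n => hp; rewrite lee_fin expr0.
      by rewrite exprn_ile1 ?nsq_ge0// ltW.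
  exists (fine (moment n 1)); first exact: fine_ge0.
  by rewrite fineK// fin_numElt (lt_le_trans _ h0) ?ltNye//= (le_lt_trans h1)// ltry.
have [c c0 E] := fin; rewrite E; congr EFin.
have key q : 0 < q < 1 -> q ^+ (2 * n) * (pi - pi * q ^+ 2) <= c - c * q ^+ (2 * n).+2 <= pi - pi * q ^+ 2.
  move=> /andP[q0 q1].
  have q2 : q ^+ 2 <= 1 by rewrite exprn_ile1 ?ltW.
  have A : forall m, (moment m 1 = moment m q + \int[leb2]_(p in disc 1 `\` disc q) (nsq p ^+ m)%:E)%E.
    move=> m; rewrite /moment -ge0_integral_setU.
    - by congr (integral _ _ _); rewrite setDUK// => p; rewrite /disc /= expr1n => h; exact: lt_le_trans h q2.
    - exact: measurable_disc.
    - by apply: measurableD; exact: measurable_disc.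
    - by apply: measurable_funTS; apply/measurable_EFinP; apply: measurable_funX; exact: measurable_nsq.
    - by move=> p _; rewrite lee_fin exprn_ge0 ?nsq_ge0.
    - by rewrite disj_set2E setDIK.
  have mA : measurable (disc 1 `\` disc q) by apply: measurableD; exact: measurable_disc.
  have mm m : measurable_fun (disc 1 `\` disc q) (fun p => (nsq p ^+ m)%:E).
    by apply: measurable_funTS; apply/measurable_EFinP; apply: measurable_funX; exact: measurable_nsq.
  have A0 := A 0; have An := A n.
  rewrite moment0 moment_scale// moment0 muln0 in A0.
  rewrite E moment_scale// E in An.
  set J0 := integral _ _ _ in A0; set Jn := integral _ _ _ in An.
  have L : ((q ^+ (2 * n))%:E * J0 <= Jn)%E.
    rewrite /J0 -ge0_integralZl//; last by rewrite lee_fin exprn_ge0// ltW.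
    apply: ge0_le_integral => //.
    - by move=> p _; rewrite -EFinM lee_fin mulr_ge0 ?exprn_ge0 ?nsq_ge0// ltW.
    - by apply: measurable_funeM.
    move=> p [_ /negP]; rewrite /disc /= -leNgt => h; rewrite -EFinM lee_fin expr0 mulr1 exprM.
    by rewrite lerXn2r ?nnegrE ?nsq_ge0 ?exprn_ge0// ltW.
  have U : (Jn <= J0)%E.
    apply: ge0_le_integral => //.
    - by move=> p _; rewrite lee_fin exprn_ge0 ?nsq_ge0.
    move=> p [h _]; rewrite /disc /= expr1n in h; rewrite lee_fin expr0.
    by rewrite exprn_ile1 ?nsq_ge0// ltW.
  have EJ0 : J0 = (pi - pi * q ^+ 2)%:E.
    rewrite -EFinM in A0; rewrite EFinB A0 [(q ^+ 2 * pi)%R]mulrC [(_ + J0)%E]addeC addeK//.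
  have EJn : Jn = (c - c * q ^+ (2 * n).+2)%:E.
    rewrite -EFinM in An; rewrite EFinB An [(_ * c)%R]mulrC [(_ + Jn)%E]addeC addeK//.
  by move: L U; rewrite EJ0 EJn -EFinM !lee_fin => -> ->.
have bern q : 0 < q < 1 -> q ^+ (2 * n) * pi <= c * n.+1%:R /\ c * (n.+1%:R * q ^+ (2 * n)) <= pi.
  move=> qq; have /andP[k1 k2] := key q qq; have /andP[q0 q1] := qq.
  have u1 : 0 < 1 - q ^+ 2 by rewrite subr_gt0 expr_lt1// ltW.
  have u1' : q ^+ 2 != 1 by rewrite lt_eqF// -subr_gt0.
  (* Both bounds of [key] are multiples of 1 - q^2; after division the factor S tends to n + 1 as q
     tends to 1. *)
  pose S := \sum_(0 <= k < n.+1) (q ^+ 2) ^+ k.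
  have SE : 1 - q ^+ (2 * n).+2 = (1 - q ^+ 2) * S.
    rewrite /S geom_sum// mulrC divfK ?gt_eqF//; congr (1 - _).
    by rewrite -exprM mulnS.
  have S1 : S <= n.+1%:R.
    rewrite /S; apply: (@le_trans _ _ (\sum_(0 <= k < n.+1) 1)); last by rewrite sumr_const_nat subn0.
    by apply: ler_sum => k _; rewrite !exprn_ile1 ?exprn_ge0 ?ltW ?exprn_ilt1 // ltW.
  have S2 : n.+1%:R * q ^+ (2 * n) <= S.
    rewrite /S; apply: (@le_trans _ _ (\sum_(0 <= k < n.+1) q ^+ (2 * n))).
      by rewrite sumr_const_nat subn0 mulr_natl.
    apply: ler_sum_nat => k /andP[_ kn]; rewrite -exprM ler_wiXn2l ?ltW//.
    by rewrite leq_mul2l /= -ltnS.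
  have e1 : c - c * q ^+ (2 * n).+2 = (1 - q ^+ 2) * (c * S) by rewrite -[X in X - _](mulr1 c) -mulrBr SE; ring.
  have e2 : pi - pi * q ^+ 2 = (1 - q ^+ 2) * pi by ring.
  rewrite e1 e2 in k1 k2.
  rewrite mulrCA ler_pM2l// in k1; rewrite ler_pM2l// in k2; split.
    by apply: le_trans k1 _; rewrite ler_wpM2l.
  by apply: le_trans k2; rewrite ler_wpM2l.
have lim (x y : R) : 0 <= x -> (forall q, 0 < q < 1 -> q ^+ (2 * n) * x <= y) -> x <= y.
  move=> x0 h; apply/ler_addgt0Pr => e e0.
  pose D := x * (2 * n)%:R + 1.
  have D1 : 1 <= D by rewrite /D lerDr mulr_ge0.
  pose d := Num.min (1 / 2) (e / D).
  have d0 : 0 < d by rewrite /d lt_min !divr_gt0//; lra.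
  have d1 : d <= 1 / 2 by rewrite /d ge_min lexx.
  have de : d * D <= e by rewrite -ler_pdivlMr; [rewrite /d ge_min lexx orbT|lra].
  have := h (1 - d); have -> : 0 < 1 - d < 1 by lra.
  move=> /(_ isT); have := @bernoulli_ineq _ d (2 * n); have -> : 0 <= d <= 1 by lra.
  move=> /(_ isT) /(ler_wpM2r x0); rewrite /D in de; lra.
have n1 : 0 < n.+1%:R :> R by rewrite ltr0n.
apply/eqP; rewrite eq_le; apply/andP; split.
  rewrite ler_pdivlMr//; apply: lim; first by rewrite mulr_ge0.
  by move=> q /bern[_]; rewrite mulrA mulrC.
rewrite ler_pdivrMr//; apply: lim; first exact: ltW.
by move=> q /bern[].
Qed.

End Moments.

(** * Area integrals of power series *)

Section Area.
Variable R : realType.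
Local Notation C := (cplx R).
Local Notation MR := (measurableTypeR R).
Local Notation leb := (@lebesgue_measure R).
Local Notation leb2 := (leb \x leb)%E.

Definition toC (p : MR * MR) : C := p.1 +i* p.2.

Lemma cmod_toC p : cmod (toC p) ^+ 2 = nsq p.
Proof. by rewrite cmod_sqr. Qed.

Lemma disc_cmod r p : 0 < r -> disc r p <-> cmod (toC p) < r.
Proof.
move=> r0; rewrite /disc /= -cmod_toC ltr_pXn2r ?nnegrE ?cmod_ge0 ?ltW//.
Qed.

Definition cmeasurable (u : MR * MR -> C) :=
  measurable_fun setT (fun p => complex.Re (u p) : R) /\ measurable_fun setT (fun p => complex.Im (u p) : R).

Lemma cmeasurable_cst c : cmeasurable (fun=> c).
Proof. by split; exact: measurable_cst. Qed.

Lemma cmeasurable_toC : cmeasurable toC.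
Proof. by split; [exact: measurable_fst|exact: measurable_snd]. Qed.

Lemma cmeasurableD u v : cmeasurable u -> cmeasurable v -> cmeasurable (fun p => u p + v p).
Proof.
move=> [u1 u2] [v1 v2]; split.
  rewrite (_ : (fun p => _) = fun p => complex.Re (u p) + complex.Re (v p)); first exact: measurable_funD.
  by apply/funext => p; case: (u p) (v p) => [? ?] [? ?].
rewrite (_ : (fun p => _) = fun p => complex.Im (u p) + complex.Im (v p)); first exact: measurable_funD.
by apply/funext => p; case: (u p) (v p) => [? ?] [? ?].
Qed.

Lemma cmeasurableM u v : cmeasurable u -> cmeasurable v -> cmeasurable (fun p => u p * v p).
Proof.
move=> [u1 u2] [v1 v2]; split.
  rewrite (_ : (fun p => _) = fun p => complex.Re (u p) * complex.Re (v p) - complex.Im (u p) * complex.Im (v p)).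
    by apply: measurable_funB; apply: measurable_funM.
  by apply/funext => p; case: (u p) (v p) => [? ?] [? ?].
rewrite (_ : (fun p => _) = fun p => complex.Re (u p) * complex.Im (v p) + complex.Im (u p) * complex.Re (v p)).
  by apply: measurable_funD; apply: measurable_funM.
by apply/funext => p; case: (u p) (v p) => [? ?] [? ?].
Qed.

Lemma cmeasurable_poly (c : nat -> C) n : cmeasurable (fun p => \sum_(0 <= k < n) c k * toC p ^+ k).
Proof.
elim: n => [|n IH].
  by under eq_fun do rewrite big_nil; exact: cmeasurable_cst.
under eq_fun do rewrite big_nat_recr//=.
apply: cmeasurableD => //; apply: cmeasurableM; first exact: cmeasurable_cst.
elim: n {IH} => [|n IH]; first by under eq_fun do rewrite expr0; exact: cmeasurable_cst.
by under eq_fun do rewrite exprS; apply: cmeasurableM => //; exact: cmeasurable_toC.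
Qed.

Lemma cmeasurable_cmod_sqr u : cmeasurable u -> measurable_fun setT (fun p => cmod (u p) ^+ 2).
Proof.
move=> [u1 u2]; under eq_fun do rewrite cmod_sqr.
by apply: measurable_funD; apply: measurable_funX.
Qed.

Section Fix.
Variables (c : nat -> C) (r : R).
Hypotheses (r0 : 0 < r) (pc : pconv c r).

(** Extended by 0 outside the disc, so that rotations of the whole plane apply. *)
Let P (w : C) : \bar R := if cmod w < r then (cmod (ps c w) ^+ 2)%:E else 0%E.

Let P_ge0 w : (0 <= P w)%E.
Proof. by rewrite /P; case: ifP => // _; rewrite lee_fin sqr_ge0. Qed.

Let patchP (g : C -> R) : (fun p => (g (toC p))%:E) \_ (disc r) =
  fun p => if cmod (toC p) < r then (g (toC p))%:E else 0%E.
Proof.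
apply/funext => p; rewrite patch_disc -cmod_toC.
by rewrite ltr_pXn2r ?nnegrE ?cmod_ge0// ltW.
Qed.

Let measurable_P : measurable_fun setT (P \o toC).
Proof.
have -> : P \o toC = (fun p => (cmod (ps c (toC p)) ^+ 2)%:E) \_ (disc r).
  by rewrite (patchP (fun w => cmod (ps c w) ^+ 2)).
apply/(measurable_restrictT _ (measurable_disc r)).
apply/measurable_EFinP.
apply: (measurable_realfun.measurable_fun_cvg (h := fun n p => cmod (\sum_(0 <= k < n) c k * toC p ^+ k) ^+ 2)).
  by move=> n; apply: measurable_funTS; apply: cmeasurable_cmod_sqr; exact: cmeasurable_poly.
move=> p /(disc_cmod _ r0)/ltW pr.
have H := cvg_cmod (ps_cvg pc pr).
by rewrite expr2; apply: (cvgn_ext (cvgnM H H)) => n; rewrite expr2.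
Qed.

Let rotate_toC (zeta : C) p : toC (rotate (complex.Re zeta) (complex.Im zeta) p) = zeta * toC p.
Proof. by case: zeta => x y; rewrite /toC /rotate /=; congr (_ +i* _); rewrite addrC. Qed.

Let Pz (zeta : C) i : MR * MR -> \bar R := fun p => P (zeta ^+ i * toC p).

(** The rotation by zeta is iterated instead of rotating once by zeta^i, which may be -1, the case
    excluded from [integral_rotate]. *)
Let integral_P_rotate (zeta : C) i : cmod zeta = 1 -> complex.Re zeta != -1 ->
  measurable_fun setT (Pz zeta i) /\
  (\int[leb2]_p Pz zeta i p = \int[leb2]_p P (toC p))%E.
Proof.
move=> z1 zN; have zs : complex.Re zeta ^+ 2 + complex.Im zeta ^+ 2 = 1 by rewrite -cmod_sqr z1 expr1n.
elim: i => [|i [mi IH]].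
  have -> : Pz zeta 0 = P \o toC by apply/funext => p; rewrite /Pz expr0 mul1r.
  by split => //; exact: measurable_P.
have -> : Pz zeta i.+1 = Pz zeta i \o rotate (complex.Re zeta) (complex.Im zeta).
  by apply/funext => p /=; rewrite /Pz rotate_toC exprSr mulrA.
split; first by apply: measurableT_comp; [exact: mi|exact: measurable_rotate].
apply: etrans IH; exact: (integral_rotate zs zN mi (fun p => P_ge0 _)).
Qed.

(* By rotation invariance |ps c|^2 may be averaged over the M-th roots of unity,
   and the average of its M-th partial sum is given by discrete Parseval. *)
Lemma area_ps : exists2 A : R,
  (\int[leb2]_(p in disc r) (cmod (ps c (toC p)) ^+ 2)%:E = A%:E)%E &
  \sum_(0 <= k < n) cmod (c k) ^+ 2 * (pi * r ^+ (2 * k).+2 / k.+1%:R) @[n --> \oo] --> A.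
Proof.
have [B HB] := pc.
have [t [t_lim t0 ht]] := ps_uniform (ltW r0) pc.
have B0 : 0 <= B by apply: le_trans (HB 0%N); rewrite big_nil.
pose I := (\int[leb2]_p P (toC p))%E.
have IE : (\int[leb2]_(p in disc r) (cmod (ps c (toC p)) ^+ 2)%:E = I)%E.
  by rewrite integral_mkcond (patchP (fun w => cmod (ps c w) ^+ 2)).
pose H n := \sum_(0 <= k < n) cmod (c k) ^+ 2 * (pi * r ^+ (2 * k).+2 / k.+1%:R).
pose h n (p : MR * MR) := \sum_(0 <= k < n) cmod (c k) ^+ 2 * nsq p ^+ k.
have h0 n p : 0 <= h n p.
  by apply: sumr_ge0 => k _; rewrite mulr_ge0 ?sqr_ge0 ?exprn_ge0 ?nsq_ge0.
have mh n : measurable_fun setT (h n).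
  rewrite /h; elim: n => [|n IH]; first by under eq_fun do rewrite big_nil; exact: measurable_cst.
  under eq_fun do rewrite big_nat_recr//=.
  apply: measurable_funD => //; apply: measurable_funM => //.
  by apply: measurable_funX; exact: measurable_nsq.
have hint n : (\int[leb2]_(p in disc r) (h n p)%:E = (H n)%:E)%E.
  rewrite /h /H; under eq_integral do rewrite -sumEFin.
  rewrite ge0_integral_sum; first last.
  - by move=> k p _; rewrite lee_fin mulr_ge0 ?sqr_ge0 ?exprn_ge0 ?nsq_ge0.
  - move=> k; apply: measurable_funTS; apply/measurable_EFinP; apply: measurable_funM => //.
    by apply: measurable_funX; exact: measurable_nsq.
  - exact: measurable_disc.
  rewrite -sumEFin; apply: eq_bigr => k _.
  under eq_integral do rewrite EFinM.
  rewrite ge0_integralZl.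
  - by rewrite -/(moment k r) moment_disc// -EFinM.
  - exact: measurable_disc.
  - by apply: measurable_funTS; apply/measurable_EFinP; apply: measurable_funX; exact: measurable_nsq.
  - by move=> p _; rewrite lee_fin exprn_ge0 ?nsq_ge0.
  - by rewrite lee_fin sqr_ge0.
(* Error in squared modulus: [ps c] and its partial sums are at most B in modulus and differ by at
   most [t n]. *)
pose e n := 2 * B * t n.
have e0 n : 0 <= e n by rewrite /e !mulr_ge0.
pose A0 := pi * r ^+ 2.
have A00 : 0 <= A0 by rewrite /A0 mulr_ge0 ?sqr_ge0 ?pi_ge0.
have diskA x : 0 <= x -> (\int[leb2]_(p in disc r) x%:E = (x * A0)%:E)%E.
  move=> x0; under eq_integral do rewrite -[x%:E]mule1.
  rewrite ge0_integralZl//; last exact: measurable_disc.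
  have -> : (\int[leb2]_(p in disc r) 1 = moment 0 r)%E by apply: eq_integral => p _; rewrite expr0.
  by rewrite moment_disc// muln0 divr1 -EFinM.
have key M : (2 < M)%N -> (I <= (H M + e M * A0)%:E)%E /\ ((H M)%:E <= I + (e M * A0)%:E)%E.
  move=> M2; have M0 : (0 < M)%N by apply: leq_trans M2.
  have [zeta pz] := prim_root_exists R M0.
  have z1 := prim_root_cmod pz.
  (* M > 2 excludes the half-turn, to which [integral_rotate] does not apply. *)
  have zN : complex.Re zeta != -1.
    apply/eqP => zRe; have h1 := cmod_sqr zeta; rewrite z1 zRe sqrrN !expr1n in h1.
    have zI : complex.Im zeta = 0 by apply/eqP; rewrite -sqrf_eq0; apply/eqP; lra.
        have zz : zeta = -1 by rewrite [zeta](_ : _ = complex.Re zeta +i* complex.Im zeta); [rewrite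
        zRe zI; apply/eqP; rewrite eq_complex /= oppr0 !eqxx|case: (zeta)].
    have := prim_order_dvd pz 2; rewrite zz sqrrN expr1n eqxx => /(dvdn_leq (isT : 0 < 2)%N).
    by rewrite leqNgt M2.
  have MR0 : 0 < M%:R :> R by rewrite ltr0n.
  pose g i p := cmod (ps c (zeta ^+ i * toC p)) ^+ 2.
  have cz i p : cmod (zeta ^+ i * toC p) = cmod (toC p) by rewrite cmodM cmodX z1 expr1n mul1r.
  have gP i : (fun p => (g i p)%:E) \_ (disc r) = Pz zeta i.
    have := patchP (fun w => cmod (ps c (zeta ^+ i * w)) ^+ 2); rewrite /g => ->.
    by apply/funext => p; rewrite /Pz /P cz.
  have mg i : measurable_fun (disc r) (fun p => (g i p)%:E).
    apply/(measurable_restrictT _ (measurable_disc r)); rewrite gP.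
    by have [] := integral_P_rotate i z1 zN.
  have gI : (\int[leb2]_(p in disc r) (\sum_(0 <= i < M) g i p)%:E = M%:R%:E * I)%E.
    under eq_integral do rewrite -sumEFin.
    rewrite ge0_integral_sum//; [|exact: measurable_disc|by move=> k p _; rewrite lee_fin sqr_ge0].
    rewrite (eq_bigr (fun=> I)); first by rewrite sumr_const_nat subn0 mule_natl.
    by move=> i _; rewrite integral_mkcond gP; have [] := integral_P_rotate i z1 zN.
  have mgs : measurable_fun (disc r) (fun p => (\sum_(0 <= i < M) g i p)%:E).
    under eq_fun do rewrite -sumEFin.
    by apply: emeasurable_sum => i; exact: mg.
    have cmp p : disc r p -> \sum_(0 <= i < M) g i p <= M%:R * (h M p + e M) /\ M%:R * h M p <=
      \sum_(0 <= i < M) g i p + M%:R * e M.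
    move=> /(disc_cmod _ r0) /ltW pr.
    have dp := discrete_parseval c (toC p) pz.
    have hE : M%:R * h M p = M%:R * \sum_(0 <= k < M) cmod (c k) ^+ 2 * cmod (toC p) ^+ (2 * k).
      by congr (_ * _); apply: eq_bigr => k _; rewrite exprM cmod_toC.
    have per i : cmod (\sum_(0 <= k < M) c k * (zeta ^+ i * toC p) ^+ k) ^+ 2 <= g i p + e M /\
       g i p <= cmod (\sum_(0 <= k < M) c k * (zeta ^+ i * toC p) ^+ k) ^+ 2 + e M.
      rewrite /g; set w := zeta ^+ i * toC p; set y := \sum_(_ <= _ < _) _.
      have wr : cmod w <= r by rewrite cz.
      have tn m n : \sum_(m <= k < n) cmod (c k * w ^+ k) <= B.
        apply: le_trans (HB n); case: (leqP m n) => mn; last first.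
          by rewrite big_geq ?(ltnW mn)//; apply: sumr_ge0 => k _; rewrite mulr_ge0 ?cmod_ge0 ?exprn_ge0 ?(ltW r0).
        rewrite [leRHS](sum_nat_split _ mn); apply: ler_wpDl.
          by apply: sumr_ge0 => k _; rewrite mulr_ge0 ?cmod_ge0 ?exprn_ge0 ?(ltW r0).
        apply: ler_sum => k _; rewrite cmodM cmodX ler_wpM2l ?cmod_ge0//.
        by rewrite lerXn2r ?nnegrE ?cmod_ge0 ?(ltW r0).
      have yB : cmod y <= B by apply: le_trans (ler_cmod_sum _ _ _) (tn _ _).
      have xB : cmod (ps c w) <= B.
        by have := series_tail_le (ps_cvg pc wr) (fun m => tn 0%N m); rewrite big_nil subr0.
      have h1 := ht w wr M; rewrite -/y in h1.
      have h2 := ler_cmodB (ps c w) y; have h3 := ler_cmodB y (ps c w); rewrite cmodBC in h3.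
      have tM := t0 M; rewrite /e.
      move: (cmod_ge0 y) (cmod_ge0 (ps c w)) => y0 x0; nra.
    rewrite mulrDr hE -dp.
    have -> : M%:R * e M = \sum_(0 <= i < M) e M by rewrite sumr_const_nat subn0 mulr_natl.
    by rewrite -!big_split /=; split; apply: ler_sum => i _; have [] := per i.
  have mhx x : measurable_fun (disc r) (fun p => (M%:R * h M p + x)%:E).
    apply: measurable_funTS; apply/measurable_EFinP; apply: measurable_funD => //.
    by apply: measurable_funM.
  have hx x : 0 <= x -> (\int[leb2]_(p in disc r) (M%:R * h M p + x)%:E = (M%:R * H M + x * A0)%:E)%E.
    move=> x0; under eq_integral do rewrite EFinD.
    rewrite ge0_integralD.
    - rewrite diskA//; under eq_integral do rewrite EFinM.
      rewrite ge0_integralZl//.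
      + by rewrite hint -EFinM -EFinD.
      + exact: measurable_disc.
      + by apply: measurable_funTS; apply/measurable_EFinP.
      + by move=> p _; rewrite lee_fin.
    - exact: measurable_disc.
    - by move=> p _; rewrite lee_fin mulr_ge0.
    - by apply: measurable_funTS; apply/measurable_EFinP; apply: measurable_funM.
    - by move=> p _; rewrite lee_fin.
    - exact: measurable_cst.
  have gs0 p : 0 <= \sum_(0 <= i < M) g i p by apply: sumr_ge0 => i _; exact: sqr_ge0.
  have MF : (M%:R%:E : \bar R) \is a fin_num by [].
  have MP : (0 < M%:R%:E :> \bar R)%E by rewrite lte_fin.
  split.
    rewrite -(lee_pmul2l MF MP) -gI -EFinM.
    have -> : M%:R * (H M + e M * A0) = M%:R * H M + (M%:R * e M) * A0 by ring.
    rewrite -hx; last by rewrite mulr_ge0.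
    apply: ge0_le_integral; first exact: measurable_disc.
    - by move=> p _; rewrite lee_fin.
    - exact: mgs.
    - exact: mhx.
    - by move=> p /cmp[+ _]; rewrite lee_fin mulrDr.
  rewrite -(lee_pmul2l MF MP) muleDr//; last by rewrite fin_num_adde_defl.
  rewrite -gI -!EFinM.
  have -> : M%:R * (e M * A0) = (M%:R * e M) * A0 by ring.
  rewrite -diskA; last by rewrite mulr_ge0.
  rewrite -ge0_integralD; first last.
  - exact: measurable_cst.
  - by move=> p _; rewrite lee_fin mulr_ge0.
  - exact: mgs.
  - by move=> p _; rewrite lee_fin.
  - exact: measurable_disc.
  have := hx 0 (lexx _); rewrite mul0r addr0 => <-.
  apply: ge0_le_integral; first exact: measurable_disc.
  - by move=> p _; rewrite lee_fin addr0 mulr_ge0.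
  - exact: mhx.
  - by apply: emeasurable_funD => //; exact: measurable_cst.
  - by move=> p /cmp[_ +]; rewrite addr0 -EFinD lee_fin.
have I0 : (0 <= I)%E by apply: integral_ge0 => p _; exact: P_ge0.
have [k1 _] := key 3 isT.
have If : I \is a fin_num by rewrite fin_numElt (lt_le_trans _ I0) ?ltNy0//= (le_lt_trans k1)// ltry.
exists (fine I); first by rewrite IE fineK.
rewrite -/H; apply/cvgrPdist_lt => d d0.
have eA : e n * A0 @[n --> \oo] --> (0 : R).
  have := cvgnM (cvgnZ (2 * B) t_lim) (@cvg_cst _ A0 nat \oo _); rewrite mulr0 mul0r.
  by apply.
move/cvgrPdist_lt: eA => /(_ d d0)[N _ hN]; exists (maxn N 3) => // M /=.
rewrite geq_max => /andP[NM M3]; have [] := key M M3.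
rewrite -{1 2}(fineK If) -EFinD !lee_fin => h1 h2.
have := hN M NM; rewrite /= sub0r normrN => /(le_lt_trans (ler_norm _)) h3.
by rewrite ltr_norml; apply/andP; split; lra.
Qed.
End Fix.
End Area.

Section ImageArea.
Variable R : realType.
Local Notation C := (cplx R).
Local Notation MR := (measurableTypeR R).
Local Notation leb := (@lebesgue_measure R).
Local Notation leb2 := (leb \x leb)%E.

(** [area_ps] for f', with coefficients (k + 1) a_(k+1): the square of k + 1 meets the 1 / (k + 1)
    of the moment. The radius 0 is treated apart, as [area_ps] assumes r > 0. *)
Lemma image_area_rep (f : C -> C) (a : nat -> C) (r : R) : rep f a 0 1 -> 0 <= r < 1 ->
  exists2 A : R, image_area f r = A%:E &
    pi * \sum_(1 <= k < n.+1) k%:R * cmod (a k) ^+ 2 * r ^+ (2 * k) @[n --> \oo] --> A.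
Proof.
move=> fa /andP[r0 r1]; move: r0; rewrite le_eqVlt => /predU1P[<-|r0].
  exists 0.
    rewrite /image_area (_ : [set p | _] = set0) ?integral_set0//.
    by apply/seteqP; split => // p /=; rewrite ltNge cmod_ge0.
  have E n : pi * \sum_(1 <= k < n.+1) k%:R * cmod (a k) ^+ 2 * (0 : R) ^+ (2 * k) = 0.
    rewrite big_nat_cond big1 ?mulr0// => k; rewrite andbT => /andP[k0 _].
    by rewrite expr0n muln_eq0 /= eqn0Ngt k0 /= mulr0.
  by apply: (cvgn_ext (@cvg_cst _ (0 : R) _ _ _)) => n; exact: E.
pose c n := n.+1%:R * a n.+1.
have fc := rep_derive fa.
have pc : pconv c r by apply: (rep_pconv fc); rewrite (ltW r0).
have [A AE Acvg] := area_ps r0 pc.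
exists A.
  rewrite -AE /image_area.
  rewrite (_ : [set p | _] = disc r); last first.
    by apply/seteqP; split => p /=; rewrite /disc /= -cmod_toC ltr_pXn2r// ?nnegrE ?cmod_ge0 ?(ltW r0).
  apply: eq_integral => p /set_mem /(disc_cmod _ r0) pr.
  have := rep_ps fc (z := toC p); rewrite subr0 => -> //.
  exact: lt_trans pr r1.
apply: (cvgn_ext Acvg) => n.
rewrite big_add1 /= big_distrr /=; apply: eq_bigr => k _.
rewrite /c cmodM cmod_nat exprMn mulnS; field.
by rewrite ?natr1 ?nat1r pnatr_eq0.
Qed.

Lemma nneseries_cvg (u : nat -> R) m (s : R) : (forall k, 0 <= u k) ->
  \sum_(m <= k < n) u k @[n --> \oo] --> s -> (\sum_(m <= k <oo) (u k)%:E = s%:E)%E.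
Proof.
move=> u0 us; apply/cvg_lim => //.
under eq_fun do rewrite sumEFin.
apply: cvg_EFin; first exact: nearW.
exact: us.
Qed.

Lemma nonneg_sum_cvg (u : nat -> R) m (B : R) : (forall k, 0 <= u k) ->
  (forall n, \sum_(m <= k < n) u k <= B) -> exists s : R, \sum_(m <= k < n) u k @[n --> \oo] --> s.
Proof.
move=> u0 uB; exists (limn (fun n => \sum_(m <= k < n) u k)).
apply: nondecreasing_is_cvgn.
  apply/nondecreasing_seqP => n; case: (leqP m n) => mn; first by rewrite big_nat_recr//= lerDl.
  by rewrite !big_geq// ltnW.
by exists B => _ [n _ <-]; exact: uB.
Qed.

(** S_r / pi for the Blaschke factor with a^2 = x; see [blaschke_area]. *)
Definition bohr_area_bound (x r : R) := (1 - x) ^+ 2 * r ^+ 2 / (1 - x * r ^+ 2) ^+ 2.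

(** Denominator minus numerator is a difference of squares: (1 - x r^2)^2 - (1 - x)^2 r^2 = (1 -
    r^2)(1 - x^2 r^2). *)
Lemma bohr_area_bound_lt1 (x r : R) : 0 <= x <= 1 -> 0 <= r < 1 ->
  0 <= bohr_area_bound x r < 1 /\
  bohr_area_bound x r / (1 - bohr_area_bound x r) =
    (1 - x) ^+ 2 * r ^+ 2 / ((1 - r ^+ 2) * (1 - x ^+ 2 * r ^+ 2)).
Proof.
move=> /andP[x0 x1] /andP[r0 r1].
have xr : 0 <= x * r by rewrite mulr_ge0.
have xr1 : x * r < 1 by apply: le_lt_trans r1; rewrite ler_piMl.
have r2 : r ^+ 2 < 1 by rewrite expr_lt1.
have xr2 : x * r ^+ 2 < 1 by apply: le_lt_trans r2; rewrite ler_piMl ?sqr_ge0.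
have d1 : 0 < 1 - x * r ^+ 2 by lra.
have e1 : 1 - x * r ^+ 2 - (1 - x) * r = (1 - r) * (1 + x * r) by ring.
have e2 : 1 - x * r ^+ 2 + (1 - x) * r = (1 + r) * (1 - x * r) by ring.
have p1 : 0 < (1 - r) * (1 + x * r) by apply: mulr_gt0; lra.
have p2 : 0 < (1 + r) * (1 - x * r) by apply: mulr_gt0; lra.
have e3 : (1 - x * r ^+ 2) ^+ 2 - (1 - x) ^+ 2 * r ^+ 2 = (1 - r) * (1 + x * r) * ((1 + r) * (1 - x * r)).
  by rewrite -e1 -e2; ring.
have p3 : 0 < (1 - x * r ^+ 2) ^+ 2 - (1 - x) ^+ 2 * r ^+ 2 by rewrite e3 mulr_gt0.
split.
  rewrite /bohr_area_bound; apply/andP; split.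
    by rewrite mulr_ge0 ?invr_ge0 ?sqr_ge0// mulr_ge0 ?sqr_ge0.
  by rewrite ltr_pdivrMr ?exprn_gt0// mul1r -subr_gt0.
have e4 : (1 - r ^+ 2) * (1 - x ^+ 2 * r ^+ 2) = (1 - x * r ^+ 2) ^+ 2 - (1 - x) ^+ 2 * r ^+ 2 by rewrite e3; ring.
have E : 1 - bohr_area_bound x r = ((1 - x * r ^+ 2) ^+ 2 - (1 - x) ^+ 2 * r ^+ 2) / (1 - x * r ^+ 2) ^+ 2.
  by rewrite /bohr_area_bound; field; rewrite gt_eqF.
rewrite E e4 /bohr_area_bound invf_div mulrA divfK//.
by rewrite expf_neq0// gt_eqF.
Qed.

End ImageArea.

(** * The majorant and its critical radius *)

Section RealBound.
Variable R : realType.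
Implicit Types (a r lam : R).

(* The value of G_2 for the Blaschke factor f_a at -r; see [blaschke_G2]. *)
Definition bohr_bound lam a r : R :=
  (r + a) / (1 + a * r) + r * (1 - a ^+ 2) / (1 + a * r) ^+ 2 + (1 - a ^+ 2) * r ^+ 2 / (1 - r)
  + lam * ((1 - a ^+ 2) ^+ 2 * r ^+ 2 / ((1 - r ^+ 2) * (1 - a ^+ 4 * r ^+ 2))).

Lemma bohr_radius_eq : 2 * bohr_radius R ^+ 2 + 3 * bohr_radius R = 1.
Proof.
rewrite /bohr_radius; have := @sqr_sqrtr R 17 (ler0n _ _); set s := Num.sqrt _ => h.
have -> : 2 * ((s - 3) / 4) ^+ 2 + 3 * ((s - 3) / 4) = (s ^+ 2 - 9) / 8 by field.
by rewrite h; field.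
Qed.

(** The lower end has to exceed 217 / 773, below which the coefficient of a^5 in [bohr_defect] is
    negative. *)
Lemma bohr_radius_bounds : 73 / 260 <= bohr_radius R <= 9 / 32.
Proof.
have := bohr_radius_eq; have : 0 <= bohr_radius R.
  rewrite /bohr_radius; apply: divr_ge0 => //; rewrite subr_ge0.
  by rewrite -[leLHS]ger0_norm// -sqrtr_sqr ler_wsqrtr//; lra.
move: (bohr_radius R) => r r0 h; apply/andP; split; nra.
Qed.

Lemma bohr_lambda_eq : bohr_lambda R = 23 / 16 - 43 / 16 * bohr_radius R.
Proof. by rewrite /bohr_lambda /bohr_radius; field. Qed.

Lemma bohr_lambda_ge0 : 0 <= bohr_lambda R.
Proof. by rewrite bohr_lambda_eq; have := bohr_radius_bounds; lra. Qed.

(* The quotient by (1 - a)^2 of the numerator of 1 - [bohr_bound], once r^2 has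
   been eliminated by means of 2 r^2 + 3 r = 1. *)
Definition bohr_defect a r : R :=
    (- (223 / 64)) + 851 / 64 * r + (- (9 / 32)) * a + 53 / 32 * a * r + 1661 / 256 * a ^+ 2 + (-
      (5849 / 256)) * a ^+ 2 * r + (- (261 / 256)) * a ^+ 3 + 961 / 256 * a ^+ 3 * r + (- (407 /
      64)) * a ^+ 4 + 1451 / 64 * a ^+ 4 * r + (- (217 / 64)) * a ^+ 5 + 773 / 64 * a ^+ 5 * r.

(** As a polynomial in a, [bohr_defect] has six coefficients affine in r; at the critical radius all
    are nonnegative and their sum is at most 1. *)
Lemma bohr_defect_bounds a : 0 <= a <= 1 -> 0 <= bohr_defect a (bohr_radius R) <= 1.
Proof.
move=> aa; have := bohr_radius_bounds; move: (bohr_radius R) => r rb.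
have [c0 c1 c2] : [/\ 0 <= - (223 / 64) + 851 / 64 * r, 0 <= - (9 / 32) + 53 / 32 * r
    & 0 <= 1661 / 256 - 5849 / 256 * r].
  by clear aa; split; lra.
have [c3 c4 c5] : [/\ 0 <= - (261 / 256) + 961 / 256 * r, 0 <= - (407 / 64) + 1451 / 64 * r
    & 0 <= - (217 / 64) + 773 / 64 * r].
  by clear - rb; split; lra.
have cs : (- (223 / 64) + 851 / 64 * r) + (- (9 / 32) + 53 / 32 * r) + (1661 / 256 - 5849 / 256 * r)
  + (- (261 / 256) + 961 / 256 * r) + (- (407 / 64) + 1451 / 64 * r) + (- (217 / 64) + 773 / 64 * r) <= 1.
  by clear - rb; lra.
have /andP[a0 a1] := aa.
have p0 n : 0 <= a ^+ n by rewrite exprn_ge0.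
have p1 n : a ^+ n <= 1 by rewrite exprn_ile1.
have E : bohr_defect a r = (- (223 / 64) + 851 / 64 * r) + (- (9 / 32) + 53 / 32 * r) * a
  + (1661 / 256 - 5849 / 256 * r) * a ^+ 2 + (- (261 / 256) + 961 / 256 * r) * a ^+ 3
  + (- (407 / 64) + 1451 / 64 * r) * a ^+ 4 + (- (217 / 64) + 773 / 64 * r) * a ^+ 5.
  by rewrite /bohr_defect; ring.
rewrite E; move: c0 c1 c2 c3 c4 c5 cs.
move: (_ + 851 / 64 * r) (_ + 53 / 32 * r) (_ - 5849 / 256 * r) (_ + 961 / 256 * r).
move: (_ + 1451 / 64 * r) (_ + 773 / 64 * r) => k4 k5 k0 k1 k2 k3 {E rb}.
move=> c0 c1 c2 c3 c4 c5 cs.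
apply/andP; split.
  by rewrite !addr_ge0// mulr_ge0.
apply: le_trans cs; rewrite !lerD//; exact: ler_piMr.
Qed.

Lemma bohr_bound_eq a : 0 <= a <= 1 -> let r := bohr_radius R in
  1 - bohr_bound (bohr_lambda R) a r =
  (1 - a) ^+ 3 * bohr_defect a r / ((1 + a * r) ^+ 2 * (1 - r ^+ 2) * (1 - a ^+ 4 * r ^+ 2)).
Proof.
move=> /andP[a0 a1] r0; rewrite /bohr_bound bohr_lambda_eq -/r0.
have := bohr_radius_eq; have := bohr_radius_bounds; rewrite -/r0; move: r0 => r rb re.
have r2 : 0 <= r ^+ 2 by rewrite sqr_ge0.
have ar : 0 <= a * r by rewrite mulr_ge0//; lra.
have d1 : 1 + a * r != 0 by rewrite gt_eqF//; lra.
have d2 : 1 - r != 0 by rewrite gt_eqF//; lra.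
have d2' : 1 - r ^+ 2 != 0 by rewrite gt_eqF//; lra.
have a41 : a ^+ 4 * r ^+ 2 <= r ^+ 2.
  by rewrite ler_piMl// exprn_ile1.
have d3 : 1 - a ^+ 4 * r ^+ 2 != 0 by rewrite gt_eqF//; lra.
set lam := 23 / 16 - 43 / 16 * r.
(* The numerator of 1 - [bohr_bound] over the common denominator, with one factor 1 - a removed. *)
pose N := (1 - r) ^+ 2 * (1 + r) * (1 + a * r) * (1 - a ^+ 4 * r ^+ 2)
  - r * (1 + a) * (1 - r ^+ 2) * (1 - a ^+ 4 * r ^+ 2)
  - (1 + a) * r ^+ 2 * (1 + r) * (1 + a * r) ^+ 2 * (1 - a ^+ 4 * r ^+ 2)
  - lam * (1 - a) * (1 + a) ^+ 2 * r ^+ 2 * (1 + a * r) ^+ 2.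
have EN : N = (1 - a) ^+ 2 * bohr_defect a r.
    (* The cofactor in the division by 2 r^2 + 3 r - 1, which is 0 at the critical radius. *)
    pose H := (- (287 / 64)) + 59 / 32 * r + 107 / 16 * a + (- (39 / 8)) * a * r + 35 / 16 * a * r
      ^+ 2 + 913 / 256 * a ^+ 2 + (- (277 / 128)) * a ^+ 2 * r + (- (51 / 64)) * a ^+ 2 * r ^+ 2 +
      27 / 32 * a ^+ 2 * r ^+ 3 + (- (3655 / 256)) * a ^+ 3 + 1059 / 128 * a ^+ 3 * r + (- (331 /
      64)) * a ^+ 3 * r ^+ 2 + 27 / 32 * a ^+ 3 * r ^+ 3 + 555 / 256 * a ^+ 4 + (- (151 / 128)) * a
      ^+ 4 * r + 115 / 64 * a ^+ 4 * r ^+ 2 + (- (59 / 32)) * a ^+ 4 * r ^+ 3 + 2127 / 256 * a ^+ 5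
      + (- (587 / 128)) * a ^+ 5 * r + 183 / 64 * a ^+ 5 * r ^+ 2 + (- (19 / 32)) * a ^+ 5 * r ^+ 3
      + 1 / 2 * a ^+ 5 * r ^+ 4 + 27 / 64 * a ^+ 6 + (- (7 / 32)) * a ^+ 6 * r + 3 / 16 * a ^+ 6 * r
      ^+ 2 + 1 / 8 * a ^+ 6 * r ^+ 3 + 3 / 4 * a ^+ 6 * r ^+ 4 + 1 / 2 * a ^+ 6 * r ^+ 5 + (- (217 /
      64)) * a ^+ 7 + 61 / 32 * a ^+ 7 * r + (- (17 / 16)) * a ^+ 7 * r ^+ 2 + 5 / 8 * a ^+ 7 * r ^+
      3 + (- (1 / 4)) * a ^+ 7 * r ^+ 4 + 1 / 2 * a ^+ 7 * r ^+ 5.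
  have -> : N = (1 - a) ^+ 2 * bohr_defect a r + (2 * r ^+ 2 + 3 * r - 1) * H.
    by rewrite /N /lam /H /bohr_defect; field.
  by rewrite re subrr mul0r addr0.
have -> : (1 - a) ^+ 3 * bohr_defect a r = (1 - a) * N by rewrite EN; ring.
rewrite /N; field; rewrite d1 d2 d3 /= ?andbT.
have -> : 1 - r ^+ 2 = (1 - r) * (1 + r) by ring.
by rewrite mulf_neq0// gt_eqF//; lra.
Qed.
End RealBound.

(** * Upper bound for G_2 *)

Section UpperBound.
Variable R : realType.
Local Notation C := (cplx R).

Lemma cvgn_le (u v : nat -> R) (a b : R) : u @ \oo --> a -> v @ \oo --> b -> (forall n, u n <= v n) -> a <= b.
Proof. by move=> ua vb uv; apply: (ler_cvg_to ua vb); exact: nearW. Qed.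

Lemma cvgn_le_cst (u : nat -> R) (a b : R) : u @ \oo --> a -> (forall n, u n <= b) -> a <= b.
Proof. by move=> ua uv; apply: (cvgn_le ua (@cvg_cst _ b _ _ _)). Qed.

(* 2 r <= 1 - r^2 makes F + r / (1 - r^2) (1 - F^2) nondecreasing in F on [0, 1]. *)
Lemma first_terms_bound (r a F D : R) : 0 <= r -> 2 * r <= 1 - r ^+ 2 -> 0 <= a <= 1 -> 0 <= F ->
  F <= (r + a) / (1 + a * r) -> D * (1 - r ^+ 2) <= 1 - F ^+ 2 ->
  F + D * r <= (r + a) / (1 + a * r) + r * (1 - a ^+ 2) / (1 + a * r) ^+ 2.
Proof.
move=> r0 r2 /andP[a0 a1] F0 FF0 DF; set F1 := _ / _ in FF0 *.
have ar : 0 <= a * r by rewrite mulr_ge0.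
have rr : 0 < 1 - r ^+ 2 by nra.
have r1 : r < 1 by nra.
have F11 : F1 <= 1.
  rewrite /F1 ler_pdivrMr ?mul1r; last lra.
  have : 0 <= (1 - a) * (1 - r) by apply: mulr_ge0; lra.
  lra.
have e1 : r * (1 - a ^+ 2) / (1 + a * r) ^+ 2 = r / (1 - r ^+ 2) * (1 - F1 ^+ 2).
  rewrite /F1; field; apply/andP; split; rewrite gt_eqF//; lra.
have D1 : D * r <= r / (1 - r ^+ 2) * (1 - F ^+ 2).
  by rewrite mulrAC ler_pdivlMr// -mulrA [r * (1 - _)]mulrC mulrA [leRHS]mulrC ler_wpM2r.
apply: le_trans (lerD (lexx F) D1) _; rewrite e1.
set q := r / _.
have q0 : 0 <= q by rewrite /q divr_ge0// ltW.
have q1 : 2 * q <= 1 by rewrite /q mulrA ler_pdivrMr// mul1r.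
have : 0 <= (F1 - F) * (1 - q * (F1 + F)).
  apply: mulr_ge0; first by rewrite subr_ge0.
  rewrite subr_ge0; apply: le_trans q1; rewrite mulrC ler_wpM2r//; lra.
lra.
Qed.

Lemma bohr_G2_le (lam : R) (f : C -> C) (z : C) : 0 <= lam -> classB f ->
  cmod z < 1 -> 2 * cmod z <= 1 - cmod z ^+ 2 ->
  (image_area f (cmod z) < pi%:E)%E /\
  exists2 a : R, 0 <= a <= 1 & (bohr_G2 lam f z <= (bohr_bound lam a (cmod z))%:E)%E.
Proof.
move=> lam0 Bf z1 z2.
have [a fa] := classB_rep Bf; have [_ f1] := Bf.
set r := cmod z in z1 z2 *; have r0 : 0 <= r by exact: cmod_ge0.
have r01 : 0 <= r < 1 by rewrite r0.
pose x := cmod (a 0%N).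
have x0 : 0 <= x by exact: cmod_ge0.
have x1 : x <= 1 by exact: (coef0_le1 fa f1).
have x201 : 0 <= x ^+ 2 <= 1 by rewrite sqr_ge0 exprn_ile1.
have rr2 : 2 * r ^+ 2 <= 1 by nra.
have p0 := pi_gt0 R.
have [A AE Acvg] := image_area_rep fa r01.
have [/andP[X0 X1] XE] := bohr_area_bound_lt1 x201 r01.
set X := bohr_area_bound _ _ in X0 X1 XE.
have AX : A <= pi * X.
  apply: (cvgn_le_cst Acvg) => n; rewrite ler_pM2l//.
  by have := area_coef_sum fa f1 n r0 rr2; rewrite -/x /X /bohr_area_bound [r ^+ 2 * _]mulrC.
have A0 : 0 <= A.
  rewrite -lee_fin -AE /image_area; apply: integral_ge0 => p _.
  by rewrite lee_fin sqr_ge0.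
have Api : A < pi by apply: le_lt_trans AX _; rewrite gtr_pMr.
split; first by rewrite AE lte_fin.
exists x; first by rewrite x0.
rewrite /bohr_G2 -/r AE /=.
have tc n : taylor_coef f n = a n := rep_taylor n ltr01 fa.
rewrite !tc -/x.
under eq_eseriesr do rewrite tc.
under [X in (_ * X)%E]eq_eseriesr do rewrite tc.
pose u k := cmod (a k) * r ^+ k; pose v k := cmod (a k) ^+ 2 * r ^+ (2 * k).
have u0 k : 0 <= u k by rewrite mulr_ge0 ?cmod_ge0 ?exprn_ge0.
have v0 k : 0 <= v k by rewrite mulr_ge0 ?sqr_ge0 ?exprn_ge0.
pose K := (1 + x)^-1 + r / (1 - r).
have K0 : 0 < K.
  by apply: ltr_pwDl; [rewrite invr_gt0; lra|rewrite divr_ge0//; lra].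
pose T := (1 - x ^+ 2) * r ^+ 2 / (1 - r).
(* [bohr_tail_sum] has the upper ends 2n + 2 and n + 1; both sums may be shortened to n since their
   terms are nonnegative. *)
have uvT n : \sum_(2 <= k < n) u k + K * \sum_(1 <= k < n) v k <= T.
  have := bohr_tail_sum fa f1 n r01; rewrite -/x -/K -/T; apply: le_trans.
  have mono (w : nat -> R) (w0 : forall k, 0 <= w k) m n1 n2 : (n1 <= n2)%N -> \sum_(m <= k < n1) w k <= \sum_(m <= k < n2) w k.
    move=> n12; case: (leqP m n1) => mn.
      by rewrite (@big_cat_nat _ _ _ n1 m n2)//= lerDl; apply: sumr_ge0.
    by rewrite big_geq ?(ltnW mn)//; apply: sumr_ge0.
  apply: lerD.
    by apply: mono => //; rewrite -addnn (leq_trans (leq_addr n n))// (leq_trans (leqnSn _)).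
  by rewrite ler_pM2l//; apply: mono.
have su n : 0 <= \sum_(2 <= k < n) u k by apply: sumr_ge0.
have sv n : 0 <= K * \sum_(1 <= k < n) v k by rewrite mulr_ge0 ?(ltW K0)//; apply: sumr_ge0.
have [s1 s1E] := @nonneg_sum_cvg _ u 2 T u0 (fun n => le_trans (ler_wpDr (sv n) (lexx _)) (uvT n)).
have [s2 s2E] : exists s : R, \sum_(1 <= k < n) v k @[n --> \oo] --> s.
  apply: (@nonneg_sum_cvg _ v 1 (T / K)) => // n.
  by rewrite ler_pdivlMr// mulrC; apply: le_trans (uvT n); rewrite lerDr.
rewrite (nneseries_cvg u0 s1E) (nneseries_cvg v0 s2E) -/K.
have sT : s1 + K * s2 <= T by apply: (cvgn_le_cst (cvgnD s1E (cvgnZ K s2E))).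
rewrite -EFinM -!EFinD lee_fin.
have h1 : cmod (f z) + cmod (derive1 f z) * r <= (r + x) / (1 + x * r) + r * (1 - x ^+ 2) / (1 + x * r) ^+ 2.
  apply: first_terms_bound => //; [by rewrite x0|exact: cmod_ge0|exact: (growth_bound fa f1)|exact: (derive_bound fa f1)].
have h2 : A / (pi - A) <= X / (1 - X).
  rewrite ler_pdivrMr ?subr_gt0// mulrAC ler_pdivlMr ?subr_gt0//.
  rewrite [X * _]mulrC; lra.
have h3 := ler_wpM2l lam0 h2.
rewrite XE -exprM in h3.
rewrite /bohr_bound -/T; lra.
Qed.
End UpperBound.

(** * The extremal functions *)

Section Blaschke.
Variable R : realType.
Local Notation C := (cplx R).

(** With y = s^2, n s^n <= 1 + s + ... + s^(n-1) <= 1 / (1 - s), so n y^n is at most s^n / (1 -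
    s). *)
Lemma cvg_natmul_expr (y : R) : 0 <= y < 1 -> n%:R * y ^+ n @[n --> \oo] --> (0 : R).
Proof.
move=> /andP[y0 y1]; pose s := Num.sqrt y.
have s0 : 0 <= s by exact: sqrtr_ge0.
have s1 : s < 1 by rewrite -sqrtr1 ltr_sqrt.
have sn : s ^+ n @[n --> \oo] --> (0 : R) by apply: cvg_expr; rewrite ger0_norm.
have H := cvgnZ (1 - s)^-1 sn; rewrite mulr0 in H.
apply: (squeeze_cvgr _ (@cvg_cst _ (0 : R) nat \oo _) H); apply: nearW => n.
rewrite mulr_ge0 ?exprn_ge0//=.
have -> : y = s * s by rewrite -expr2 sqr_sqrtr.
rewrite exprMn mulrA ler_wpM2r ?exprn_ge0//.
apply: le_trans (geom_bound n (_ : 0 <= s < 1)); last by rewrite s0.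
have -> : n%:R * s ^+ n = \sum_(0 <= k < n) s ^+ n by rewrite sumr_const_nat subn0 mulr_natl.
by apply: ler_sum_nat => k /andP[_ kn]; rewrite ler_wiXn2l ?(ltW s1) ?(ltnW kn).
Qed.

(** Over a general field because it serves both the area, over [R], and the derivative at -r, over
    [C]. *)
Lemma cvg_deriv_geom (K : numFieldType) (w : K) : w != 1 -> w ^+ n @[n --> \oo] --> (0 : K) ->
  n%:R * w ^+ n @[n --> \oo] --> (0 : K) ->
  \sum_(1 <= k < n.+1) k%:R * w ^+ k.-1 @[n --> \oo] --> ((1 - w) ^+ 2)^-1.
Proof.
move=> w1 h1 h2.
have H : (fun n => ((1 - w) ^+ 2)^-1 * (1 + (-1 * w ^+ n + (w - 1) * (n%:R * w ^+ n)))) @ \oo -->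
    ((1 - w) ^+ 2)^-1 * (1 + (-1 * 0 + (w - 1) * 0)).
  by apply: cvgnZ; apply: cvgnD; [exact: cvg_cst|apply: cvgnD; apply: cvgnZ].
rewrite !mulr0 !addr0 mulr1 in H; apply: (cvgn_ext H) => n.
rewrite sum_deriv_geom// mulrC; congr (_ * _); ring.
Qed.

Definition blaschke_coef (a : R) (n : nat) : C := if n is k.+1 then (- (1 - a ^+ 2) * a ^+ k)%:C else a%:C.

Lemma blaschke_denom_neq0 (a : R) (z : C) : 0 <= a < 1 -> cmod z < 1 -> 1 - a%:C * z != 0.
Proof.
move=> /andP[a0 a1] z1; rewrite subr_eq0; apply/eqP => h.
have := cmod1 R; rewrite h cmodM cmod_real ger0_norm// => h1.
have : a * cmod z <= a * 1 by rewrite ler_wpM2l// ltW.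
lra.
Qed.

Lemma blaschke_rep (a : R) : 0 <= a < 1 -> rep (blaschke a) (blaschke_coef a) 0 1.
Proof.
move=> aa z; rewrite subr0 => z1; have /andP[a0 a1] := aa.
have d0 := blaschke_denom_neq0 aa z1.
have az1 : cmod (a%:C * z) < 1.
  rewrite cmodM cmod_real ger0_norm//; apply: le_lt_trans z1.
  by rewrite ler_piMl ?cmod_ge0 ?(ltW a1).
have H := cvgnD (@cvg_cst _ (a%:C : C) nat \oo _) (cvgnZ (- (1 - a ^+ 2)%:C * z : C) (cvg_geomC az1)).
have E : blaschke a z = a%:C + (- (1 - a ^+ 2)%:C * z) * (1 - a%:C * z)^-1.
  rewrite /blaschke rmorphB rmorph1 rmorphXn /=; field.
  exact: d0.
suff : series (fun k => blaschke_coef a k * z ^+ k) n.+1 @[n --> \oo] --> blaschke a z.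
  by rewrite (cvg_shiftS (series _)).
rewrite E; apply: (cvgn_ext (H _)) => n.
rewrite /series /= big_nat_recl// expr0 mulr1; congr (_ + _).
rewrite big_distrr /=; apply: eq_bigr => k _.
rewrite rmorphM /= rmorphN /= rmorphXn /= exprMn [z ^+ k.+1]exprS; ring.
Qed.

(** By [cmodB_sqr], |1 - a z|^2 - |a - z|^2 = (1 - |z|^2)(1 - a^2). *)
Lemma blaschke_classB (a : R) : 0 <= a < 1 -> classB (blaschke a).
Proof.
move=> aa; have /andP[a0 a1] := aa; have fa := blaschke_rep aa; split=> z z1.
  by apply: (rep_analytic fa); rewrite subr0.
have d0 := blaschke_denom_neq0 aa z1.
rewrite /unit_disk /= in z1.
have d0' : 0 < cmod (1 - a%:C * z) by rewrite lt_neqAle cmod_ge0 andbT eq_sym cmod_eq0.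
rewrite /blaschke cmodM cmodV ler_pdivrMr// mul1r.
rewrite -(ler_pXn2r (_ : 0 < 2)%N) ?nnegrE ?cmod_ge0//.
have := cmodB_sqr z a%:C; rewrite cj_real [z * _]mulrC => ->.
rewrite cmodBC lerDl cmod_real ger0_norm//; apply: mulr_ge0.
  by rewrite subr_ge0 exprn_ile1 ?cmod_ge0// ltW.
by rewrite subr_ge0 exprn_ile1// ltW.
Qed.

Section Fix.
Variables (a r : R).
Hypotheses (aa : 0 <= a < 1) (rr : 0 < r < 1).

Let a0 : 0 <= a. Proof. by case/andP: aa. Qed.
Let a1 : a < 1. Proof. by case/andP: aa. Qed.
Let r0 : 0 < r. Proof. by case/andP: rr. Qed.
Let r1 : r < 1. Proof. by case/andP: rr. Qed.
Let ar0 : 0 <= a * r. Proof. by rewrite mulr_ge0// ltW. Qed.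
Let ar1 : a * r < 1. Proof. by apply: le_lt_trans r1; rewrite ler_piMl ?(ltW r0) ?(ltW a1). Qed.
Let y0 : 0 <= a ^+ 2 * r ^+ 2. Proof. by rewrite mulr_ge0 ?sqr_ge0. Qed.
Let y1 : a ^+ 2 * r ^+ 2 < 1. Proof. by rewrite -exprMn expr_lt1. Qed.

Lemma cmod_blaschke_coefS k : cmod (blaschke_coef a k.+1) = (1 - a ^+ 2) * a ^+ k.
Proof.
rewrite /blaschke_coef cmod_real mulNr normrN ger0_norm// mulr_ge0 ?exprn_ge0//.
by rewrite subr_ge0 exprn_ile1// ltW.
Qed.

Let blaschke_coef_sqr k : cmod (blaschke_coef a k.+1) ^+ 2 * r ^+ (2 * k.+1) =
  (1 - a ^+ 2) ^+ 2 * r ^+ 2 * (a ^+ 2 * r ^+ 2) ^+ k.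
Proof.
have sq : (a ^+ k) ^+ 2 = (a ^+ 2) ^+ k by rewrite -!exprM mulnC.
rewrite cmod_blaschke_coefS mulnS exprD [r ^+ (2 * k)]exprM [(_ * a ^+ k) ^+ 2]exprMn sq.
by rewrite [(a ^+ 2 * _) ^+ k]exprMn; ring.
Qed.

Lemma blaschke_area : image_area (blaschke a) r = (pi * bohr_area_bound (a ^+ 2) r)%:E.
Proof.
have r01 : 0 <= r < 1 by rewrite (ltW r0).
have [A -> Acvg] := image_area_rep (blaschke_rep aa) r01; congr EFin.
apply: (cvg_unique _ Acvg) => //.
have yy : 0 <= a ^+ 2 * r ^+ 2 < 1 by rewrite y0.
have yn : (a ^+ 2 * r ^+ 2) ^+ n @[n --> \oo] --> (0 : R) by apply: cvg_expr; rewrite ger0_norm.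
have H := cvg_deriv_geom _ yn (cvg_natmul_expr yy); rewrite lt_eqF// in H.
have {}H := cvgnZ (pi * ((1 - a ^+ 2) ^+ 2 * r ^+ 2)) (H isT).
rewrite /bohr_area_bound mulrA; apply: (cvgn_ext H) => n.
rewrite -mulrA; congr (_ * _); rewrite big_distrr /=; apply: eq_big_nat => -[//|k] _.
by rewrite -mulrA blaschke_coef_sqr mulrCA.
Qed.

(** At -r the value (a + r) / (1 + a r) attains [growth_bound] and the derivative attains
    [derive_bound], so the estimates behind [bohr_G2_le] become equalities. *)
Lemma blaschke_G2 (lam : R) : bohr_G2 lam (blaschke a) (- r%:C) = (bohr_bound lam a r)%:E.
Proof.
have p0 := pi_gt0 R.
have fa := blaschke_rep aa.
have rc : cmod (- r%:C : C) = r by rewrite cmodN cmod_real ger0_norm// ltW.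
rewrite /bohr_G2 rc blaschke_area /=.
have tc n : taylor_coef (blaschke a) n = blaschke_coef a n := rep_taylor n ltr01 fa.
rewrite tc.
under eq_eseriesr do rewrite tc.
under [X in (_ * X)%E]eq_eseriesr do rewrite tc.
have ca : cmod (blaschke_coef a 0) = a by rewrite /= cmod_real ger0_norm.
have gr (y : R) : 0 <= y -> y < 1 -> \sum_(0 <= k < n) y ^+ k @[n --> \oo] --> (1 - y)^-1.
  move=> yp yl; apply: cvgn_geom; first by rewrite lt_eqF.
  by apply: cvg_expr; rewrite ger0_norm.
have h1 : \sum_(2 <= k < n) cmod (blaschke_coef a k) * r ^+ k @[n --> \oo] -->
    (1 - a ^+ 2) * a * r ^+ 2 * (1 - a * r)^-1.
  rewrite -(cvg_shiftn 2); apply: (cvgn_ext (cvgnZ ((1 - a ^+ 2) * a * r ^+ 2) (gr _ ar0 ar1))) => n.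
  rewrite /= -{1}[2%N]add0n big_addn addnK big_distrr /=; apply: eq_bigr => k _.
  by rewrite addn2 cmod_blaschke_coefS exprMn !exprS; ring.
have h2 : \sum_(1 <= k < n) cmod (blaschke_coef a k) ^+ 2 * r ^+ (2 * k) @[n --> \oo] -->
    (1 - a ^+ 2) ^+ 2 * r ^+ 2 * (1 - a ^+ 2 * r ^+ 2)^-1.
  rewrite -(cvg_shiftn 1); apply: (cvgn_ext (cvgnZ ((1 - a ^+ 2) ^+ 2 * r ^+ 2) (gr _ y0 y1))) => n.
  rewrite /= -{1}[1%N]add0n big_addn addnK big_distrr /=; apply: eq_bigr => k _.
  by rewrite addn1 blaschke_coef_sqr.
rewrite (nneseries_cvg _ h1); last by move=> k; rewrite mulr_ge0 ?cmod_ge0 ?exprn_ge0 ?(ltW r0).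
rewrite (nneseries_cvg _ h2); last by move=> k; rewrite mulr_ge0 ?sqr_ge0 ?exprn_ge0 ?(ltW r0).
rewrite -EFinM -!EFinD; congr EFin.
have zr : cmod (- r%:C : C) < 1 by rewrite rc.
have fz : cmod (blaschke a (- r%:C)) = (r + a) / (1 + a * r).
  rewrite /blaschke cmodM cmodV opprK mulrN opprK -!rmorphM -(rmorph1 (real_complex R)) -!rmorphD /= !cmod_real.
  by rewrite !ger0_norm ?addr_ge0 ?(ltW r0)// addrC.
have dfz : cmod (derive1 (blaschke a) (- r%:C)) = (1 - a ^+ 2) / (1 + a * r) ^+ 2.
  have Hd := rep_derive fa; have {}Hd := Hd (- r%:C); rewrite subr0 in Hd; have {}Hd := Hd zr.
  have azc : cmod (- (a * r)%:C : C) < 1 by rewrite cmodN cmod_real ger0_norm.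
  have w1 : - (a * r)%:C != 1 :> C by apply/eqP => h; rewrite h cmod1 ltxx in azc.
  have wn : (- (a * r)%:C : C) ^+ n @[n --> \oo] --> (0 : C).
    apply/cvgCP; under eq_fun do rewrite subr0 cmodX.
    by apply: cvg_expr; rewrite ger0_norm ?cmod_ge0.
  have nwn : n%:R * (- (a * r)%:C : C) ^+ n @[n --> \oo] --> (0 : C).
    apply/cvgCP; under eq_fun do rewrite subr0 cmodM cmod_nat cmodX.
    by apply: cvg_natmul_expr; rewrite cmod_ge0.
  have H := cvgnZ (- (1 - a ^+ 2)%:C) (cvg_deriv_geom w1 wn nwn).
  have -> : derive1 (blaschke a) (- r%:C) = - (1 - a ^+ 2)%:C * ((1 - - (a * r)%:C) ^+ 2)^-1.
    apply: (cvgC_unique Hd); apply: (cvgn_ext H) => n.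
    rewrite /series /= big_add1 /= big_distrr /=; apply: eq_bigr => k _.
    rewrite rmorphM rmorphN rmorphXn /= -mulNr rmorphM /= -mulrN exprMn; ring.
  rewrite opprK -(rmorph1 (real_complex R)) -rmorphD /= cmodM cmodN cmodV cmodX !cmod_real.
  have h : 0 <= 1 - a ^+ 2 by rewrite subr_ge0 exprn_ile1// ltW.
  by rewrite !ger0_norm// addr_ge0.
have r01 : 0 <= r < 1 by rewrite (ltW r0).
have x201 : 0 <= a ^+ 2 <= 1 by rewrite sqr_ge0 exprn_ile1// ltW.
have [/andP[X0 X1] XE] := bohr_area_bound_lt1 x201 r01.
have -> : pi * bohr_area_bound (a ^+ 2) r / (pi - pi * bohr_area_bound (a ^+ 2) r) =
  bohr_area_bound (a ^+ 2) r / (1 - bohr_area_bound (a ^+ 2) r).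
  have -> : pi - pi * bohr_area_bound (a ^+ 2) r = pi * (1 - bohr_area_bound (a ^+ 2) r) by ring.
  by rewrite -mulf_div divff ?mul1r// gt_eqF.
rewrite XE -exprM fz dfz ca /bohr_bound; congr (_ + _).
rewrite -addrA; congr (_ + _ + _); first by rewrite mulrAC [r * _]mulrC.
(* What remains is equality in the tail estimate: moduli and weighted squares add up to (1 - a^2)
   r^2 / (1 - r). *)
have d1 : 1 + a * r != 0 by rewrite gt_eqF// ltr_pwDl.
have d2 : 1 - a * r != 0 by rewrite gt_eqF// subr_gt0.
have d3 : 1 - r != 0 by rewrite gt_eqF// subr_gt0.
have d4 : 1 + a != 0 by rewrite gt_eqF// ltr_pwDl.
have -> : 1 - a ^+ 2 * r ^+ 2 = (1 - a * r) * (1 + a * r) by ring.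
by field; rewrite d1 d2 d3 d4.
Qed.
End Fix.
End Blaschke.

(** * Monotonicity in r and sharpness of the constants *)

Section Extremal.
Variable R : realType.
Implicit Types (a r s lam : R).

(** Each summand increases with r; for r / (1 + a r)^2 this is s (1 + a r)^2 - r (1 + a s)^2 = (s -
    r)(1 - a^2 r s) >= 0. *)
Lemma bohr_bound_le lam a r s : 0 <= lam -> 0 <= a <= 1 -> 0 <= r -> r <= s -> s < 1 ->
  bohr_bound lam a r <= bohr_bound lam a s.
Proof.
move=> l0 /andP[a0 a1] r0 rs s1.
have s0 : 0 <= s by apply: le_trans rs.
have ar : 0 <= a * r by rewrite mulr_ge0.
have as0 : 0 <= a * s by rewrite mulr_ge0.
have a2 : 0 <= 1 - a ^+ 2 by rewrite subr_ge0 exprn_ile1.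
have rs2 : r ^+ 2 <= s ^+ 2 by rewrite lerXn2r.
have s2 : s ^+ 2 < 1 by rewrite expr_lt1.
have a4 : 0 <= a ^+ 4 <= 1 by rewrite exprn_ge0// exprn_ile1.
have a4s : a ^+ 4 * s ^+ 2 < 1 by apply: le_lt_trans s2; rewrite ler_piMl ?sqr_ge0//; case/andP: a4.
have a4rs : a ^+ 4 * r ^+ 2 <= a ^+ 4 * s ^+ 2 by rewrite ler_wpM2l//; case/andP: a4.
have d1 : 0 < 1 + a * r by lra.
have d2 : 0 < 1 + a * s by lra.
apply: lerD; last first.
  apply: ler_wpM2l => //; rewrite -[leLHS]mulrA -[leRHS]mulrA; apply: ler_wpM2l; first exact: sqr_ge0.
  apply: ler_pM; [exact: sqr_ge0|by rewrite invr_ge0 mulr_ge0//; lra|by []|].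
  rewrite lef_pV2 ?posrE; [|by apply: mulr_gt0; lra|by apply: mulr_gt0; lra].
  by apply: ler_pM; lra.
apply: lerD; last first.
  rewrite -[leLHS]mulrA -[leRHS]mulrA; apply: ler_wpM2l => //; apply: ler_pM; [exact: sqr_ge0|by rewrite invr_ge0; lra|by []|].
  by rewrite lef_pV2 ?posrE; lra.
apply: lerD.
  rewrite ler_pdivrMr// mulrAC ler_pdivlMr//.
  have : 0 <= (s - r) * (1 - a ^+ 2) by apply: mulr_ge0 => //; lra.
  lra.
rewrite ler_pdivrMr ?exprn_gt0// mulrAC ler_pdivlMr ?exprn_gt0//.
have ars : 0 <= 1 - (a * r) * (a * s).
  rewrite subr_ge0 -[leRHS](mulr1 1); apply: ler_pM => //.
    by rewrite -[leRHS](mulr1 1); apply: ler_pM => //; lra.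
  by rewrite -[leRHS](mulr1 1); apply: ler_pM => //; lra.
have : 0 <= (1 - a ^+ 2) * ((s - r) * (1 - (a * r) * (a * s))).
  by rewrite !mulr_ge0//; lra.
lra.
Qed.

(* To first order at a = 1, 1 - [bohr_bound] is a positive multiple of
   - (2 r^2 + 3 r - 1) (1 - a); the term in lam is of second order. *)
Lemma bohr_radius_sharp lam r : 0 <= lam -> 0 < r < 1 -> 1 < 2 * r ^+ 2 + 3 * r ->
  exists2 a, 0 <= a < 1 & 1 < bohr_bound lam a r.
Proof.
move=> l0 /andP[r0 r1] rr.
(* -d is the value at e = 0 of the polynomial P below; the rest of P is at most 13 e, and e <= d /
   26 keeps it under d. *)
pose d := (2 * r ^+ 2 + 3 * r - 1) * (r ^+ 2 + 1).
have d0 : 0 < d by apply: mulr_gt0; [lra|rewrite ltr_wpDl ?sqr_ge0].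
pose e := Num.min (1 / 2) (d / 26).
have e0 : 0 < e by rewrite /e lt_min; apply/andP; split; lra.
have e1 : e <= 1 / 2 by rewrite /e ge_min lexx.
have e2 : e <= d / 26 by rewrite /e ge_min lexx orbT.
exists (1 - e); first lra.
have r2 : 0 < r ^+ 2 < 1 by rewrite exprn_gt0// expr_lt1// ltW.
have q0 : 0 <= (1 - e) ^+ 4 <= 1 by rewrite exprn_ge0 ?exprn_ile1//; lra.
have der : 0 < 1 + (1 - e) * r by have := mulr_gt0 (_ : 0 < 1 - e) r0; lra.
pose P := (1 - r) ^+ 2 * (1 + (1 - e) * r) - r * (2 - e) * (1 - r) - (2 - e) * r ^+ 2 * (1 + (1 - e) * r) ^+ 2.
have PE : P = - d + e * (r * (1 - r) - (1 - r) ^+ 2 * r + r ^+ 2 * ((1 + (1 - e) * r) ^+ 2 + 2 * r * (2 + (2 - e) * r))).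
  by rewrite /P /d; ring.
have Ple : P < 0.
  suff : r * (1 - r) - (1 - r) ^+ 2 * r + r ^+ 2 * ((1 + (1 - e) * r) ^+ 2 + 2 * r * (2 + (2 - e) * r)) <= 13.
    by move=> /(ler_wpM2l (ltW e0)); rewrite PE; lra.
  have er : 0 <= e * r by rewrite mulr_ge0 ?ltW.
  have t1 : (1 + (1 - e) * r) ^+ 2 <= 2 ^+ 2 by rewrite lerXn2r ?nnegrE//; lra.
  have t2 : r * (2 + (2 - e) * r) <= 1 * 4 by apply: ler_pM; lra.
  have t3 : r ^+ 2 * ((1 + (1 - e) * r) ^+ 2 + 2 * r * (2 + (2 - e) * r)) <= 1 * 12.
    apply: ler_pM; [lra| |lra|lra].
    by rewrite addr_ge0 ?sqr_ge0// mulr_ge0//; lra.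
  have t4 : 0 <= (1 - r) ^+ 2 * r by rewrite mulr_ge0 ?sqr_ge0 ?ltW.
  have t5 : 0 <= r ^+ 2 by lra.
  lra.
have T : 0 <= lam * ((1 - (1 - e) ^+ 2) ^+ 2 * r ^+ 2 / ((1 - r ^+ 2) * (1 - (1 - e) ^+ 4 * r ^+ 2))).
  apply: mulr_ge0 => //; apply: divr_ge0; first by rewrite mulr_ge0 ?sqr_ge0.
  apply: mulr_ge0; first lra.
  rewrite subr_ge0; apply: (@le_trans _ _ (1 * r ^+ 2)); last lra.
  by apply: ler_wpM2r; lra.
have E : 1 - bohr_bound 0 (1 - e) r = e * P / ((1 + (1 - e) * r) ^+ 2 * (1 - r)).
  have n1 : 1 + (1 - e) * r != 0 by rewrite gt_eqF.
  have n2 : 1 - r != 0 by rewrite gt_eqF//; lra.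
  by rewrite /bohr_bound mul0r addr0 /P; field; rewrite n1 n2.
have : e * P / ((1 + (1 - e) * r) ^+ 2 * (1 - r)) < 0.
  rewrite -mulrA pmulr_rlt0// nmulr_rlt0// invr_gt0 mulr_gt0 ?exprn_gt0//; lra.
rewrite -E /bohr_bound mul0r addr0; lra.
Qed.

(** The factor 2 comes from a denominator that is at least 1 / 2. The lower bound is the inequality
    at the critical radius, the upper bound the contact of order 3. *)
Lemma bohr_defect_le a : 0 <= a <= 1 ->
  0 <= 1 - bohr_bound (bohr_lambda R) a (bohr_radius R) <= 2 * (1 - a) ^+ 3.
Proof.
move=> aa; have /andP[a0 a1] := aa; rewrite bohr_bound_eq//.
have /andP[Q0 Q1] := bohr_defect_bounds aa.
have rb := bohr_radius_bounds R.
move: (bohr_defect a _) Q0 Q1 => Q Q0 Q1; move: (bohr_radius R) rb => r rb.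
have r2 : r ^+ 2 <= 1 / 4.
  by apply: (@le_trans _ _ ((1 / 2) ^+ 2)); [rewrite lerXn2r ?nnegrE//; lra|lra].
have r2' := sqr_ge0 r.
have a4 : a ^+ 4 * r ^+ 2 <= 1 / 4 by apply: le_trans r2; rewrite ler_piMl// exprn_ile1.
have ar : 0 <= a * r by rewrite mulr_ge0//; lra.
have c0 : 0 <= (1 - a) ^+ 3 by rewrite exprn_ge0// subr_ge0.
set D := _ * (1 - r ^+ 2) * _.
have D1 : 1 / 2 <= D.
  have h1 : 1 <= (1 + a * r) ^+ 2 by rewrite expr_ge1//; lra.
  have h2 : 1 * (3 / 4) <= (1 + a * r) ^+ 2 * (1 - r ^+ 2) by apply: ler_pM; lra.
  have h3 : 3 / 4 * (3 / 4) <= D by apply: ler_pM; lra.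
  lra.
have D0 : 0 < D by lra.
apply/andP; split; first by apply: divr_ge0; [exact: mulr_ge0|exact: ltW].
rewrite ler_pdivrMr//.
have h : (1 - a) ^+ 3 * Q <= (1 - a) ^+ 3 by rewrite ler_piMr.
have : (1 - a) ^+ 3 * (1 / 2) <= (1 - a) ^+ 3 * D by rewrite ler_wpM2l.
lra.
Qed.

(** At a = 1 - e the larger lambda adds at least k e^2, while the deficit is at most 2 e^3; e <= k /
    4 makes the gain win. *)
Lemma bohr_lambda_sharp lam : bohr_lambda R < lam ->
  exists2 a, 0 <= a < 1 & 1 < bohr_bound lam a (bohr_radius R).
Proof.
move=> ll; have rb := bohr_radius_bounds R.
set r := bohr_radius R in rb *.
have r20 : 0 < r ^+ 2 by rewrite exprn_gt0//; lra.
pose k := (lam - bohr_lambda R) * r ^+ 2.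
have k0 : 0 < k by rewrite mulr_gt0// subr_gt0.
pose e := Num.min (1 / 2) (k / 4).
have e0 : 0 < e by rewrite /e lt_min; apply/andP; split; lra.
have e1 : e <= 1 / 2 by rewrite /e ge_min lexx.
have e2 : e <= k / 4 by rewrite /e ge_min lexx orbT.
have aa : 0 <= 1 - e < 1 by lra.
exists (1 - e) => //.
have aa' : 0 <= 1 - e <= 1 by lra.
have /andP[_ h] := bohr_defect_le aa'; rewrite -/r subKr in h.
have r2 : r ^+ 2 < 1 by rewrite expr_lt1//; lra.
have a4 : 0 <= (1 - e) ^+ 4 <= 1 by rewrite exprn_ge0 ?exprn_ile1//; lra.
have a4r : 0 <= (1 - e) ^+ 4 * r ^+ 2 < 1.
  have /andP[a40 a41] := a4; apply/andP; split; first by apply: mulr_ge0 => //; exact: ltW.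
  by apply: le_lt_trans r2; apply: ler_piMl => //; exact: ltW.
pose D := (1 - r ^+ 2) * (1 - (1 - e) ^+ 4 * r ^+ 2).
have D0 : 0 < D by apply: mulr_gt0; lra.
have D1 : D <= 1 by rewrite -[leRHS](mulr1 1); apply: ler_pM; lra.
pose Y := (1 - (1 - e) ^+ 2) ^+ 2 * r ^+ 2 / D.
have Y1 : e ^+ 2 * r ^+ 2 <= Y.
  rewrite /Y ler_pdivlMr//; apply: (@le_trans _ _ (e ^+ 2 * r ^+ 2)).
    by rewrite ler_piMr// mulr_ge0 ?sqr_ge0.
  rewrite ler_wpM2r ?sqr_ge0// lerXn2r ?nnegrE ?(ltW e0)//; nra.
have E : bohr_bound lam (1 - e) r = bohr_bound (bohr_lambda R) (1 - e) r + (lam - bohr_lambda R) * Y.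
  by rewrite /bohr_bound -/D -/Y; ring.
have h3 : (lam - bohr_lambda R) * (e ^+ 2 * r ^+ 2) <= (lam - bohr_lambda R) * Y.
  by rewrite ler_wpM2l// subr_ge0 ltW.
have h4 : (lam - bohr_lambda R) * (e ^+ 2 * r ^+ 2) = k * e ^+ 2 by rewrite /k; ring.
have h5 : 2 * e ^+ 3 <= k / 2 * e ^+ 2.
  have -> : 2 * e ^+ 3 = (2 * e) * e ^+ 2 by ring.
  by rewrite ler_wpM2r ?sqr_ge0//; lra.
have h6 : 0 < k * e ^+ 2 by rewrite mulr_gt0// exprn_gt0.
rewrite E; lra.
Qed.

Lemma bohr_bound_cvg : bohr_bound (bohr_lambda R) a (bohr_radius R) @[a --> 1^'-] --> (1 : R).
Proof.
apply/cvgrPdist_le => e e0; near=> a.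
have a1 : a < 1 by near: a; exact: nbhs_left_lt.
have a0 : 0 < a by near: a; exact: nbhs_left_gt.
have ae : 1 - e / 2 < a by near: a; apply: nbhs_left_gt; lra.
have aa : 0 <= a <= 1 by lra.
have /andP[h0 h1] := bohr_defect_le aa.
rewrite ger0_norm//; apply: le_trans h1 _.
have : (1 - a) ^+ 3 <= 1 - a by rewrite exprS ler_piMr ?exprn_ile1//; lra.
lra.
Unshelve. all: by end_near. Qed.

(** The limit is the coefficient of (1 - a)^2 in the deficit, which any larger lambda would make
    negative. *)
Lemma bohr_defect_cvg : (1 - bohr_bound (bohr_lambda R) a (bohr_radius R)) / (1 - a) ^+ 2
  @[a --> 1^'-] --> (0 : R).
Proof.
apply/cvgrPdist_le => e e0; near=> a.
have a1 : a < 1 by near: a; exact: nbhs_left_lt.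
have a0 : 0 < a by near: a; exact: nbhs_left_gt.
have ae : 1 - e / 2 < a by near: a; apply: nbhs_left_gt; lra.
have aa : 0 <= a <= 1 by lra.
have /andP[h0 h1] := bohr_defect_le aa.
have d0 : 0 < (1 - a) ^+ 2 by rewrite exprn_gt0// subr_gt0.
rewrite sub0r normrN ger0_norm; last by rewrite divr_ge0// ltW.
rewrite ler_pdivrMr//; apply: le_trans h1 _.
by rewrite exprS mulrA ler_wpM2r ?ltW//; lra.
Unshelve. all: by end_near. Qed.
End Extremal.
Unset Implicit Arguments.

Theorem theorem2p15 (R : realType) :
  [/\ (* the inequality; the area bound makes the last term meaningful *)
      (forall f : cplx R -> cplx R, classB f ->
         forall z : cplx R, cmod z <= bohr_radius R ->
           (image_area f (cmod z) < pi%:E)%E /\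
           (bohr_G2 (bohr_lambda R) f z <= 1%:E)%E),
      (* no larger radius *)
      (forall rho : R, bohr_radius R < rho ->
         exists f : cplx R -> cplx R, exists z : cplx R,
           [/\ classB f, cmod z <= rho /\ unit_disk z,
               (image_area f (cmod z) < pi%:E)%E &
               (1%:E < bohr_G2 (bohr_lambda R) f z)%E]),
      (* no larger lambda *)
      (forall lambda : R, bohr_lambda R < lambda ->
         exists f : cplx R -> cplx R, exists z : cplx R,
           [/\ classB f, cmod z <= bohr_radius R,
               (image_area f (cmod z) < pi%:E)%E &
               (1%:E < bohr_G2 lambda f z)%E])
    & (* extremality of the family f_a, asymptotically as a tends to 1 *)
      [/\ (forall a : R, 0 <= a < 1 -> classB (blaschke a)),
          bohr_G2 (bohr_lambda R) (blaschke a) (- (bohr_radius R)%:C)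
            @[a --> 1^'-] --> 1%:E
        & (1 - fine (bohr_G2 (bohr_lambda R) (blaschke a)
                       (- (bohr_radius R)%:C))) / (1 - a) ^+ 2
            @[a --> 1^'-] --> (0 : R)]].
Proof.
have rb := bohr_radius_bounds R; have l0 := bohr_lambda_ge0 R.
have p0 := pi_gt0 R.
have near_eq (a : R) : 0 <= a < 1 ->
    bohr_G2 (bohr_lambda R) (blaschke a) (- (bohr_radius R)%:C) =
    (bohr_bound (bohr_lambda R) a (bohr_radius R))%:E.
  by move=> aa; apply: blaschke_G2 => //; lra.
have area_lt (a r : R) : 0 <= a < 1 -> 0 < r < 1 -> (image_area (blaschke a) r < pi%:E)%E.
  move=> aa rr; rewrite blaschke_area// lte_fin.
  have x01 : 0 <= a ^+ 2 <= 1 by rewrite sqr_ge0 exprn_ile1//; lra.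
  have r01 : 0 <= r < 1 by lra.
  have [/andP[_ h] _] := bohr_area_bound_lt1 x01 r01.
  by rewrite gtr_pMr.
have cz (r : R) : 0 < r -> cmod (- r%:C : cplx R) = r by move=> r0; rewrite cmodN cmod_real gtr0_norm.
split.
- move=> f Bf z zr.
  have z0 := cmod_ge0 z.
  have z1 : cmod z < 1 by lra.
  have z2 : 2 * cmod z <= 1 - cmod z ^+ 2.
    have : cmod z ^+ 2 <= (1 / 3) ^+ 2 by rewrite lerXn2r ?nnegrE//; lra.
    lra.
  have [h1 [a aa h2]] := bohr_G2_le l0 Bf z1 z2; split => //.
  apply: le_trans h2 _; rewrite lee_fin.
  (* Monotonicity in r reduces the claim to the critical radius. *)
  apply: (@le_trans _ _ (bohr_bound (bohr_lambda R) a (bohr_radius R))).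
    by apply: bohr_bound_le => //; lra.
  by have /andP[h _] := bohr_defect_le aa; rewrite subr_ge0 in h.
(* The cap 1 / 3 exceeds the critical radius and keeps r inside the disc however large rho is. *)
- move=> rho hrho; pose r := Num.min rho (1 / 3).
  have r1 : r <= 1 / 3 by rewrite /r ge_min lexx orbT.
  have r2 : r <= rho by rewrite /r ge_min lexx.
  have r3 : bohr_radius R < r by rewrite /r lt_min hrho /=; lra.
  have rr : 0 < r < 1 by lra.
  have rs : 1 < 2 * r ^+ 2 + 3 * r.
    have := bohr_radius_eq R.
    have : bohr_radius R ^+ 2 < r ^+ 2 by rewrite ltrXn2r ?nnegrE//; lra.
    lra.
  have [a aa ha] := bohr_radius_sharp l0 rr rs.
  have r0 : 0 < r by lra.
  exists (blaschke a), (- r%:C); rewrite /unit_disk /= cz//; split.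
  + exact: blaschke_classB.
  + by split => //; lra.
  + exact: area_lt.
  + by rewrite blaschke_G2// lte_fin.
- move=> lam hl; have [a aa ha] := bohr_lambda_sharp hl.
  have r0 : 0 < bohr_radius R by lra.
  exists (blaschke a), (- (bohr_radius R)%:C); rewrite cz//; split.
  + exact: blaschke_classB.
  + exact: lexx.
  + by apply: area_lt => //; lra.
  + by rewrite blaschke_G2 ?lte_fin//; lra.
- have nr : \forall a \near (1 : R)^'-, 0 <= a < 1.
    near=> a; apply/andP; split; last by near: a; exact: nbhs_left_lt.
    by apply: ltW; near: a; exact: nbhs_left_gt.
  split.
  + by move=> a; exact: blaschke_classB.
  + have H : (bohr_bound (bohr_lambda R) a (bohr_radius R))%:E @[a --> (1 : R)^'-] --> 1%:E.
      by apply: cvg_EFin; [exact: nearW|exact: bohr_bound_cvg].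
    apply: cvg_trans H; apply: near_eq_cvg.
    by move: nr; apply: filterS => a aa; rewrite near_eq.
  + apply: cvg_trans (@bohr_defect_cvg R); apply: near_eq_cvg.
    by move: nr; apply: filterS => a aa; rewrite near_eq.
Unshelve. all: by end_near. Qed.
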